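(* Let $t>0$ be fixed, let $B=\{B_s\}_{s\ge 0}$ and $\beta=\{\beta(s)\}_{s\ge 0}$ be one-dimensional standard Brownian motions, and suppose that $B$ and $\beta$ are independent. Then, for every fixed $x\in\mathbb{R}$, the process $$\mathbb{T}_{x+B_t-\operatorname{Argsh}\left(e^{B_t}\sinh x+\beta(A_t)\right)}(B)(s),\quad 0\le s\le t,$$ is identical in law with $\{B_s\}_{0\le s\le t}$.
   Context: For a continuous function $\phi$ on $[0,t]$ (or on $[0,\infty)$) put $A_s(\phi)=\int_0^s e^{2\phi_u}\,du$, and write $A_s=A_s(B)$. For $z\in\mathbb{R}$, the path transformation $\mathbb{T}_z:C([0,t];\mathbb{R})\to C([0,t];\mathbb{R})$ is defined by $$\mathbb{T}_z(\phi)(s)=\phi_s-\log\left\{1+\frac{A_s(\phi)}{A_t(\phi)}(e^z-1)\right\},\quad 0\le s\le t.$$ In the claim, the (random) value of the subscript is substituted for $z$, and $\mathbb{T}_z$ is applied to the path $\{B_s\}_{0\le s\le t}$. $\operatorname{Argsh} x=\log(x+\sqrt{1+x^2})$, $x\in\mathbb{R}$, is the inverse function of $\sinh$. Brownian motions start from $0$. The space $C([0,t];\mathbb{R})$ of real-valued continuous functions on $[0,t]$ carries the topology of uniform convergence and its Borel $\sigma$-field. *)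

(* Defs.v *)
From HB Require Import structures.
From mathcomp Require Import all_boot all_order all_algebra.
From mathcomp Require Import all_classical all_reals all_analysis.
From mathcomp Require Import lra.

Set Implicit Arguments.
Unset Strict Implicit.
Unset Printing Implicit Defensive.

Import Order.TTheory GRing.Theory Num.Theory.
Import numFieldNormedType.Exports.

Local Open Scope classical_set_scope.
Local Open Scope ring_scope.

Definition Cspace (R : realType) (t : R) : Type :=
  continuousType (set_type (`[0, t] : set R)) R.

HB.instance Definition _ (R : realType) (t : R) := Choice.on (Cspace t).

Definition Cspace_fun (R : realType) (t : R) (phi : Cspace t)
  : set_type (`[0, t] : set R) -> R := @Continuous.sort _ _ phi.
Coercion Cspace_fun : Cspace >-> Funclass.

Lemma Cspace_continuous (R : realType) (t : R) (phi : Cspace t) :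
  continuous phi.
Proof. exact: (@cts_fun _ _ phi). Qed.

HB.instance Definition _ (R : realType) (t : R) :=
  Uniform.copy (Cspace t) (initial_topology
    (@Cspace_fun R t :
       Cspace t -> {uniform set_type (`[0, t] : set R) -> R})).

Definition mkCspace (R : realType) (t : R)
    (f : set_type (`[0, t] : set R) -> R) (cf : continuous f) : Cspace t :=
  (mkcts cf : continuousType (set_type (`[0, t] : set R)) R).

HB.instance Definition _ (R : realType) (t : R) :=
  isPointed.Build (Cspace t) (mkCspace (fun x => @cst_continuous _ _ 0 x)).

Definition borel (X : ptopologicalType) := g_sigma_algebraType (@open X).

HB.instance Definition _ (X : ptopologicalType) :=
  Measurable.on (borel X).

Section path_transform.
Context {R : realType}.

Definition sinh (x : R) : R := (expR x - expR (- x)) / 2.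

Definition Argsh (x : R) : R := ln (x + Num.sqrt (1 + x ^+ 2)).

(* The functional A_s(phi); only the values of phi on [0,s] matter. *)
Definition expA (phi : R -> R) (s : R) : R :=
  \int[@lebesgue_measure R]_(u in `[0, s]) expR (2 * phi u).

(* Extension of a path on [0,t] by 0; its values outside [0,t] are never used. *)
Definition extend (t : R) (phi : Cspace t) : R -> R := 'valL_ 0 phi.

Lemma extendE (t : R) (phi : Cspace t) (s : set_type (`[0, t] : set R)) :
  extend phi (set_val s) = phi s.
Proof. exact: (congr1 (@^~ s) (@valLK _ _ 0 _ (Cspace_fun phi))). Qed.

Lemma extend_continuous (t : R) (phi : Cspace t) :
  {within `[0, t], continuous (extend phi)}.
Proof. apply/subspace_valL_continuousP'; exact: Cspace_continuous. Qed.

Lemma expA_integrable (t : R) (phi : R -> R) :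
  {within `[0, t], continuous phi} ->
  (@lebesgue_measure R).-integrable `[0, t]
    (EFin \o (fun u => expR (2 * phi u))).
Proof.
move=> cphi; apply: continuous_compact_integrable.
  exact: segment_compact.
move=> x; apply: continuous_comp; last exact: continuous_expR.
by apply: continuousM; [exact: cst_continuous|exact: cphi].
Qed.

Lemma expA_continuous (t : R) (phi : R -> R) : 0 <= t ->
  {within `[0, t], continuous phi} -> {within `[0, t], continuous (expA phi)}.
Proof.
move=> t0 cphi; apply: parameterized_integral_continuous => //.
exact: expA_integrable.
Qed.

Lemma expA_ge0 (phi : R -> R) (s : R) : 0 <= expA phi s.
Proof. by apply: Rintegral_ge0 => x _; exact: expR_ge0. Qed.

Lemma expA_le (t : R) (phi : R -> R) (s : R) :
  {within `[0, t], continuous phi} -> s <= t -> expA phi s <= expA phi t.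
Proof.
move=> cphi st; have iphi := expA_integrable cphi.
have sub : (`[0, s] : set R) `<=` `[0, t].
  by move=> u /=; rewrite !in_itv/= => /andP[-> /le_trans->].
apply: fine_le.
- apply: integrable_fin_num => //; exact: integrableS iphi.
- exact: integrable_fin_num.
- apply: ge0_subset_integral => //; exact: (measurable_int _ iphi).
Qed.

Definition transform_fun (t z : R) (phi : Cspace t)
    (s : set_type (`[0, t] : set R)) : R :=
  phi s - ln (1 + expA (extend phi) (set_val s) / expA (extend phi) t
                  * (expR z - 1)).

Lemma transform_arg_gt0 (t z : R) (phi : Cspace t)
    (s : set_type (`[0, t] : set R)) :
  0 < 1 + expA (extend phi) (set_val s) / expA (extend phi) t * (expR z - 1).
Proof.
set a := expA _ (set_val s); set b := expA _ t.
have ab : a <= b.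
  apply: expA_le; first exact: extend_continuous.
  by have := set_valP s; rewrite /= in_itv/= => /andP[].
have r0 : 0 <= a / b by rewrite divr_ge0 ?expA_ge0.
have r1 : a / b <= 1.
  have [->|b0] := eqVneq b 0; first by rewrite invr0 mulr0.
  by rewrite ler_pdivrMr ?mul1r// lt_def b0 expA_ge0.
have ez := expR_gt0 z.
by move: r0 r1; set r := a / b => r0 r1; nra.
Qed.

Lemma transform_continuous (t z : R) (phi : Cspace t) :
  continuous (transform_fun z phi).
Proof.
have [t0|t0] := leP 0 t; last first.
  move=> s; exfalso; have := set_valP s.
  by rewrite /= in_itv/= => /andP[/le_trans/[apply]]; rewrite leNgt t0.
move=> s; apply: continuousB; first exact: Cspace_continuous.
apply: continuous_comp; last first.
  by apply: continuous_ln; exact: transform_arg_gt0.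
apply: continuousD; first exact: cst_continuous.
apply: continuousM; last exact: cst_continuous.
apply: continuousM; last exact: cst_continuous.
have /subspace_sigL_continuousP := expA_continuous t0 (@extend_continuous t phi).
exact.
Qed.

Definition transform (t z : R) (phi : Cspace t) : Cspace t :=
  mkCspace (@transform_continuous t z phi).

End path_transform.

Section processes.
Context {R : realType} {d : measure_display} {T : measurableType d}.

(* A real process indexed by [0,oo) all of whose paths are continuous; its values
   at negative times are irrelevant. *)
Record continuous_process := ContinuousProcess {
  process_fun :> R -> T -> R ;
  process_measurable : forall s, 0 <= s -> measurable_fun setT (process_fun s) ;
  process_continuous : forall w,
    {within `[0, +oo[, continuous (fun s => process_fun s w)} }.

Lemma process_path_continuous (t : R) (X : continuous_process) (w : T) :
  continuous (sigL `[0, t] (fun s => X s w)).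
Proof.
apply/subspace_sigL_continuousP.
apply: continuous_subspaceW (@process_continuous X w).
by move=> s /=; rewrite !in_itv/= => /andP[->].
Qed.

Definition process_path (t : R) (X : continuous_process) (w : T) : Cspace t :=
  mkCspace (@process_path_continuous t X w).

Definition process_sigma (I : set R) (X : R -> T -> R) : set (set T) :=
  <<s \bigcup_(s in I) g_sigma_algebra_preimage (X s) >>.

Variable P : probability T R.

Definition independent_classes (F G : set (set T)) : Prop :=
  forall E E', F E -> G E' -> P (E `&` E') = (P E * P E')%E.

Definition independent_processes (X Y : R -> T -> R) : Prop :=
  independent_classes (process_sigma `[0, +oo[ X) (process_sigma `[0, +oo[ Y).

Definition increment (X : R -> T -> R) (s u : R) (w : T) : R := X u w - X s w.

(* normal_prob takes the mean and the standard deviation. *)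
Definition brownian_motion (B : continuous_process) : Prop :=
  [/\ {ae P, forall w, B 0 w = 0},
      forall s u, 0 <= s < u ->
        independent_classes (process_sigma `[0, s] B)
          (g_sigma_algebra_preimage (increment B s u)) &
      forall s u, 0 <= s < u -> forall V : set R, measurable V ->
        pushforward P (increment B s u) V = normal_prob 0 (Num.sqrt (u - s)) V].

Definition identical_in_law (X : ptopologicalType) (Y Z : T -> X) : Prop :=
  [/\ measurable_fun setT (Y : T -> borel X),
      measurable_fun setT (Z : T -> borel X) &
      forall E : set (borel X), measurable E ->
        pushforward P (Y : T -> borel X) E = pushforward P (Z : T -> borel X) E].

End processes.
Arguments continuous_process R {d} T.

(* Main.v *)
Require Import Defs.
From mathcomp Require Import all_boot all_order all_algebra.
From mathcomp Require Import all_classical all_reals all_analysis.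
From mathcomp Require Import measurable_realfun.
From HB Require Import structures.
From mathcomp Require Import lra ring.

Set Implicit Arguments.
Unset Strict Implicit.
Unset Printing Implicit Defensive.

Import Order.TTheory GRing.Theory Num.Theory.
Import numFieldNormedType.Exports.

Local Open Scope classical_set_scope.
Local Open Scope ring_scope.

(** For real [c] let [dilate c phi] be the path phi_s - log(1 + c A_s(phi)), where 1 + c A_t(phi) >
    0; it is [transform z phi] with z = log(1 + c A_t(phi)). Since A(dilate c phi) = A / (1 + c A)
    ([dilate_expA]), the dilation of parameter -c undoes that of parameter c ([dilateK]).

    Three facts carry the proof. First, Wiener measure is quasi-invariant under dilations:
    E[F(B); 1 + c A_t > 0] = E[F(dilate (-c) B) D_c(B)], where D_c is [dilate_density c], that is (1
    - c A_t)^-1 exp(-(c/2)(e^{2 B_t} / (1 - c A_t) - 1)) on c A_t < 1 and 0 elsewhere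
    ([brownian_dilate_signed]). Second, by independence beta(A_t) is, given B, a centred Gaussian
    variable of variance A_t ([integral_random_time]), so the transformed path is dilate c B for a
    random c whose conditional density q(c, B) is explicit ([ge0_integral_tau]). Third, for every
    path phi the integral over c of q(c, dilate (-c) phi) D_c(phi) equals 1 ([tau_density_mass]).
    With Tonelli, the expectation of F at the transformed path is the integral over c of
    E[F(dilate c B) q(c, B); 1 + c A_t > 0] = E[F(B) q(c, dilate (-c) B) D_c(B)], and integrating
    out c leaves E F(B) ([random_transform_product]).

    Quasi-invariance for c > 0 comes from a change of variables in finitely many Gaussian
    increments. Along a dyadic walk psi each increment y becomes y + k (e^{2y} - 1) / (2y), where k
    discretizes c e^{2 psi} ds / (1 - c A). With a suitable update of a ~ 1 / (1 - c A), the ratio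
    of Gaussian densities is exactly the exponential of an increment of the potential (c/2) e^{2
    psi} a ([shift_quadratic]), so the product over the steps telescopes into an exact identity
    ([chain_int_transform]). As the mesh tends to 0, the new walk tends to dilate (-c) B and the
    Jacobian to 1 / (1 - c A_t), path by path ([cvg_path_weight]). Bounded convergence applies
    because the cutoff weight [cutw] keeps all integrands in [0, 1]; it leaves a factor exp(-6 c
    A_t), cancelled in [brownian_dilate]. Negative c follows by inversion.

    Laws on the path space are compared through products of continuous functions of the values at
    dyadic times ([Cspace_weighted_law_unique]). *)

(** * Measures with a density and change of variables on the line *)

Section density_measure.
Context {d : measure_display} {T : measurableType d} {R : realType}.
Variables (mu : {measure set T -> \bar R}) (w : T -> R).
Hypotheses (mw : measurable_fun setT w) (w0 : forall x, 0 <= w x).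
Local Open Scope ereal_scope.

Definition density_measure (_ : measurable_fun setT w) (_ : forall x, (0 <= w x)%R)
  (V : set T) : \bar R := \int[mu]_(x in V) (w x)%:E.

Local Notation nu := (density_measure mw w0).

Let density0 : nu set0 = 0. Proof. by rewrite /nu integral_set0. Qed.

Let density_ge0 V : 0 <= nu V.
Proof. by apply: integral_ge0 => x _; rewrite lee_fin. Qed.

Let density_sigma_additive : semi_sigma_additive nu.
Proof.
move=> /= A mA tA mUA; rewrite /nu ge0_integral_bigcup//.
- apply: is_cvg_ereal_nneg_natsum_cond => n _ _.
  by apply: integral_ge0 => x _; rewrite lee_fin.
- by apply/measurable_EFinP; exact: measurable_funTS.
- by move=> x _; rewrite lee_fin.
Qed.

HB.instance Definition _ := isMeasure.Build _ _ _ nu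
  density0 density_ge0 density_sigma_additive.

Import HBNNSimple.

(** For multiples of indicators this is the definition of the measure; simple functions follow by
    linearity, and the general case by monotone convergence along [nnsfun_approx]. *)
Lemma ge0_integral_density (f : T -> \bar R) :
  measurable_fun setT f -> (forall x, 0 <= f x) ->
  \int[nu]_x f x = \int[mu]_x (f x * (w x)%:E).
Proof.
move=> mf f0; pose f_ := nnsfun_approx measurableT mf.
have ff x : EFin \o f_ ^~ x @ \oo --> f x.
  exact: (cvg_nnsfun_approx measurableT mf).
transitivity (limn (fun n => \int[nu]_x (f_ n x)%:E)).
  rewrite -monotone_convergence//.
  - by apply: eq_integral => y _; apply/esym/cvg_lim => //; exact: ff.
  - by move=> n; exact/measurable_EFinP/measurable_funP.
  - by move=> n y _; rewrite lee_fin.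
  - by move=> y _ m n mn; rewrite lee_fin; exact/lefP/nd_nnsfun_approx.
rewrite (_ : (fun n => _) = (fun n => \int[mu]_x ((f_ n x)%:E * (w x)%:E))).
  rewrite -monotone_convergence//; last 3 first.
    - move=> n; apply: emeasurable_funM; exact/measurable_EFinP.
    - by move=> n x _ /=; rewrite mule_ge0 ?lee_fin.
    - move=> x _ m n mn; rewrite lee_wpmul2r ?lee_fin//.
      exact/lefP/nd_nnsfun_approx.
  apply: eq_integral => x _; apply/cvg_lim => //.
  by apply: cvgeZr => //; exact: ff.
apply/funext => n.
transitivity (\sum_(k \in range (f_ n))
    \int[nu]_x (k * \1_(f_ n @^-1` [set k]) x)%:E).
  under eq_integral do rewrite fimfunE -fsumEFin//.
  rewrite ge0_integral_fsum//.
  - by move=> y; exact/measurable_EFinP/measurable_funM.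
  - by move=> y x _; rewrite nnfun_muleindic_ge0.
transitivity (\sum_(k \in range (f_ n))
    \int[mu]_x ((k * \1_(f_ n @^-1` [set k]) x)%:E * (w x)%:E)).
  apply: eq_fsbigr => k /[!inE] -[x _ fx].
  have k0 : (0 <= k)%R by rewrite -fx.
  rewrite integralZl_indic_nnsfun//= integral_indic// setIT.
  under [RHS]eq_integral do rewrite EFinM -muleA.
  rewrite ge0_integralZl//; last 2 first.
  - apply: emeasurable_funM; last exact/measurable_EFinP.
    exact/measurable_EFinP/measurable_indic.
  - by move=> y _; rewrite mule_ge0 ?lee_fin.
  congr (_ * _); rewrite /density_measure [LHS]integral_mkcond.
  by apply: eq_integral => y _; rewrite epatch_indic muleC.
rewrite -ge0_integral_fsum//.
- apply: eq_integral => x _.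
  rewrite -ge0_mule_fsuml => [|y]; last exact: nnfun_muleindic_ge0.
  by rewrite fsumEFin// -fimfunE.
- move=> r; apply: emeasurable_funM; last exact/measurable_EFinP.
  exact/measurable_EFinP/measurable_funM.
- move=> r x _; apply: mule_ge0; last by rewrite lee_fin.
  exact: nnfun_muleindic_ge0.
Qed.

End density_measure.

Section substitution.
Context {R : realType}.
Local Notation mu := (@lebesgue_measure R).
Local Open Scope ereal_scope.

(** The image under [F] of the measure with density [F'] on [D] is Lebesgue measure: by the
    fundamental theorem of calculus on [[Fi a, Fi b]], which lies in the interval [D], it gives mass
    b - a to []a, b]]. An arbitrary interval [D] and an explicit inverse [Fi] allow for the
    half-lines of admissible dilation parameters. *)
Lemma ge0_substitution_increasing (D : set R) (F F' Fi : R -> R)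
    (G : R -> \bar R) : measurable D -> is_interval D ->
  {in D &, {homo F : x y / (x < y)%R}} ->
  (forall x, D x -> is_derive x 1%R F (F' x)) ->
  {within D, continuous F'} -> (forall x, D x -> (0 <= F' x)%R) ->
  (forall y, D (Fi y)) -> (forall y, F (Fi y) = y) ->
  measurable_fun setT F -> measurable_fun setT F' ->
  measurable_fun setT G -> (forall x, 0 <= G x) ->
  \int[mu]_x G x = \int[mu]_(x in D) (G (F x) * (F' x)%:E).
Proof.
move=> mD iD Fincr dF cF' F'0 DFi FK mF mF' mG G0.
pose w := (F' \_ D)%R.
have mw : measurable_fun setT w.
  by rewrite -measurable_restrictT//; exact: measurable_funTS.
have w0 x : (0 <= w x)%R.
  by rewrite /w patchE; case: ifPn => // /set_mem/F'0.
have Fle x y : D x -> D y -> (F x <= F y)%R = (x <= y)%R.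
  move=> Dx Dy; apply/idP/idP => [|]; last first.
    rewrite le_eqVlt => /predU1P[->//|xy].
    by apply/ltW/Fincr => //; exact: mem_set.
  rewrite !leNgt; apply: contra => yx; apply: Fincr => //; exact: mem_set.
have Flt x y : D x -> D y -> (F x < F y)%R = (x < y)%R.
  by move=> Dx Dy; rewrite !ltNge Fle.
pose nu := pushforward (density_measure mu mw w0) (F : _ -> measurableTypeR R).
have -> : \int[mu]_x G x = \int[nu]_x G x.
  apply: eq_measure_integral => /= A mA _.
  apply: (@lebesgue_measure_unique _ nu) mA => //= _ [[a b] _ <-] /=.
  rewrite lebesgue_measure_itv/= lte_fin /pushforward /density_measure.
  rewrite integral_mkcond; case: ifPn => [ab|]; last first.
    rewrite -leNgt => ba; apply/esym; apply: integral0_eq => x _.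
    rewrite patchE; case: ifPn => // /set_mem/=.
    by rewrite in_itv/= => /andP[/lt_le_trans/[apply]]; rewrite ltNge ba.
  have uv : (Fi a < Fi b)%R by rewrite -Flt// !FK.
  have uvD x : (Fi a <= x <= Fi b)%R -> D x.
    by move=> /andP[ax xb]; apply: (iD (Fi a) (Fi b)) => //; rewrite ax.
  have FD x : D x -> (a < F x <= b)%R = (Fi a < x <= Fi b)%R.
    by move=> Dx; rewrite -{1}(FK a) -{1}(FK b) Flt// Fle.
  transitivity (\int[mu]_(x in `]Fi a, Fi b]) (F' x)%:E).
    rewrite integral_itv_obnd_cbnd; last first.
      exact/measurable_EFinP/measurable_funTS.
    rewrite (@continuous_FTC2 _ F' F)// ?FK ?EFinB//.
    - apply: continuous_subspaceW cF' => x /=; rewrite in_itv/=; exact: uvD.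
    - have Fc x : D x -> {for x, continuous F}.
        move=> Dx; apply/differentiable_continuous/derivable1_diffP.
        by have [] := dF _ Dx.
      split.
      + move=> x; rewrite in_itv/= => /andP[/ltW ax /ltW xb].
        by have [] // : is_derive x 1%R F (F' x) by apply/dF/uvD; rewrite ax.
      + by apply: cvg_at_right_filter; exact: Fc.
      + by apply: cvg_at_left_filter; exact: Fc.
    - move=> x; rewrite in_itv/= => /andP[/ltW ax /ltW xb].
      rewrite derive1E.
      by have [] // : is_derive x 1%R F (F' x) by apply/dF/uvD; rewrite ax.
  rewrite [LHS]integral_mkcond; apply: eq_integral => x _.
  rewrite !patchE /w patchE; case: (pselect (D x)) => Dx; last first.
    rewrite memNset//; last first.
      by rewrite /= in_itv/= => /andP[/ltW ax xb]; apply: Dx; apply: uvD; rewrite ax.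
    by rewrite (memNset Dx) /=; case: ifP.
  rewrite (mem_set Dx); congr (if _ then _ else _).
  by apply/idP/idP => /set_mem xx; apply/mem_set; move: xx; rewrite /= !in_itv/= FD.
rewrite ge0_integral_pushforward//=.
rewrite preimage_setT ge0_integral_density//=; last exact: measurableT_comp.
rewrite [RHS]integral_mkcond; apply: eq_integral => x _.
by rewrite /w !patchE; case: ifP => //; rewrite mule0.
Qed.

Lemma ge0_integralNT (f : R -> \bar R) : measurable_fun setT f ->
  (forall x, 0 <= f x) -> \int[mu]_x f x = \int[mu]_x f (- x)%R.
Proof.
move=> mf f0.
have -> : \int[mu]_x f (- x)%R =
    \int[pushforward mu (-%R : _ -> measurableTypeR R)]_x f x.
  by rewrite ge0_integral_pushforward.
by apply: eq_measure_integral => A mA _; exact/esym/lebesgue_measureN.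
Qed.

End substitution.

(** * The function (e^w - 1) / w *)

Section exponential_quotient.
Context {R : realType}.
Implicit Types x y w h : R.

(** This is the integral of e^{u w} for u in [0, 1]; the value at 0 removes the singularity. *)
Definition expq w : R := if w == 0 then 1 else (expR w - 1) / w.

Definition expq' w : R :=
  if w == 0 then 2^-1 else (expR w * (w - 1) + 1) / w ^+ 2.

Lemma expqM w : expq w * w = expR w - 1.
Proof.
rewrite /expq; case: eqVneq => [->|w0]; last by rewrite divfK.
by rewrite mulr0 expR0 subrr.
Qed.

Lemma expq_gt0 w : 0 < expq w.
Proof.
rewrite /expq; case: eqVneq => // w0.
have [wn|wp|w00] := ltgtP w 0; last by rewrite w00 eqxx in w0.
- by rewrite nmulr_lgt0 ?invr_lt0// subr_lt0 -expR0 ltr_expR.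
- by rewrite divr_gt0// subr_gt0 -[ltLHS]expR0 ltr_expR.
Qed.

Lemma expR_1BM_le w : expR w * (1 - w) <= 1.
Proof.
rewrite -[leRHS](expRxMexpNx_1 w) ler_pM2l ?expR_gt0//.
exact: expR_ge1Dx.
Qed.

Lemma expq_le w M : w <= M -> 0 <= M -> expq w <= expR M.
Proof.
move=> wM M0; rewrite /expq; case: eqVneq => [_|w0].
  by rewrite -expR0 ler_expR.
have [wn|wp|w00] := ltgtP w 0; last by rewrite w00 eqxx in w0.
- apply: (@le_trans _ _ 1); last by rewrite -expR0 ler_expR.
  by rewrite ler_ndivrMr// mul1r lerBrDl expR_ge1Dx.
- apply: (@le_trans _ _ (expR w)); last by rewrite ler_expR.
  by rewrite ler_pdivrMr//; have := expR_1BM_le w; lra.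
Qed.

Lemma expq'_ge0 w : 0 <= expq' w.
Proof.
rewrite /expq'; case: eqVneq => [_|w0]; first by rewrite invr_ge0.
by rewrite divr_ge0 ?sqr_ge0//; have := expR_1BM_le w; lra.
Qed.

(** After clearing w^2 this is 1 + w <= e^w. It lets the Jacobian of a step be bounded in terms of
    its jump. *)
Lemma expq'_le w : expq' w <= expq w.
Proof.
rewrite /expq' /expq; case: eqVneq => [_|w0]; first by lra.
rewrite ler_pdivrMr ?exprn_even_gt0// expr2 mulrA divfK//.
by have := expR_ge1Dx w; lra.
Qed.

Lemma expR_taylor2 h : `|h| <= 2^-1 ->
  `|expR h - 1 - h - h ^+ 2 / 2| <= 2 * `|h| ^+ 3.
Proof.
move=> h2; pose r x : R := expR x - 1 - x - x ^+ 2 / 2.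
have dr x : is_derive x 1 r (expR x - 1 - x).
  rewrite /r; apply: is_derive_eq.
  by rewrite !scaler1 /GRing.scale/=; lra.
have cr : continuous r.
  by move=> x; apply/differentiable_continuous/derivable1_diffP; case: (dr x).
have r0 : r 0 = 0 by rewrite /r expR0; lra.
have b c : `|c| <= `|h| -> `|expR c - 1 - c| <= 2 * `|h| ^+ 2.
  move=> ch; have c2 := le_trans ch h2.
  have cs : c ^+ 2 <= `|h| ^+ 2.
    by rewrite -(real_normK (num_real c)) ler_pXn2r ?nnegrE.
  have g1 := expR_ge1Dx c; have g2 := expR_1BM_le c.
  move: c2; rewrite ler_norml => /andP[c2 c3].
  rewrite ger0_norm; last by lra.
  by nra.
(* The mean value theorem trades the second-order remainder at [h] for [h] times a first-order
   remainder, which the elementary bounds 1 + c <= e^c and e^c (1 - c) <= 1 control. *)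
suff : exists2 c, `|c| <= `|h| & r h = (expR c - 1 - c) * h.
  case=> c ch; rewrite -/(r h) => ->; rewrite normrM [leRHS](_ : _ = 2 * `|h| ^+ 2 * `|h|); last by ring.
  by rewrite ler_wpM2r// b.
have [hn|hp|->] := ltgtP h 0.
- have [c|c /[!in_itv]/= /andP[c1 c2] e] := @MVT _ r (fun x => expR x - 1 - x) _ _ hn.
    exact: continuous_subspaceT.
  exists c; first by rewrite !ltr0_norm// lerN2 ltW.
  by move: e; rewrite r0; lra.
- have [c|c /[!in_itv]/= /andP[c1 c2] e] := @MVT _ r (fun x => expR x - 1 - x) _ _ hp.
    exact: continuous_subspaceT.
  exists c; first by rewrite !gtr0_norm// ltW.
  by move: e; rewrite r0; lra.
- by exists 0 => //; rewrite r0 mulr0.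
Qed.

Lemma expq_taylor1 h : h != 0 -> `|h| <= 2^-1 ->
  `|(expq h - 1) / h - 2^-1| <= 2 * `|h|.
Proof.
move=> h0 hh; have hp : 0 < `|h| by rewrite normr_gt0.
rewrite -(ler_pM2r (exprn_gt0 2 hp)) -normrX -normrM.
rewrite [leRHS](_ : _ = 2 * `|h| ^+ 3); last by rewrite normrX; ring.
have := expR_taylor2 hh; rewrite (_ : _ - h ^+ 2 / 2 =
  ((expq h - 1) / h - 2^-1) * h ^+ 2)//.
rewrite /expq (negbTE h0); field.
by [].
Qed.

Lemma expq'_taylor0 h : `|h| <= 2^-1 -> `|expq' h - 2^-1| <= 4 * `|h|.
Proof.
move=> hh; rewrite /expq'; case: eqVneq => [->|h0].
  by rewrite subrr normr0 mulr0.
have hp : 0 < `|h| by rewrite normr_gt0.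
rewrite -(ler_pM2r (exprn_gt0 2 hp)) -normrX -normrM.
have e := expR_taylor2 hh.
pose r := expR h - 1 - h - h ^+ 2 / 2.
rewrite (_ : _ * h ^+ 2 = h ^+ 3 / 2 + (h - 1) * r); last first.
  by rewrite /r; field.
apply: le_trans (ler_normD _ _) _; rewrite !normrM.
rewrite normfV (@ger0_norm _ 2)//.
have : `|h - 1| <= 3 / 2.
  by move: hh; rewrite !ler_norml => /andP[? ?]; apply/andP; split; lra.
move: e; rewrite -/r; have := normr_ge0 r; have := normr_ge0 (h - 1).
set u := `|r|; set v := `|h - 1|; set s := `|h| => v0 u0 us v3.
have s0 : 0 <= s by exact: normr_ge0.
have : v * u <= 3 / 2 * (2 * s ^+ 3) by apply: ler_pM.
have : 0 <= s ^+ 3 by exact: exprn_ge0.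
by rewrite !exprS expr0 mulr1; lra.
Qed.

Lemma continuous_expq' : continuous expq'.
Proof.
move=> w; have [->|w0] := eqVneq w 0.
  have e'0 : expq' 0 = 2^-1 by rewrite /expq' eqxx.
  suff : expq' h @[h --> (0 : R)] --> (2^-1 : R) by rewrite -e'0.
  apply/cvgrPdist_le => e e0; near=> h; rewrite distrC; apply: le_trans (expq'_taylor0 _) _.
    near: h; exists 2^-1 => //= x /=.
    by rewrite sub0r normrN => /ltW.
  rewrite -ler_pdivlMl//; near: h; exists (4^-1 * e) => [|x] /=.
    by rewrite mulr_gt0.
  by rewrite sub0r normrN => /ltW.
pose f x : R := (expR x * (x - 1) + 1) / x ^+ 2.
have cf : {for w, continuous f}.
  apply: cvgM.
    apply: cvgD; last exact: cvg_cst.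
    apply: cvgM; first exact: continuous_expR.
    by apply: cvgB; [exact: cvg_id|exact: cvg_cst].
  apply: cvgV; first by rewrite expf_neq0.
  exact: exprn_continuous.
rewrite /continuous_at [expq' w](_ : _ = f w); last first.
  by rewrite /expq' (negbTE w0).
apply: cvg_trans cf; apply: near_eq_cvg; near=> x.
rewrite /f /expq' ifN//; near: x.
by apply: (cvgr_neq0 w) => //; exact: cvg_id.
Unshelve. all: by end_near. Qed.

Lemma is_derive_expq w : is_derive w 1 expq (expq' w).
Proof.
have [->|w0] := eqVneq w 0.
  have e0 : expq 0 = 1 by rewrite /expq eqxx.
  have e'0 : expq' 0 = 2^-1 by rewrite /expq' eqxx.
  have lim : h^-1 *: (expq (h *: 1 + 0) - expq 0) @[h --> 0^'] --> expq' 0.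
    apply/cvgrPdist_le => e ep; rewrite e'0.
    near=> h; rewrite distrC addr0 /GRing.scale/= mulr1 e0 mulrC.
    have h0 : h != 0 by near: h; exact: nbhs_dnbhs_neq.
    apply: le_trans (expq_taylor1 h0 _) _.
      by near: h; apply: dnbhs0_le.
    by rewrite -ler_pdivlMl//; near: h; apply: dnbhs0_le; rewrite mulr_gt0.
  split; first by apply/cvg_ex; exists (expq' 0).
  exact: cvg_lim.
pose f x : R := (expR x - 1) / x.
have df : is_derive w 1 f (expq' w).
  have dV : is_derive w 1 (fun x : R => x^-1) (- w ^- 2 *: 1).
    exact: (@is_deriveV _ id).
  apply: is_derive_eq.
  by rewrite /expq' (negbTE w0) /GRing.scale/=; field.
apply: near_eq_is_derive df; near=> x.
rewrite /f /expq ifN//; near: x.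
by apply: (cvgr_neq0 w) => //; exact: cvg_id.
Unshelve. all: by end_near. Qed.

End exponential_quotient.

(** * Change of variables in one Gaussian increment *)

Section gaussian_step.
Context {R : realType}.
Local Notation mu := (@lebesgue_measure R).

Lemma ge0_integral_normal_prob (m s : R) (f : R -> \bar R) :
  measurable_fun setT f -> (forall x, (0 <= f x)%E) ->
  (\int[normal_prob m s]_x f x = \int[mu]_x (f x * (normal_pdf m s x)%:E))%E.
Proof.
move=> mf f0.
rewrite -(ge0_integral_density mu (measurable_normal_pdf m s) (@normal_pdf_ge0 _ m s))//.
Qed.

(** The added term is [k] times the average of e^{2u} over u between 0 and [y]: a discrete form of
    d(phi) = d(psi) + c e^{2 psi} / (1 - c A) ds, which is the equation of phi = psi - log(1 - c
    A). *)
Definition shift (k y : R) : R := y + k * expq (2 * y).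
Definition shift' (k y : R) : R := 1 + 2 * k * expq' (2 * y).

Lemma is_derive_shift (k y : R) : is_derive y 1 (shift k) (shift' k y).
Proof.
have d1 : is_derive y 1 (fun x => expq (2 * x)) (expq' (2 * y) * 2).
  have d2 := is_derive_expq (2 * y).
  have d3 : is_derive y 1 (fun x : R => 2 * x) 2.
    by apply: is_derive_eq; rewrite /GRing.scale/=; ring.
  exact: (@is_derive1_comp _ expq (fun x => 2 * x)).
rewrite /shift; apply: is_derive_eq.
by rewrite /shift' /GRing.scale/=; ring.
Qed.

Lemma shift'_ge1 (k y : R) : 0 <= k -> 1 <= shift' k y.
Proof. by move=> k0; rewrite lerDl mulr_ge0 ?mulr_ge0 ?expq'_ge0. Qed.

Lemma continuous_shift (k : R) : continuous (shift k).
Proof.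
move=> x; apply/differentiable_continuous/derivable1_diffP.
by case: (is_derive_shift k x).
Qed.

Lemma continuous_shift' (k : R) : continuous (shift' k).
Proof.
move=> x; apply: cvgD; first exact: cvg_cst.
apply: cvgM; first exact: cvg_cst.
apply: continuous_comp; last exact: continuous_expq'.
by apply: cvgM; [exact: cvg_cst|exact: cvg_id].
Qed.

Lemma shift_increasing (k : R) : 0 <= k -> {homo shift k : x y / x < y}.
Proof.
move=> k0 x y xy.
have [z _ e] := MVT xy (fun z _ => is_derive_shift k z)
  (continuous_subspaceT (@continuous_shift k)).
rewrite -subr_gt0 e mulr_gt0 ?subr_gt0//.
by rewrite (lt_le_trans ltr01)// shift'_ge1.
Qed.

Lemma shift_surj (k y : R) : 0 <= k -> exists x, shift k x = y.
Proof.
(* Since [expq] is at most 1 on the nonpositive half-line, shift k a <= a + k <= y, while shift k y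
   >= y; the intermediate value theorem applies between [a] and [y]. *)
move=> k0; pose a := Num.min 0 (y - k).
have ay : a <= y by rewrite /a ge_min lerBlDr lerDl k0 orbT.
have sa : shift k a <= y.
  have a0 : a <= 0 by rewrite ge_min lexx.
  apply: (@le_trans _ _ (a + k)); last first.
    by rewrite -lerBrDr ge_min lexx orbT.
  rewrite lerD2l ler_piMr// -[leRHS]expR0; apply: expq_le => //.
  by rewrite pmulr_rle0.
have sy : y <= shift k y by rewrite lerDl mulr_ge0// ltW// expq_gt0.
have [] := @IVT _ (shift k) a y y ay.
- exact/continuous_subspaceT/continuous_shift.
- by rewrite ge_min sa/= le_max sy orbT.
- by move=> x _ e; exists x.
Qed.

(** Substitution by the increasing bijection [shift k]; the exponential is the ratio of the Gaussian
    density at [shift k y] to that at [y]. *)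
Lemma ge0_integral_shift (h k : R) (G : R -> \bar R) : 0 < h -> 0 <= k ->
  measurable_fun setT G -> (forall x, (0 <= G x)%E) ->
  (\int[normal_prob 0 (Num.sqrt h)]_x G x =
   \int[normal_prob 0 (Num.sqrt h)]_y (G (shift k y) *
     (shift' k y * expR ((y ^+ 2 - shift k y ^+ 2) / (2 * h)))%:E))%E.
Proof.
move=> h0 k0 mG G0.
have mS : measurable_fun setT (shift k).
  by apply: continuous_measurable_fun; exact: continuous_shift.
have mS' : measurable_fun setT (shift' k).
  by apply: continuous_measurable_fun; exact: continuous_shift'.
have S'0 y : 0 <= shift' k y by rewrite (le_trans ler01)// shift'_ge1.
have mE : measurable_fun setT
    (fun y : R => expR ((y ^+ 2 - shift k y ^+ 2) / (2 * h))).
  apply: measurableT_comp => //; apply: measurable_funM => //.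
  apply: measurable_funB; apply: measurable_funX => //.
have mpdf := measurable_normal_pdf (0 : R) (Num.sqrt h).
rewrite !ge0_integral_normal_prob//; last 2 first.
- apply: emeasurable_funM; first exact: measurableT_comp.
  by apply/measurable_EFinP/measurable_funM.
- by move=> y; rewrite mule_ge0// lee_fin mulr_ge0// expR_ge0.
pose Fi y := projT1 (cid (shift_surj y k0)).
rewrite (@ge0_substitution_increasing R setT (shift k) (shift' k) Fi _
  measurableT _ _ (fun x _ => is_derive_shift k x))//.
- apply: eq_integral => y _; rewrite -!muleA; congr (_ * _)%E.
  rewrite -!EFinM; congr EFin.
  rewrite normal_pdfE ?gt_eqF ?sqrtr_gt0// /normal_fun !subr0 sqr_sqrtr ?ltW//.
  rewrite (_ : expR (- shift k y ^+ 2 / (h *+ 2)) =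
    expR ((y ^+ 2 - shift k y ^+ 2) / (2 * h)) * expR (- y ^+ 2 / (h *+ 2))).
    by ring.
  by rewrite -expRD; congr expR; field; exact/lt0r_neq0.
- move=> x y _ _; exact: shift_increasing.
- exact/continuous_subspaceT/continuous_shift'.
- by move=> y; rewrite /Fi; case: cid.
- by apply: emeasurable_funM => //; exact/measurable_EFinP.
- by move=> x; rewrite mule_ge0// lee_fin normal_pdf_ge0.
Qed.

(* The increment of [a] is chosen so that the two quadratic forms differ
   exactly by the increment of the potential [c / 2 * (expR (2 * psi) * a)]. *)
Lemma shift_quadratic (c h a p y : R) : c != 0 -> h != 0 ->
  let k := c * h * a * expR (2 * p) in
  let e := k * expq (2 * y) in
  let a' := a + e ^+ 2 / (c * h * expR (2 * (p + y))) in
  (shift k y ^+ 2 - y ^+ 2) / (2 * h) =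
  c / 2 * (expR (2 * (p + y)) * a' - expR (2 * p) * a).
Proof.
move=> c0 h0 k e a'.
have e0 : expR (2 * p) != 0 by rewrite gt_eqF ?expR_gt0.
have e1 : expR (2 * y) != 0 by rewrite gt_eqF ?expR_gt0.
rewrite (_ : shift k y ^+ 2 - y ^+ 2 = k * (expq (2 * y) * (2 * y)) + e ^+ 2); last first.
  by rewrite /shift /e; ring.
rewrite expqM /a' (mulrDr 2 p) expRD.
move: (e) => e2; rewrite /k.
by field; rewrite c0 h0 e0 e1.
Qed.

End gaussian_step.

(** * Independence, and chains driven by Brownian increments *)

Section independence.
Context {R : realType} {d : measure_display} {T : measurableType d}.
Variable P : probability T R.

(** Factorization on rectangles makes the joint law the product of the marginal laws, by uniqueness
    of product measures; Tonelli does the rest. *)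
Lemma ge0_integral_independent d1 d2 (S1 : measurableType d1)
    (S2 : measurableType d2) (X : T -> S1) (Y : T -> S2) (f : S1 * S2 -> \bar R) :
  measurable_fun setT X -> measurable_fun setT Y ->
  (forall U V, measurable U -> measurable V ->
    P (X @^-1` U `&` Y @^-1` V) = (P (X @^-1` U) * P (Y @^-1` V))%E) ->
  measurable_fun setT f -> (forall x, (0 <= f x)%E) ->
  (\int[P]_w f (X w, Y w) = \int[P]_w \int[pushforward P Y]_y f (X w, y))%E.
Proof.
move=> mX mY XY mf f0.
pose X' : {mfun T >-> S1} := HB.pack X (isMeasurableFun.Build _ _ _ _ _ mX).
pose Y' : {mfun T >-> S2} := HB.pack Y (isMeasurableFun.Build _ _ _ _ _ mY).
have mXY : measurable_fun setT (fun w => (X w, Y w)).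
  exact: measurable_fun_pair.
transitivity (\int[pushforward P (fun w => (X w, Y w))]_z f z)%E.
  by rewrite ge0_integral_pushforward.
transitivity (\int[distribution P X' \x distribution P Y']_z f z)%E.
  apply: eq_measure_integral => A mA _; apply/esym.
  apply: product_measure_unique mA => U V mU mV.
  by rewrite /pushforward /= -XY.
rewrite fubini_tonelli1// /fubini_F.
rewrite [LHS]ge0_integral_distribution//.
  exact: measurable_fun_fubini_tonelli_F.
by move=> x; exact: integral_ge0.
Qed.

End independence.

Section chain.
Context {R : realType} {d : measure_display} {S : measurableType d}.
Variables (h : R) (step : S -> R -> S) (u : nat -> S -> R -> R) (v : S -> R).
Hypothesis mstep : measurable_fun setT (fun z : S * R => step z.1 z.2).
Hypothesis mu_ : forall k, measurable_fun setT (fun z : S * R => u k z.1 z.2).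
Hypothesis mv : measurable_fun setT v.
Hypothesis u0 : forall k s y, 0 <= u k s y.
Hypothesis v0 : forall s, 0 <= v s.

(** Here [n] counts the steps left and [k] is the current index, so this is the conditional
    expectation of the remaining weights and terminal value, given the state [s]. *)
Fixpoint chain_int (n k : nat) (s : S) : \bar R :=
  if n is n'.+1 then
    (\int[normal_prob 0 (Num.sqrt h)]_y
       ((u k s y)%:E * chain_int n' k.+1 (step s y)))%E
  else (v s)%:E.

Fixpoint chain_state (s : S) (xi : nat -> R) (k : nat) : S :=
  if k is k'.+1 then step (chain_state s xi k') (xi k') else s.

Definition chain_weight (s : S) (xi : nat -> R) (k : nat) : R :=
  \prod_(i < k) u i (chain_state s xi i) (xi i).

Lemma chain_weight_ge0 s xi k : 0 <= chain_weight s xi k.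
Proof. by apply: prodr_ge0. Qed.

Lemma chain_int_ge0 n k s : (0 <= chain_int n k s)%E.
Proof.
elim: n k s => [|n IH] k s /=; first by rewrite lee_fin.
by apply: integral_ge0 => y _; rewrite mule_ge0 ?lee_fin.
Qed.

Lemma measurable_chain_int n k : measurable_fun setT (chain_int n k).
Proof.
elim: n k => [|n IH] k /=; first exact/measurable_EFinP.
apply: (@measurable_fun_fubini_tonelli_F _ _ _ _ _ (normal_prob 0 (Num.sqrt h))
  (fun z : S * R => ((u k z.1 z.2)%:E * chain_int n k.+1 (step z.1 z.2))%E)).
  have mE : measurable_fun setT (fun z : S * R => (u k z.1 z.2)%:E).
    by apply/measurable_EFinP; exact: mu_.
  exact: (emeasurable_funM mE (measurableT_comp (IH k.+1) mstep)).
by move=> z; rewrite mule_ge0 ?lee_fin ?chain_int_ge0.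
Qed.

Lemma measurable_chain d' (U : measurableType d') (s0 : S) (xi : U -> nat -> R) k :
  (forall i, (i < k)%N -> measurable_fun setT (xi ^~ i)) ->
  measurable_fun setT
    (fun w => (chain_weight s0 (xi w) k, chain_state s0 (xi w) k)).
Proof.
elim: k => [|k IH] mxi.
  rewrite (_ : (fun w => _) = cst (1, s0)); first exact: measurable_cst.
  by apply/funext => w; rewrite /chain_weight big_ord0.
have {}IH := IH (fun i ik => mxi i (ltnW ik)).
have mW := measurableT_comp measurable_fst IH.
have mX := measurableT_comp measurable_snd IH.
have mXxi := measurable_fun_pair mX (mxi k (ltnSn k)).
apply: measurable_fun_pair.
  have mW1 := measurable_funM mW (measurableT_comp (mu_ k) mXxi).
  apply: eq_measurable_fun mW1 => w _.
  by rewrite /= /chain_weight big_ord_recr.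
exact: (measurableT_comp mstep mXxi).
Qed.

End chain.

Lemma brownian_increment_law {R : realType} d (T : measurableType d)
    (P : probability T R) (B : continuous_process R T) (s r : R) (f : R -> \bar R) :
  brownian_motion P B -> 0 <= s < r -> measurable_fun setT f ->
  (forall x, (0 <= f x)%E) ->
  (\int[pushforward P (increment B s r : T -> measurableTypeR R)]_y f y =
   \int[normal_prob 0 (Num.sqrt (r - s))]_y f y)%E.
Proof.
move=> BM sr mf f0; have /andP[s0 /ltW sr'] := sr.
have mxi : measurable_fun setT (increment B s r).
  by apply: measurable_funB; apply: process_measurable => //; exact: le_trans sr'.
pose Y : {mfun T >-> measurableTypeR R} := HB.pack (increment B s r)
  (isMeasurableFun.Build _ _ T (measurableTypeR R) _ mxi).
apply: (@eq_measure_integral _ _ _ setT (normal_prob 0 (Num.sqrt (r - s)))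
  (distribution P Y)).
by move=> A mA _; case: BM => _ _ /(_ s r sr A mA).
Qed.

Section brownian_chain.
Context {R : realType} {d : measure_display} {T : measurableType d}.
Variables (P : probability T R) (B : continuous_process R T).
Hypothesis BM : brownian_motion P B.
Context {dS : measure_display} {S : measurableType dS}.
Variables (h : R) (step : S -> R -> S) (u : nat -> S -> R -> R) (v : S -> R).
Hypothesis h0 : 0 < h.
Hypothesis mstep : measurable_fun setT (fun z : S * R => step z.1 z.2).
Hypothesis mu_ : forall k, measurable_fun setT (fun z : S * R => u k z.1 z.2).
Hypothesis mv : measurable_fun setT v.
Hypothesis u0 : forall k s y, 0 <= u k s y.
Hypothesis v0 : forall s, 0 <= v s.
Variable s0 : S.

Let xi w (i : nat) : R := B (i.+1%:R * h) w - B (i%:R * h) w.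
Let X k w := chain_state step s0 (xi w) k.
Let W k w := chain_weight step u s0 (xi w) k.

(** Making the history of [B] up to [r] a measurable type turns adaptedness into [measurable_fun] on
    [past r]. *)
Definition past (r : R) := g_sigma_algebraType
  (\bigcup_(q in `[0, r]) g_sigma_algebra_preimage (B q) : set (set T)).

Lemma measurable_past r q : 0 <= q <= r ->
  measurable_fun setT (B q : past r -> R).
Proof.
move=> qr _ V mV; apply: sub_sigma_algebra; exists q => //=.
by exists V.
Qed.

Lemma measurable_pastW r d' (U : measurableType d') (f : T -> U) :
  measurable_fun setT (f : past r -> U) -> 0 <= r ->
  measurable_fun setT f.
Proof.
move=> mf r0 _ V mV; rewrite setTI.
have := mf measurableT V mV; rewrite setTI.
apply: smallest_sub; first exact: sigma_algebra_measurable.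
move=> _ [q /= /[!in_itv]/= /andP[q0 _]] [V' mV' <-].
exact: process_measurable.
Qed.

Let mWX k r : k%:R * h <= r ->
  measurable_fun setT ((fun w => (W k w, X k w)) : past r -> (R * S)%type).
Proof.
move=> kr; apply: measurable_chain => // i ik.
apply: measurable_funB; apply: measurable_past.
  rewrite mulr_ge0 ?(ltW h0)//= (le_trans _ kr)// ler_pM2r// ler_nat//.
by rewrite mulr_ge0 ?(ltW h0)//= (le_trans _ kr)// ler_pM2r// ler_nat ltnW.
Qed.

Let law_xi k : forall f : R -> \bar R, measurable_fun setT f ->
   (forall x, (0 <= f x)%E) ->
  (\int[pushforward P (fun w => xi w k : measurableTypeR R)]_y f y =
   \int[normal_prob 0 (Num.sqrt h)]_y f y)%E.
Proof.
move=> f mf f0.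
have sr : 0 <= k%:R * h < k.+1%:R * h.
  by rewrite ltr_pM2r// ltr_nat ltnSn mulr_ge0 ?(ltW h0).
have := brownian_increment_law BM sr mf f0.
by rewrite (_ : k.+1%:R * h - k%:R * h = h)// -natr1; ring.
Qed.

(** One step of the Markov property: [W k] and [X k] depend on the path up to time k h, and the next
    increment is an independent Gaussian variable of variance [h]. *)
Let step_int (m k : nat) :
  (\int[P]_w ((W k w)%:E * chain_int h step u v m.+1 k (X k w)) =
   \int[P]_w ((W k.+1 w)%:E * chain_int h step u v m k.+1 (X k.+1 w)))%E.
Proof.
have kh0 : 0 <= k%:R * h by rewrite mulr_ge0 ?(ltW h0).
have mxi : measurable_fun setT ((fun w => xi w k) : T -> R).
  by apply: measurable_funB; apply: process_measurable; rewrite ?mulr_ge0 ?(ltW h0).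
have kS0 : 0 <= k.+1%:R * h by rewrite mulr_ge0 ?(ltW h0).
have mWXk := measurable_pastW (mWX (lexx (k%:R * h))) kh0.
pose c := chain_int h step u v.
have c0 n j s : (0 <= c n j s)%E by apply: chain_int_ge0.
have mc n j : measurable_fun setT (c n j) by apply: measurable_chain_int.
(* the absolute value makes the integrand nonnegative on all of R * S * R *)
pose f (z : (R * S) * R) :=
  ((`|z.1.1|)%:E * ((u k z.1.2 z.2)%:E * c m k.+1 (step z.1.2 z.2)))%E.
have mSR : measurable_fun setT (fun z : (R * S) * R => (z.1.2, z.2)).
  apply: measurable_fun_pair; last exact: measurable_snd.
  exact: measurableT_comp measurable_snd measurable_fst.
have mf : measurable_fun setT f.
  apply: emeasurable_funM.
    apply/measurable_EFinP; apply: measurableT_comp => //.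
    exact: measurableT_comp measurable_fst measurable_fst.
  have m1 := measurableT_comp (mu_ k) mSR.
  have m2 := measurableT_comp (measurableT_comp (mc m k.+1) mstep) mSR.
  by apply: emeasurable_funM => //; exact/measurable_EFinP.
have f0 z : (0 <= f z)%E by rewrite !mule_ge0 ?lee_fin.
have W0 j w : 0 <= W j w by exact: chain_weight_ge0.
transitivity (\int[P]_w f ((W k w, X k w), xi w k))%E; last first.
  apply: eq_integral => w _; rewrite /f /= ger0_norm// muleA -EFinM.
  by rewrite {2}/W /chain_weight big_ord_recr.
rewrite (@ge0_integral_independent _ _ _ P _ _ _ _
  (fun w => (W k w, X k w)) (fun w => xi w k : measurableTypeR R) f)//; last first.
  move=> U V mU mV; case: BM => _ /(_ (k%:R * h) (k.+1%:R * h)).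
  rewrite ltr_pM2r// ltr_nat ltnSn kh0 => /(_ isT) ind _.
  apply: ind; last by exists V => //; rewrite setTI.
  by have := mWX (lexx (k%:R * h)) measurableT mU; rewrite setTI.
apply: eq_integral => w _; rewrite law_xi; first last.
- by move=> y; exact: f0.
- exact: measurableT_comp mf (pair1_measurable _).
rewrite /f /= ge0_integralZl//.
- by rewrite ger0_norm.
- have mp := measurableT_comp mstep (pair1_measurable (X k w)).
  apply: emeasurable_funM; last exact: measurableT_comp (mc m k.+1) mp.
  by apply/measurable_EFinP; exact: measurableT_comp (mu_ k) (pair1_measurable _).
- by move=> y _; rewrite mule_ge0 ?lee_fin.
Qed.

Lemma brownian_chain_int n :
  (\int[P]_w (W n w * v (X n w))%:E = chain_int h step u v n 0 s0)%E.
Proof.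
suff H m k : (\int[P]_w ((W k w)%:E * chain_int h step u v m k (X k w)) =
    \int[P]_w (W (k + m) w * v (X (k + m) w))%:E)%E.
  have := H n 0%N; rewrite add0n => <-.
  rewrite /W /X /chain_weight/=; under eq_integral do rewrite big_ord0 mul1e.
  rewrite integral_cst//= [X in (_ * X)%E](_ : _ = 1%E) ?mule1//.
  exact: (@probability_setT _ _ _ P).
elim: m k => [|m IH] k; first by rewrite addn0; apply: eq_integral => w _; rewrite EFinM.
by rewrite step_int IH addSnnS.
Qed.

End brownian_chain.

(** * The exact discrete form of the dilation identity *)

Section discrete_transform.
Context {R : realType}.
Variables (c h : R) (f : nat -> R -> R -> R).
Hypotheses (c0 : 0 < c) (h0 : 0 < h).
Hypothesis mf : forall k, measurable_fun setT (fun z : R * R => f k z.1 z.2).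
Hypothesis f0 : forall k x y, 0 <= f k x y.

Definition walk (x y : R) : R := x + y.

Definition wweight (k : nat) (x y : R) : R := f k x (x + y).

(* A state [(psi, phi, a)] records the walk [psi], the transformed walk [phi]
   and the running value [a] of [1 / (1 - c A)]. *)
Definition state : Type := (R * R * R)%type.

Definition rate (s : state) : R := c * h * s.2 * expR (2 * s.1.1).

Definition jump (s : state) (y : R) : R := rate s * expq (2 * y).

Definition tstep (s : R * R * R) (y : R) : R * R * R :=
  (s.1.1 + y, s.1.2 + y + jump s y,
   s.2 + jump s y ^+ 2 / (c * h * expR (2 * (s.1.1 + y)))).

(* The absolute value only matters for unreachable states with [s.2 < 0]. *)
Definition tweight (k : nat) (s : R * R * R) (y : R) : R :=
  f k s.1.2 (s.1.2 + shift (rate s) y) * `|shift' (rate s) y|.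

Definition tpotential (s : R * R * R) : R := c / 2 * (expR (2 * s.1.1) * s.2).

Lemma measurable_expq : measurable_fun setT (@expq R).
Proof.
apply: continuous_measurable_fun => w.
apply/differentiable_continuous/derivable1_diffP.
by case: (is_derive_expq w).
Qed.

Let mfst1 : measurable_fun setT (fun z : R * R * R * R => z.1.1.1).
Proof.
apply: (measurableT_comp measurable_fst).
exact: (measurableT_comp measurable_fst measurable_fst).
Qed.

Let mfst2 : measurable_fun setT (fun z : R * R * R * R => z.1.1.2).
Proof.
apply: (measurableT_comp measurable_snd).
exact: (measurableT_comp measurable_fst measurable_fst).
Qed.

Let mfst3 : measurable_fun setT (fun z : R * R * R * R => z.1.2).
Proof. exact: (measurableT_comp measurable_snd measurable_fst). Qed.

Let msnd : measurable_fun setT (fun z : R * R * R * R => z.2).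
Proof. exact: measurable_snd. Qed.

Let mrate : measurable_fun setT (fun z : R * R * R * R => rate z.1).
Proof.
apply: measurable_funM; first exact: measurable_funM.
by apply: measurableT_comp => //; exact: measurable_funM.
Qed.

Let mexpq : measurable_fun setT (fun z : R * R * R * R => expq (2 * z.2)).
Proof.
by apply: (measurableT_comp measurable_expq); exact: measurable_funM.
Qed.

Lemma measurable_tstep :
  measurable_fun setT (fun z : R * R * R * R => tstep z.1 z.2).
Proof.
have mj : measurable_fun setT (fun z : R * R * R * R => jump z.1 z.2).
  exact: measurable_funM.
apply: measurable_fun_pair; [apply: measurable_fun_pair|].
- exact: measurable_funD.
- by apply: measurable_funD => //; exact: measurable_funD.
- apply: measurable_funD => //; apply: measurable_funM.
    exact: measurable_funX.
  under eq_fun do rewrite invfM -expRN.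
  apply: measurable_funM => //; apply: measurableT_comp => //.
  apply: measurableT_comp => //; apply: measurable_funM => //.
  exact: measurable_funD.
Qed.

Lemma measurable_tweight k :
  measurable_fun setT (fun z : R * R * R * R => tweight k z.1 z.2).
Proof.
apply: measurable_funM.
  have mg : measurable_fun setT
      (fun z : R * R * R * R => (z.1.1.2, z.1.1.2 + shift (rate z.1) z.2)).
    apply: measurable_fun_pair => //; apply: measurable_funD => //.
    by apply: measurable_funD => //; exact: measurable_funM.
  exact: (measurableT_comp (mf k) mg).
apply: measurableT_comp => //; apply: measurable_funD => //.
apply: measurable_funM; first exact: measurable_funM.
apply: (measurableT_comp (continuous_measurable_fun (@continuous_expq' R))).
exact: measurable_funM.
Qed.

Lemma measurable_walk : measurable_fun setT (fun z : R * R => walk z.1 z.2).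
Proof.
by apply: measurable_funD; [exact: measurable_fst|exact: measurable_snd].
Qed.

Lemma measurable_wweight k :
  measurable_fun setT (fun z : R * R => wweight k z.1 z.2).
Proof.
have mg : measurable_fun setT (fun z : R * R => (z.1, z.1 + z.2)).
  by apply: measurable_fun_pair; [exact: measurable_fst|exact: measurable_walk].
exact: (measurableT_comp (mf k) mg).
Qed.

Lemma measurable_tpotential : measurable_fun setT tpotential.
Proof.
apply: measurable_funM => //; apply: measurable_funM => //.
apply: measurableT_comp => //; apply: measurable_funM => //.
exact: (measurableT_comp measurable_fst measurable_fst).
Qed.

Lemma tweight_ge0 k s y : 0 <= tweight k s y.
Proof. by rewrite mulr_ge0. Qed.

(** In each step of the plain walk the variable is substituted by [shift (rate s)]. The derivative
    of the shift goes into [tweight], and by [shift_quadratic] the ratio of Gaussian densities is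
    exactly exp(-(new potential - old potential)). The potentials telescope, leaving only the
    initial one, and the right-hand side sees the state only through the transformed walk
    [s.1.2]. *)
Lemma chain_int_transform n k (s : R * R * R) : 0 <= s.2 ->
  chain_int h tstep tweight (fun s => expR (- tpotential s)) n k s =
  ((expR (- tpotential s))%:E * chain_int h walk wweight (fun=> 1%R) n k s.1.2)%E.
Proof.
elim: n k s => [|n IH] k s a0; first by rewrite /= mule1.
have r0 : 0 <= rate s by rewrite !mulr_ge0// ltW// expR_gt0.
have sh0 y : 0 <= shift' (rate s) y by rewrite (le_trans ler01)// shift'_ge1.
set I := chain_int h walk wweight (fun=> 1%R).
have mI m j : measurable_fun setT (I m j).
  apply: measurable_chain_int => //; first exact: measurable_walk.
    exact: measurable_wweight.
  by move=> ? ? ?; exact: f0.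
have I0 m j x : (0 <= I m j x)%E by apply: chain_int_ge0 => // ? ? ?; exact: f0.
pose G y := ((f k s.1.2 (s.1.2 + y))%:E * I n k.+1 (s.1.2 + y)%R)%E.
have mx : measurable_fun setT (fun y => s.1.2 + y) by exact: measurable_funD.
have mG : measurable_fun setT G.
  apply: emeasurable_funM; last exact: measurableT_comp (mI _ _) mx.
  have mg : measurable_fun setT (fun y : R => (s.1.2, s.1.2 + y)).
    exact: measurable_fun_pair.
  by apply/measurable_EFinP; exact: (measurableT_comp (mf k) mg).
have G0 y : (0 <= G y)%E by rewrite mule_ge0 ?lee_fin.
transitivity ((expR (- tpotential s))%:E *
  \int[normal_prob 0 (Num.sqrt h)]_y G y)%E; last by [].
rewrite (@ge0_integral_shift _ h (rate s))//=.
pose H y := (G (shift (rate s) y) * (shift' (rate s) y *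
  expR ((y ^+ 2 - shift (rate s) y ^+ 2) / (2 * h)))%:E)%E.
have H0 y : (0 <= H y)%E by rewrite mule_ge0// lee_fin mulr_ge0// expR_ge0.
have mH : measurable_fun setT (H : measurableTypeR R -> \bar R).
  have ms := continuous_measurable_fun (@continuous_shift R (rate s)).
  have ms' := continuous_measurable_fun (@continuous_shift' R (rate s)).
  apply: emeasurable_funM; first exact: (measurableT_comp mG ms).
  apply/measurable_EFinP; apply: measurable_funM => //.
  apply: measurableT_comp => //; apply: measurable_funM => //.
  by apply: measurable_funB; apply: measurable_funX.
rewrite -(@ge0_integralZl _ (measurableTypeR R) _ _ _ measurableT H mH)//.
apply: eq_integral => y _.
rewrite IH; last first.
  by rewrite /= addr_ge0// mulr_ge0 ?sqr_ge0// invr_ge0 !mulr_ge0 ?expR_ge0 ?ltW.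
rewrite /tweight ger0_norm// /G /= -addrA -/(shift (rate s) y).
rewrite (_ : expR (- tpotential (tstep s y)) = expR (- tpotential s) *
   expR ((y ^+ 2 - shift (rate s) y ^+ 2) / (2 * h))); last first.
  have := @shift_quadratic R c h s.2 s.1.1 y (lt0r_neq0 c0) (lt0r_neq0 h0).
  rewrite /= -/(rate s) -/(jump s y) => e; rewrite -expRD; congr expR.
  by rewrite -(opprB (shift _ _ ^+ 2)) mulNr e /tpotential /=; ring.
rewrite /H /G /I !EFinM -!muleA.
move: (chain_int _ _ _ _ n _ _) => J; move: (f k _ _)%:E => x.
move: (shift' _ _)%:E (expR (- _))%:E (expR (_ / _))%:E => z e q.
by rewrite (muleCA z e) (muleCA x e) (muleC J) -!muleA.
Qed.

End discrete_transform.

(** * Deterministic estimates for the reciprocal b of the running value a *)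

Section reciprocal_recursion.
Context {R : realType}.
Variables (N : nat) (x E E' F b A : nat -> R) (theta tau m M : R).
Hypotheses (x0 : forall k, 0 <= x k) (b0 : b 0%N = 1) (bp : forall k, 0 < b k).
Hypotheses (E0 : forall k, 0 < E k) (E'0 : forall k, 0 < E' k).
Hypothesis bS : forall k, b k.+1 = b k / (1 + x k * (E k * E' k) / b k).
Hypotheses (theta0 : 0 <= theta) (theta1 : 10 * theta <= 1).
Hypotheses (E1 : forall k, (k < N)%N -> `|E k - 1| <= theta).
Hypotheses (E'1 : forall k, (k < N)%N -> `|E' k - 1| <= theta).
Hypotheses (F1 : forall k, (k < N)%N -> `|F k - 1| <= theta).
Hypotheses (xtau : forall k, (k < N)%N -> x k <= tau).
Hypothesis tau0 : 0 <= tau.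
Hypothesis xA : forall k, (k <= N)%N -> `|\sum_(j < k) x j - A k| <= theta.
Hypothesis AM : forall k, (k <= N)%N -> A k + theta <= M.

Let q k := x k * (E k * E' k).
Let Q k := \sum_(j < k) q j.

Let EE'1 k : (k < N)%N -> `|E k * E' k - 1| <= 3 * theta.
Proof.
move=> kN; have e := E1 kN; have e' := E'1 kN.
rewrite (_ : _ - 1 = (E k - 1) * (E' k - 1) + (E k - 1) + (E' k - 1)); last by ring.
apply: le_trans (ler_normD _ _) _.
apply: le_trans (lerD (ler_normD _ _) (lexx _)) _; rewrite normrM.
have : `|E k - 1| * `|E' k - 1| <= theta * 1.
  by apply: ler_pM => //; apply: le_trans e' _; have := theta1; lra.
by lra.
Qed.

Let q0 k : 0 <= q k.
Proof. by rewrite mulr_ge0// mulr_ge0// ltW. Qed.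

(** Up to the ratio [b k.+1 / b k], close to 1 for a fine mesh, the recursion subtracts the
    increments [q k] of a Riemann sum for [A]; hence [b] should follow 1 - A. *)
Let bS' k : b k - b k.+1 = q k * b k.+1 / b k.
Proof.
have bq : 0 < b k + q k by rewrite ltr_wpDr// ?q0.
by rewrite bS -/(q k); field; rewrite !gt_eqF ?bp.
Qed.

Lemma recursion_nonincreasing k : b k.+1 <= b k.
Proof.
rewrite -subr_ge0 bS' mulr_ge0 ?invr_ge0 ?(ltW (bp _))//.
by rewrite mulr_ge0 ?(ltW (bp _)).
Qed.

Let sumx k : (k <= N)%N -> \sum_(j < k) x j <= M.
Proof.
move=> kN; apply: le_trans (AM kN); have := xA kN.
by rewrite ler_norml => /andP[_]; lra.
Qed.

Let QE k : (k <= N)%N -> `|Q k - A k| <= (1 + 3 * M) * theta.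
Proof.
move=> kN; rewrite -(subrKA (\sum_(j < k) x j)).
apply: le_trans (ler_normD _ _) _.
rewrite mulrDl mul1r [leRHS]addrC; apply: lerD; last exact: xA.
rewrite /Q -sumrB; apply: le_trans (ler_norm_sum _ _ _) _.
apply: (@le_trans _ _ (\sum_(j < k) x j * (3 * theta))).
  apply: ler_sum => j _.
  rewrite /q -{2}(mulr1 (x j)) -mulrBr normrM ger0_norm// ler_wpM2l// EE'1//.
  exact: leq_trans (ltn_ord j) kN.
by rewrite -mulr_suml -mulrA [leRHS]mulrCA ler_wpM2r ?sumx// mulr_ge0.
Qed.

(** Each decrease of [b] is at most [q k], because the ratio [b k.+1 / b k] is at most 1. This is
    what supplies the lower bound [m] used in the finer estimates when the limit of [A] stays below
    1. *)
Lemma recursion_ge k : 1 - Q k <= b k.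
Proof.
elim: k => [|k IH]; first by rewrite /Q big_ord0 b0 subr0.
rewrite /Q big_ord_recr/= -/(Q k).
suff : b k - b k.+1 <= q k by lra.
rewrite bS' -mulrA ler_piMr// ler_pdivrMr ?bp// mul1r.
exact: recursion_nonincreasing.
Qed.

Lemma recursion_ge_limit k : (k <= N)%N -> 1 - A k - (1 + 3 * M) * theta <= b k.
Proof.
move=> kN; apply: le_trans (recursion_ge k).
by have := QE kN; rewrite ler_norml => /andP[_]; lra.
Qed.

Hypotheses (m0 : 0 < m) (bN : m <= b N).

Let bm k : (k <= N)%N -> m <= b k.
Proof.
move=> kN; apply: le_trans bN _; rewrite -(subnKC kN); elim: (N - k)%N.
  by rewrite addn0.
by move=> j IH; rewrite addnS (le_trans (recursion_nonincreasing _)).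
Qed.

Let M0 : 0 <= M.
Proof. by have := sumx (leq0n N); rewrite big_ord0. Qed.

Let qx k : (k < N)%N -> q k <= 2 * x k.
Proof.
move=> kN; rewrite /q [leLHS]mulrC ler_wpM2r//.
by have := EE'1 kN; have := theta1; rewrite ler_norml => ? /andP[_]; lra.
Qed.

Let Q2M k : (k <= N)%N -> Q k <= 2 * M.
Proof.
move=> kN; apply: (@le_trans _ _ (\sum_(j < k) 2 * x j)).
  by apply: ler_sum => j _; rewrite qx// (leq_trans (ltn_ord j)).
by rewrite -mulr_sumr ler_wpM2l// sumx.
Qed.

(** The ratio [b k.+1 / b k] is 1 / (1 + z) with z = q k / b k <= 2 tau / m, hence at least 1 - 2
    tau / m. *)
Let recursion_le k : (k <= N)%N -> b k <= 1 - Q k + Q k * (2 * tau / m).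
Proof.
elim: k => [|k IH] kN; first by rewrite /Q big_ord0 b0; lra.
rewrite /Q big_ord_recr/= -/(Q k); have := IH (ltnW kN).
suff : q k - q k * (2 * tau / m) <= b k - b k.+1 by lra.
rewrite bS' -[leRHS]mulrA -{1}(mulr1 (q k)) -mulrBr ler_wpM2l//.
rewrite bS -/(q k) [leRHS]mulrAC mulfV ?gt_eqF// mul1r.
have qm : q k / b k <= 2 * tau / m.
  apply: ler_pM => //; first by rewrite invr_ge0 ltW.
    by apply: le_trans (qx kN) _; rewrite ler_pM2l// xtau.
  by rewrite lef_pV2 ?posrE// bm// ltnW.
have q1 : 0 <= q k / b k by rewrite divr_ge0// ltW.
rewrite -[leRHS]mul1r ler_pdivlMr; last by lra.
by move: q1 qm; set z := q k / b k; set w := 2 * tau / m => z0 zw; nra.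
Qed.

Let err := (1 + 3 * M) * theta + 4 * M / m * tau.

Lemma recursion_limit k : (k <= N)%N -> `|b k - (1 - A k)| <= err.
Proof.
move=> kN; have h1 := recursion_ge_limit kN; have h2 := recursion_le kN.
have h3 := QE kN; have h4 : Q k * (2 * tau / m) <= 4 * M / m * tau.
  rewrite (_ : 4 * M / m * tau = 2 * M * (2 * tau / m)); last by ring.
  by rewrite ler_wpM2r ?Q2M// divr_ge0 ?mulr_ge0// ltW.
have h5 : 0 <= 4 * M / m * tau by rewrite !mulr_ge0// invr_ge0 ltW.
have t0 := theta0.
have := h3; rewrite !ler_norml /err => /andP[h6 h7].
by apply/andP; split; lra.
Qed.

Let kappa k := x k / b k.

Let kappa0 k : 0 <= kappa k. Proof. by rewrite divr_ge0// ltW. Qed.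

Let sumkappa k : (k <= N)%N -> \sum_(j < k) kappa j <= M / m.
Proof.
move=> kN; apply: (@le_trans _ _ (\sum_(j < k) x j / m)).
  apply: ler_sum => j _; rewrite ler_wpM2l// lef_pV2 ?posrE//.
  by rewrite bm// ltnW// (leq_trans (ltn_ord j)).
by rewrite -mulr_suml ler_wpM2r ?sumx// invr_ge0 ltW.
Qed.

Let kappa_tau k : (k < N)%N -> kappa k <= tau / m.
Proof.
move=> kN; apply: ler_pM => //; first by rewrite invr_ge0 ltW.
  exact: xtau.
by rewrite lef_pV2 ?posrE// bm// ltnW.
Qed.

Let ln1_bound (k : nat) (y : R) : (k < N)%N -> 0 <= y ->
  `|y - kappa k| <= 3 * theta * kappa k ->
  `|ln (1 + y) - kappa k| <= kappa k * (3 * theta + 4 * tau / m).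
Proof.
move=> kN y0 yk; have k0 := kappa0 k.
have t1 := theta1; have t0 := theta0.
have y2 : y <= 2 * kappa k.
  move: yk; rewrite ler_norml => /andP[_].
  have : 3 * theta * kappa k <= 1 * kappa k by rewrite ler_wpM2r//; lra.
  by lra.
have l1 : ln (1 + y) <= y.
  by have := @le_ln1Dx _ y; apply; lra.
(* Obtained by applying ln(1 + v) <= v to v = (1 + y)^-1 - 1, which gives ln(1 + y) >= y / (1 +
   y). *)
have l2 : y - y ^+ 2 <= ln (1 + y).
  have y1 : 0 < (1 + y)^-1 by rewrite invr_gt0; lra.
  have : ln (1 + ((1 + y)^-1 - 1)) <= (1 + y)^-1 - 1.
    by apply: le_ln1Dx; lra.
  rewrite addrC subrK lnV ?posrE; last by lra.
  suff : y - y ^+ 2 <= 1 - (1 + y)^-1 by lra.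
  rewrite (_ : 1 - (1 + y)^-1 = y / (1 + y)); last by field; lra.
  by rewrite ler_pdivlMr; [nra|lra].
have yy : y ^+ 2 <= kappa k * (4 * tau / m).
  apply: (@le_trans _ _ ((2 * kappa k) ^+ 2)).
    by rewrite ler_pXn2r ?nnegrE//; lra.
  rewrite (_ : (2 * kappa k) ^+ 2 = kappa k * (4 * kappa k)); last by ring.
  by rewrite ler_wpM2l// -mulrA ler_wpM2l// kappa_tau.
move: yk; rewrite !ler_norml => /andP[? ?].
rewrite mulrDr; apply/andP; split; nra.
Qed.

Let delta k := kappa k * E k.

Let sum_close (u : nat -> R) (z : R) k : (k <= N)%N ->
  (forall j, (j < N)%N -> `|u j - kappa j| <= kappa j * z) ->
  0 <= z ->
  `|\sum_(j < k) u j - \sum_(j < k) kappa j| <= M / m * z.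
Proof.
move=> kN uk z0; rewrite -sumrB; apply: le_trans (ler_norm_sum _ _ _) _.
apply: (@le_trans _ _ (\sum_(j < k) kappa j * z)).
  by apply: ler_sum => j _; rewrite uk// (leq_trans (ltn_ord j)).
by rewrite -mulr_suml ler_wpM2r// sumkappa.
Qed.

Let w := 3 * theta + 4 * tau / m.

Let w0 : 0 <= w.
Proof. by rewrite addr_ge0 ?mulr_ge0// invr_ge0 ltW. Qed.

Let lnb k : ln (b k) = - \sum_(j < k) ln (1 + kappa j * (E j * E' j)).
Proof.
elim: k => [|k IH]; first by rewrite b0 ln1 big_ord0 oppr0.
have k1 : 0 < 1 + kappa k * (E k * E' k).
  by rewrite ltr_wpDr// mulr_ge0// mulr_ge0// ltW.
rewrite big_ord_recr/= bS mulrAC -/(kappa k) ln_div ?posrE//.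
by rewrite IH; lra.
Qed.

Let lnb_close k : (k <= N)%N ->
  `|- ln (b k) - \sum_(j < k) kappa j| <= M / m * w.
Proof.
move=> kN; rewrite lnb opprK.
apply: (@sum_close (fun j => ln (1 + kappa j * (E j * E' j)))) => // j jN; apply: ln1_bound => //.
  by rewrite mulr_ge0// mulr_ge0// ltW.
rewrite -{2}(mulr1 (kappa j)) -mulrBr normrM ger0_norm// mulrC.
by rewrite ler_wpM2r// EE'1.
Qed.

(** Both the sum of the jumps and -ln b are within (M / m) w of the sum of the ratios x / b, whence
    the factor 2. In the limit the total displacement is -ln(1 - A). *)
Lemma recursion_sum_limit k : (k <= N)%N ->
  `|\sum_(j < k) delta j + ln (b k)| <= 2 * (M / m * w).
Proof.
move=> kN.
have h1 : `|\sum_(j < k) delta j - \sum_(j < k) kappa j| <= M / m * w.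
  apply: (@sum_close delta) => // j jN; rewrite /delta -{2}(mulr1 (kappa j)) -mulrBr.
  rewrite normrM ger0_norm// ler_wpM2l// (le_trans (E1 jN))// /w.
  by have := theta0; have : 0 <= 4 * tau / m by [rewrite !mulr_ge0// invr_ge0 ltW]; lra.
have h2 := lnb_close kN; move: h1 h2; rewrite !ler_norml.
by move=> /andP[? ?] /andP[? ?]; apply/andP; split; lra.
Qed.

(** With F j = 2 expq'(2 y), close to 1 for small increments y, the sum is the logarithm of the
    Jacobian product; it too has the limit -ln(1 - A). *)
Lemma recursion_jacobian_limit k : (k <= N)%N -> (forall j, 0 <= F j) ->
  `|\sum_(j < k) ln (1 + kappa j * F j) + ln (b k)| <= 2 * (M / m * w).
Proof.
move=> kN F0.
have h1 : `|\sum_(j < k) ln (1 + kappa j * F j) - \sum_(j < k) kappa j|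
    <= M / m * w.
  apply: (@sum_close (fun j => ln (1 + kappa j * F j))) => // j jN.
  apply: ln1_bound => //; first exact: mulr_ge0.
  rewrite -{2}(mulr1 (kappa j)) -mulrBr normrM ger0_norm// mulrC.
  by rewrite ler_wpM2r// (le_trans (F1 jN))//; have := theta0; lra.
have h2 := lnb_close kN; move: h1 h2; rewrite !ler_norml.
by move=> /andP[? ?] /andP[? ?]; apply/andP; split; lra.
Qed.

(** The recursion makes 1/b - 1 telescope into the sum of x E E' / b^2, and exp(2 sum delta) is
    close to b^-2 by [recursion_sum_limit]. The sum discretizes c times the functional A of the
    transformed path, whose value is c A / (1 - c A). *)
Lemma recursion_exponential_limit : M / m * w <= 16^-1 ->
  `|\sum_(j < N) x j * expR (2 * \sum_(i < j) delta i) - ((b N)^-1 - 1)|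
  <= M / m ^+ 2 * (3 * theta + 8 * (M / m * w)).
Proof.
move=> wsmall.
have tel : (b N)^-1 - 1 = \sum_(j < N) x j * (E j * E' j) / b j ^+ 2.
  have T k : (b k)^-1 - 1 = \sum_(j < k) x j * (E j * E' j) / b j ^+ 2.
    elim: k => [|k IH]; first by rewrite b0 invr1 subrr big_ord0.
    rewrite big_ord_recr/= -IH bS invf_div.
    by field; rewrite gt_eqF ?bp.
  exact: T.
rewrite tel -sumrB; apply: le_trans (ler_norm_sum _ _ _) _.
apply: (@le_trans _ _ (\sum_(j < N) x j *
    ((m ^+ 2)^-1 * (3 * theta + 8 * (M / m * w))))); last first.
  rewrite -mulr_suml -[leRHS]mulrA ler_wpM2r ?sumx//.
  by rewrite mulr_ge0 ?invr_ge0 ?sqr_ge0// addr_ge0 ?mulr_ge0// invr_ge0 ltW.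
apply: ler_sum => j _; have jN := ltn_ord j.
rewrite -mulrA -mulrBr normrM (ger0_norm (x0 j)) ler_wpM2l//.
set r := \sum_(i < j) delta i + ln (b j).
have rw : `|r| <= 2 * (M / m * w) by exact: (recursion_sum_limit (ltnW jN)).
have -> : expR (2 * \sum_(i < j) delta i) = expR (2 * r) / b j ^+ 2.
  rewrite /r mulrDr expRD -mulrA.
  have -> : expR (2 * ln (b j)) = b j ^+ 2.
    by rewrite mulr2n mulrDl mul1r expRD lnK ?posrE// expr2.
  by rewrite mulfV ?mulr1// gt_eqF// exprn_gt0.
rewrite -mulrBl normrM mulrC; apply: ler_pM => //.
  rewrite ger0_norm ?invr_ge0 ?sqr_ge0// lef_pV2 ?posrE ?exprn_gt0//.
  by rewrite ler_pXn2r ?nnegrE ?(ltW m0) ?(ltW (bp _))// bm// ltnW.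
(* The assumed bound 1/16 makes |r| <= 1/8, where this linear bound follows from 1 + v <= e^v and
   e^v (1 - v) <= 1. *)
have er : `|expR (2 * r) - 1| <= 4 * `|r|.
  have r8 : `|r| <= 8^-1 by lra.
  have g1 := expR_ge1Dx (2 * r); have g2 := expR_1BM_le (2 * r).
  move: r8; rewrite !ler_norml => /andP[r1 r2].
  have := expR_gt0 (2 * r); move: g1 g2; set z := expR (2 * r) => g1 g2 z0.
  have [rp|rn] := ger0P r.
    by apply/andP; split; nra.
  by apply/andP; split; nra.
rewrite -(subrKA 1); apply: le_trans (ler_normD _ _) _; rewrite addrC.
apply: lerD; first by rewrite distrC EE'1.
apply: le_trans er _; lra.
Qed.

End reciprocal_recursion.

(** * Dyadic approximation along a continuous path *)

Section segment_paths.
Context {R : realType}.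
Variables (t : R) (X : R -> R).
Hypothesis t0 : 0 < t.
Hypothesis cX : {within `[0, t], continuous X}.

(** The Heine theorem: compactness, in its near-covering form, turns the local moduli at the points
    of the segment into a single one. *)
Lemma segment_unif_continuous (e : R) : 0 < e -> exists2 r, 0 < r &
  forall x y, 0 <= x <= t -> 0 <= y <= t -> `|x - y| < r -> `|X x - X y| <= e.
Proof.
move=> e0; pose K : set R := `[0, t]%classic.
have kK : near_covering_within K.
  by apply/near_covering_withinP/compact_near_coveringP/segment_compact.
pose Q (r x : R) := forall y, K y -> `|x - y| < r -> `|X x - X y| <= e.
have : \forall r \near (0 : R)^'+, K `<=` Q r.
  apply: kK => x Kx.
  have /cvgrPdist_lt/(_ (e / 2)) := (subspace_continuousP _ _).1 cX x Kx.
  rewrite divr_gt0// => /(_ isT) [r /= r0 xr].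
  exists (ball x (r / 2), [set s : R | s < r / 2]).
    split => /=.
      by apply: nbhsx_ballx; rewrite divr_gt0.
    by apply: nbhs_right_lt; rewrite divr_gt0.
  move=> [x' s] /= [xx' sr] Kx' y Ky x'y.
  have r2 : `|x - y| < r.
    rewrite -(subrKA x') (le_lt_trans (ler_normD _ _))//.
    by rewrite (splitr r) ltrD// (lt_trans x'y).
  have h1 : `|X x - X y| < e / 2 by apply: xr.
  have h2 : `|X x - X x'| < e / 2.
    apply: xr => //; rewrite /ball_ /=; apply: lt_trans xx' _.
    by rewrite ltr_pdivrMr// ltr_pMr// ltr1n.
  rewrite -(subrKA (X x)) (le_trans (ler_normD _ _))//.
  by rewrite (splitr e) lerD// ltW// distrC.
move=> H; near (0 : R)^'+ => r; exists r => //.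
have /= Hr : K `<=` Q r by near: r.
by move=> x y xt yt; apply: Hr; rewrite /K /= in_itv.
Unshelve. all: by end_near. Qed.

Lemma is_derive_expA (s : R) : 0 < s < t -> is_derive s 1 (expA X) (expR (2 * X s)).
Proof.
move=> /andP[s0 st].
pose f := (fun u => expR (2 * X u)).
have cf : {for s, continuous f}.
  have : {within `]0, t[, continuous X}.
    by apply: continuous_subspaceW cX; exact: subset_itv_oo_cc.
  rewrite continuous_open_subspace; last exact: interval_open.
  move=> /(_ s) H.
  apply: continuous_comp; last exact: continuous_expR.
  apply: cvgM; first exact: cvg_cst.
  by apply: H; rewrite inE/= in_itv/= s0.
have [] := @continuous_FTC1_closed _ f 0 s t st _ s0 cf.
  exact: expA_integrable.
by move=> d e; apply: DeriveDef => //; rewrite -derive1E.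
Qed.

Lemma expA0 (Y : R -> R) : expA Y 0 = 0.
Proof. by rewrite /expA set_itv1 Rintegral_set1. Qed.

Definition mesh (n : nat) : R := t / 2 ^+ n.
Definition grid (n k : nat) : R := k%:R * mesh n.

Lemma mesh_gt0 n : 0 < mesh n.
Proof. by rewrite divr_gt0// exprn_gt0. Qed.

Lemma grid_last n : grid n (2 ^ n) = t.
Proof. by rewrite /grid /mesh natrX mulrC divfK// expf_neq0. Qed.

Lemma gridS n k : grid n k.+1 = grid n k + mesh n.
Proof. by rewrite /grid -natr1 mulrDl mul1r. Qed.

Lemma grid_le n j k : (grid n j <= grid n k) = (j <= k)%N.
Proof. by rewrite ler_pM2r ?mesh_gt0// ler_nat. Qed.

Lemma grid_itv n k : (k <= 2 ^ n)%N -> 0 <= grid n k <= t.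
Proof.
move=> kn; rewrite mulr_ge0 ?(ltW (mesh_gt0 _))//=.
by rewrite -[leRHS](grid_last n) grid_le.
Qed.

Lemma cvg_mesh : mesh n @[n --> \oo] --> 0.
Proof.
rewrite -[X in _ --> X](mulr0 t); apply: cvgM; first exact: cvg_cst.
under eq_fun do rewrite -exprVn.
by apply: cvg_expr; rewrite ger0_norm ?invr_ge0// invf_lt1 ?ltr1n.
Qed.

Lemma mesh_small (r : R) : 0 < r -> \forall n \near \oo, mesh n < r.
Proof.
move=> r0; have /cvgrPdist_lt/(_ _ r0) := cvg_mesh.
apply: filterS => n; rewrite sub0r normrN ger0_norm//.
exact/ltW/mesh_gt0.
Qed.

Lemma path_increment_small (e : R) : 0 < e -> \forall n \near \oo,
  forall k, (k < 2 ^ n)%N -> `|X (grid n k.+1) - X (grid n k)| <= e.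
Proof.
move=> e0; have [r r0 Xr] := segment_unif_continuous e0.
near=> n => k kn; apply: Xr; [exact: grid_itv|exact/grid_itv/ltnW|].
rewrite gridS addrAC subrr add0r ger0_norm ?(ltW (mesh_gt0 _))//.
by near: n; exact: mesh_small.
Unshelve. all: by end_near. Qed.

Lemma path_bounded : exists2 M, 0 < M & forall s, 0 <= s <= t -> X s <= M.
Proof.
have [s _ Xs] := EVT_max (ltW t0) cX.
exists (`|X s| + 1); first by rewrite ltr_wpDl.
move=> u u0; have := Xs u; rewrite in_itv/= => /(_ u0) /le_trans; apply.
by rewrite (le_trans (ler_norm _))// lerDl.
Qed.

Lemma expA_mvt (x y : R) : 0 <= x -> x < y -> y <= t -> exists2 z, x < z < y &
  expA X y - expA X x = expR (2 * X z) * (y - x).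
Proof.
move=> x0 xy yt.
have [z| |z] := @MVT _ (expA X) (fun s => expR (2 * X s)) x y xy.
- rewrite in_itv/= => /andP[xz zy]; apply: is_derive_expA.
  by rewrite (le_lt_trans x0)//= (lt_le_trans zy).
- apply: continuous_subspaceW (expA_continuous (ltW t0) cX) => u /=.
  by rewrite !in_itv/= => /andP[xu uy]; rewrite (le_trans x0)//= (le_trans uy).
by rewrite in_itv/= => zxy ->; exists z.
Qed.

Lemma expA_gt0 (s : R) : 0 < s <= t -> 0 < expA X s.
Proof.
move=> /andP[s0 st]; have [z _] := expA_mvt (lexx 0) s0 st.
by rewrite expA0 !subr0 => ->; rewrite mulr_gt0// expR_gt0.
Qed.

Lemma expA_mono (x y : R) : 0 <= x -> x <= y -> y <= t -> expA X x <= expA X y.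
Proof.
move=> x0; rewrite le_eqVlt => /predU1P[->//|xy] yt.
have [z _ e] := expA_mvt x0 xy yt; rewrite -subr_ge0 e.
by rewrite mulr_ge0 ?expR_ge0// subr_ge0 ltW.
Qed.

Lemma path_expR_increment (e : R) : 0 < e -> \forall n \near \oo,
  forall k z, (k < 2 ^ n)%N -> grid n k <= z <= grid n k.+1 ->
  `|expR (2 * X (grid n k)) - expR (2 * X z)| <= e.
Proof.
move=> e0; have [M M0 XM] := path_bounded.
(* The bound 1/4 validates |e^{2u} - 1| <= 4 |u|; the other entry compensates this factor 4 and the
   maximum e^{2M} of e^{2X}. *)
pose e' := Num.min (4^-1) (e / (4 * expR (2 * M))).
have e'0 : 0 < e'.
  by rewrite lt_min invr_gt0 ltr0n/= divr_gt0// mulr_gt0// expR_gt0.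
have [r r0 Xr] := segment_unif_continuous e'0.
near=> n => k z kn /andP[kz zk].
have k_t : 0 <= grid n k <= t by exact/grid_itv/ltnW.
have zt : 0 <= z <= t.
  have /andP[? ?] := grid_itv kn; case/andP: k_t => g0 _.
  by rewrite (le_trans g0)//= (le_trans zk).
have d : `|X (grid n k) - X z| <= e'.
  apply: Xr => //; rewrite distrC ger0_norm ?subr_ge0//.
  have : z - grid n k <= mesh n by rewrite lerBlDl -gridS.
  by move/le_lt_trans; apply; near: n; exact: mesh_small.
set u := X (grid n k) - X z in d.
have -> : X (grid n k) = X z + u by rewrite /u addrC subrK.
rewrite mulrDr expRD -{2}(mulr1 (expR (2 * X z))) -mulrBr normrM.
rewrite (ger0_norm (expR_ge0 _)).
have u4 : `|u| <= 4^-1 by apply: le_trans d _; rewrite ge_min lexx.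
have ue : `|u| <= e / (4 * expR (2 * M)).
  by apply: le_trans d _; rewrite ge_min lexx orbT.
have h : `|expR (2 * u) - 1| <= 4 * `|u|.
  have g1 := expR_ge1Dx (2 * u); have g2 := expR_1BM_le (2 * u).
  move: u4; rewrite !ler_norml => /andP[r1 r2].
  have := expR_gt0 (2 * u); move: g1 g2; set w := expR (2 * u) => g1 g2 w0.
  by have [rp|rn] := ger0P u; apply/andP; split; nra.
have hM : expR (2 * X z) <= expR (2 * M) by rewrite ler_expR ler_pM2l// XM.
apply: (@le_trans _ _ (expR (2 * M) * (4 * (e / (4 * expR (2 * M)))))).
  apply: ler_pM => //.
  by apply: le_trans h _; rewrite ler_pM2l.
rewrite le_eqVlt; apply/orP; left; apply/eqP; field.
by rewrite gt_eqF ?expR_gt0.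
Unshelve. all: by end_near. Qed.

Lemma riemann_sum (e : R) : 0 < e -> \forall n \near \oo,
  forall k, (k <= 2 ^ n)%N ->
  `|\sum_(j < k) mesh n * expR (2 * X (grid n j)) - expA X (grid n k)| <= e.
Proof.
move=> e0; near=> n => k.
have H : forall k z, (k < 2 ^ n)%N -> grid n k <= z <= grid n k.+1 ->
    `|expR (2 * X (grid n k)) - expR (2 * X z)| <= e / t.
  by near: n; apply: path_expR_increment; rewrite divr_gt0.
move=> kn.
(* An error proportional to the elapsed time adds up cell by cell; in each cell the mean value
   theorem replaces the integral by a value of e^{2X} times the mesh. The bound is uniform in
   [k]. *)
suff : `|\sum_(j < k) mesh n * expR (2 * X (grid n j)) - expA X (grid n k)|
    <= e / t * grid n k.
  move/le_trans; apply; rewrite -mulrA ler_piMr ?(ltW e0)//.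
  by rewrite mulrC ler_pdivrMr// mul1r; case/andP: (grid_itv kn).
elim: k kn => [|k IH] kn.
  by rewrite big_ord0 /grid !mul0r expA0 subrr normr0 mulr0.
have [g0 gt] := andP (grid_itv (ltnW kn)); have [_ gSt] := andP (grid_itv kn).
have gg : grid n k < grid n k.+1 by rewrite gridS ltrDl mesh_gt0.
have [z /andP[gz zg] e1] := expA_mvt g0 gg gSt.
rewrite big_ord_recr/= (_ : expA X (grid n k.+1) =
    expA X (grid n k) + mesh n * expR (2 * X z)); last first.
  by apply/eqP; rewrite -subr_eq0 opprD addrA e1 gridS addrAC subrr add0r mulrC subrr.
rewrite opprD addrACA (le_trans (ler_normD _ _))//.
rewrite gridS mulrDr lerD ?IH ?(ltnW kn)//.
rewrite -mulrBr normrM (ger0_norm (ltW (mesh_gt0 n))) mulrC.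
by rewrite ler_pM2r ?mesh_gt0// H// !ltW.
Unshelve. all: by end_near. Qed.

End segment_paths.

(** * Cutoff weights and domination of the Jacobian *)

Section cut_weight.
Context {R : realType}.
Variables (c h : R) (g : nat -> R -> R).
Hypotheses (c0 : 0 < c) (h0 : 0 < h).
Hypothesis g01 : forall k x, 0 <= g k x <= 1.

Lemma expqN (w : R) : expq (- w) = expq w * expR (- w).
Proof.
have [->|w0] := eqVneq w 0; first by rewrite oppr0 expR0 mulr1.
apply: (mulIf w0); rewrite mulrAC expqM -[LHS]opprK -mulrN expqM.
by rewrite mulrBl mul1r expRxMexpNx_1 opprB.
Qed.

(* The exponential factor dominates the Jacobian of the step, and the
   indicator keeps the step in the region where that domination holds. *)
Definition cutw (k : nat) (x y : R) : R :=
  g k y * expR (- (6 * (c * h * expR (2 * x)))) *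
  ((`|y - x| <= 20^-1) && (c * h * expR (2 * x) <= 20^-1))%:R.

Lemma cutw_ge0 k x y : 0 <= cutw k x y.
Proof. by have /andP[? _] := g01 k y; rewrite !mulr_ge0 ?expR_ge0. Qed.

Lemma measurable_cutw : (forall k, measurable_fun setT (g k)) ->
  forall k, measurable_fun setT (fun z : R * R => cutw k z.1 z.2).
Proof.
move=> mg k.
have m1 : measurable_fun setT (fun z : R * R => c * h * expR (2 * z.1)).
  apply: measurable_funM => //; apply: measurableT_comp => //.
  by apply: measurable_funM => //; exact: measurable_fst.
have m2 : measurable_fun setT (fun z : R * R => `|z.2 - z.1|).
  apply: measurableT_comp => //.
  by apply: measurable_funB; [exact: measurable_snd|exact: measurable_fst].
apply: measurable_funM; first apply: measurable_funM.
- exact: (measurableT_comp (mg k) measurable_snd).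
- by apply: measurableT_comp => //; apply: measurableT_comp => //; exact: measurable_funM.
- apply: (measurableT_comp (f := fun b : bool => b%:R : R)) => //.
  by apply: measurable_and; exact: measurable_fun_ler.
Qed.

Variable xi : nat -> R.
Let s k : R * R * R := chain_state (tstep c h) (0, 0, 1) xi k.
Let psi k := (s k).1.1.
Let phi k := (s k).1.2.
Let a k := (s k).2.
Let delta k := jump c h (s k) (xi k).

Lemma chain_psiS k : psi k.+1 = psi k + xi k. Proof. by []. Qed.

Lemma chain_phiS k : phi k.+1 = phi k + xi k + delta k. Proof. by []. Qed.

(** The additive update becomes multiplicative by [expqN]. This yields positivity of [a], and for b
    = 1/a exactly the recursion studied above. *)
Lemma chain_aS k : a k.+1 = a k * (1 + delta k * expq (- (2 * xi k))).
Proof.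
have -> : a k.+1 = a k + delta k ^+ 2 / (c * h * expR (2 * (psi k + xi k))) by [].
rewrite expqN expRN mulrDr expRD /delta /jump /rate -/(a k) -/(psi k).
field; rewrite !gt_eqF ?expR_gt0//.
Qed.

Lemma chain_a_gt0 k : 0 < a k.
Proof.
elim: k => [|k IH]; first exact: ltr01.
rewrite chain_aS mulr_gt0// ltr_wpDr// !mulr_ge0// ?ltW// ?expR_gt0//.
  exact: expq_gt0.
exact: expq_gt0.
Qed.

Lemma chain_delta_ge0 k : 0 <= delta k.
Proof.
rewrite /delta /jump /rate -/(a k) !mulr_ge0 ?expR_ge0 ?ltW ?expq_gt0//.
exact: chain_a_gt0.
Qed.

Let W k := chain_weight (tstep c h) (tweight c h cutw) (0, 0, 1) xi k.

(** The inequality a e^{2 psi} <= e^{2 phi} is carried along because it bounds the rate, which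
    involves the unobserved psi, by z = c h e^{2 phi}, which the cutoff sees. In the continuum a =
    e^{phi - psi} with phi >= psi. *)
Lemma chain_cut_step k : a k * expR (2 * psi k) <= expR (2 * phi k) ->
  tweight c h cutw k (s k) (xi k) != 0 ->
  [/\ a k.+1 * expR (2 * psi k.+1) <= expR (2 * phi k.+1) &
      tweight c h cutw k (s k) (xi k) <= expR (- delta k)].
Proof.
move=> apk.
rewrite /tweight -/(phi k).
have -> : phi k + shift (rate c h (s k)) (xi k) = phi k.+1.
  by rewrite chain_phiS /shift addrA.
rewrite /cutw; case: andP => [[e1 e2]|_]; last by rewrite mulr0 mul0r eqxx.
move=> _; rewrite mulr1.
set z := c * h * expR (2 * phi k) in e2 *.
have z0 : 0 < z by rewrite !mulr_gt0// expR_gt0.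
have a0 := chain_a_gt0 k; have d0 := chain_delta_ge0 k.
have rz : rate c h (s k) <= z.
  by rewrite /rate -/(a k) -/(psi k) -mulrA ler_wpM2l// mulr_ge0// ltW.
have r0 : 0 <= rate c h (s k).
  by rewrite /rate !mulr_ge0// ?ltW// ?expR_gt0.
have xe : xi k <= 20^-1.
  move: e1; rewrite chain_phiS (_ : _ - phi k = xi k + delta k); last by ring.
  by rewrite ler_norml => /andP[_]; lra.
have e10 : expR (2 * 20^-1 : R) <= 2.
  have := @expR_1BM_le R (2 * 20^-1); have := expR_gt0 (2 * 20^-1 : R); lra.
have e310 : expR (6 * 20^-1 : R) <= 2.
  have := @expR_1BM_le R (6 * 20^-1); have := expR_gt0 (6 * 20^-1 : R); lra.
(* The indicator gives |xi + delta| <= 1/20 and delta >= 0, so xi <= 1/20; then delta <= 2 z <= 1/10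
   gives xi >= -3/20, and both quotients are at most 2. *)
have E2 : expq (2 * xi k) <= 2.
  by apply: le_trans e10; apply: expq_le; [rewrite ler_pM2l|rewrite mulr_ge0// invr_ge0].
have d2 : delta k <= 2 * z.
  rewrite mulrC; apply: ler_pM => //; exact/ltW/expq_gt0.
have xe' : - (3 * 20^-1) <= xi k.
  move: e1; rewrite chain_phiS (_ : _ - phi k = xi k + delta k); last by ring.
  by rewrite ler_norml => /andP[+ _]; lra.
have E'2 : expq (- (2 * xi k)) <= 2.
  by apply: le_trans e310; apply: expq_le; lra.
split.
  rewrite chain_psiS chain_phiS chain_aS.
  have ed := expR_ge1Dx (2 * delta k).
  apply: (@le_trans _ _ (a k * expR (2 * delta k) * expR (2 * (psi k + xi k)))).
    rewrite ler_wpM2r ?expR_ge0// ler_wpM2l ?(ltW a0)//.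
    apply: le_trans ed; rewrite lerD2l mulrC ler_wpM2r//.
  rewrite (_ : 2 * (phi k + xi k + delta k) = 2 * phi k + (2 * delta k + 2 * xi k)); last by ring.
  rewrite mulrDr !expRD (_ : a k * _ * _ = a k * expR (2 * psi k) *
    (expR (2 * delta k) * expR (2 * xi k))); last by ring.
  by rewrite ler_wpM2r// mulr_ge0 ?expR_ge0.
have sh1 := @shift'_ge1 R _ (xi k) r0.
rewrite ger0_norm; last by rewrite (le_trans ler01).
have /andP[g0 g1] := g01 k (phi k.+1).
have J : shift' (rate c h (s k)) (xi k) <= expR (2 * delta k).
  apply: le_trans (expR_ge1Dx _).
  rewrite /shift' lerD2l -mulrA ler_wpM2l// /delta /jump ler_wpM2l//.
  exact: expq'_le.
(* The constant 6 in [cutw]: the Jacobian is at most e^{2 delta} and delta <= 2 z, so that e^{-6z}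
   e^{2 delta} <= e^{-delta}. *)
apply: (@le_trans _ _ (expR (- (6 * z)) * expR (2 * delta k))).
  by rewrite ler_pM ?mulr_ge0 ?expR_ge0 ?(le_trans ler01 sh1)// ler_piMl ?expR_ge0.
by rewrite -expRD ler_expR; lra.
Qed.

(** Either some factor vanishes or every step passes the cutoff and [chain_cut_step] iterates. The
    bound on [W] provides domination; together with the inequality on [a] it forces the limit 0 when
    c A_t >= 1. *)
Lemma chain_weight_bound k : W k = 0 \/
  (a k * expR (2 * psi k) <= expR (2 * phi k) /\
   W k <= expR (- \sum_(j < k) delta j)).
Proof.
have WS j : W j.+1 = W j * tweight c h cutw j (s j) (xi j).
  by rewrite /W /chain_weight big_ord_recr.
elim: k => [|k [IH|[IH1 IH2]]].
- right; split; first by rewrite mul1r.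
  by rewrite /W /chain_weight !big_ord0 oppr0 expR0.
- by left; rewrite WS IH mul0r.
- rewrite WS; have [->|tw0] := eqVneq (tweight c h cutw k (s k) (xi k)) 0.
    by left; rewrite mulr0.
  right; have [h1 h2] := chain_cut_step IH1 tw0.
  split=> //; rewrite big_ord_recr/= opprD expRD ler_pM//.
  + by apply: chain_weight_ge0 => j x y; apply: tweight_ge0 => *; exact: cutw_ge0.
  + by apply: tweight_ge0 => *; exact: cutw_ge0.
Qed.

Lemma chain_weight_le k : W k <= expR (- \sum_(j < k) delta j).
Proof. by case: (chain_weight_bound k) => [->|[]//]; exact: expR_ge0. Qed.

Lemma chain_phiE k : phi k = psi k + \sum_(j < k) delta j.
Proof.
elim: k => [|k IH]; first by rewrite big_ord0 addr0.
by rewrite chain_phiS chain_psiS IH big_ord_recr/=; ring.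
Qed.

End cut_weight.

(** * Transport of a product functional to finer dyadic levels *)

Section refinement.
Context {R : realType}.

(** The factor of index [k] is evaluated at the grid point [k.+1], so the odd indices are the points
    shared with the coarser grid; the new points get the factor 1. *)
Fixpoint refine (g : nat -> R -> R) (i k : nat) (x : R) : R :=
  if i is i'.+1 then (if odd k then refine g i' k./2 x else 1) else g k x.

Lemma prod_refine (g : nat -> R -> R) (m i : nat) (y : nat -> R) :
  \prod_(k < 2 ^ (m + i)) refine g i k (y k.+1) =
  \prod_(j < 2 ^ m) g j (y (j.+1 * 2 ^ i)%N).
Proof.
elim: i y => [|i IH] y.
  by rewrite addn0; apply: eq_bigr => j _; rewrite muln1.
have {}IH := IH (fun k => y k.*2).
have e : (2 ^ (m + i.+1) = (2 ^ (m + i)).*2)%N by rewrite addnS expnS mul2n.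
have H N (z : nat -> R) : \prod_(k < N.*2) z k =
    \prod_(k < N) (z k.*2 * z k.*2.+1).
  elim: N => [|N IHN]; first by rewrite !big_ord0.
  by rewrite doubleS !big_ord_recr/= IHN mulrA.
rewrite e (H _ (fun k => refine g i.+1 k (y k.+1))) (eq_bigr (fun k : 'I__ => refine g i k (y k.+1.*2))) => [|k _].
  rewrite IH; apply: eq_bigr => j _.
  by rewrite expnS mulnCA mul2n.
by rewrite /= odd_double/= mul1r uphalf_double doubleS.
Qed.

Lemma refine_itv (g : nat -> R -> R) i : (forall k x, 0 <= g k x <= 1) ->
  forall k x, 0 <= refine g i k x <= 1.
Proof.
move=> g01; elim: i => [|i IH] k x //=.
by case: ifP => // _; rewrite ler01 lexx.
Qed.

Lemma measurable_refine (g : nat -> R -> R) i :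
  (forall k, measurable_fun setT (g k)) ->
  forall k, measurable_fun setT (refine g i k).
Proof. by move=> mg; elim: i => [|i IH] k //=; case: (odd k). Qed.

End refinement.

(** * Pathwise limit of the transformed weights *)

Section path_limit.
Context {R : realType}.
Variables (t c : R) (X : R -> R) (m0 : nat) (g : nat -> R -> R).
Hypotheses (t0 : 0 < t) (c0 : 0 < c).
Hypothesis cX : {within `[0, t], continuous X}.
Hypothesis X0 : X 0 = 0.
Hypothesis g01 : forall k x, 0 <= g k x <= 1.
Hypothesis cg : forall k, continuous (g k).

Local Notation mesh := (mesh t).
Local Notation grid := (grid t).

Definition incr (n k : nat) : R := X (grid n k.+1) - X (grid n k).

Let gl n := refine g (n - m0).
Let st n k : R * R * R := chain_state (tstep c (mesh n)) (0, 0, 1) (incr n) k.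
Let x n k := c * mesh n * expR (2 * X (grid n k)).
Let E n k := expq (2 * incr n k).
Let E' n k := expq (- (2 * incr n k)).
Let F n k := 2 * expq' (2 * incr n k).
Let b n k := ((st n k).2)^-1.
Let W n k :=
  chain_weight (tstep c (mesh n)) (tweight c (mesh n) (cutw c (mesh n) (gl n)))
    (0, 0, 1) (incr n) k.
Let phi n k := (st n k).1.2.
Let D n k := \sum_(j < k) x n j / b n j * E n j.

Let psiE n k : (st n k).1.1 = X (grid n k).
Proof.
elim: k => [|k IH]; first by rewrite /grid mul0r X0.
by rewrite /st /= -/(st n k) IH /incr addrC subrK.
Qed.

Let a0 n k : 0 < (st n k).2.
Proof. by apply: chain_a_gt0 => //; exact: mesh_gt0. Qed.

Let rateE n k : rate c (mesh n) (st n k) = x n k / b n k.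
Proof. by rewrite /rate psiE /x /b invrK; ring. Qed.

Let jumpE n k : jump c (mesh n) (st n k) (incr n k) = x n k / b n k * E n k.
Proof. by rewrite /jump rateE. Qed.

Let phiE n k : phi n k = X (grid n k) + D n k.
Proof.
rewrite /phi chain_phiE -/(st n k) psiE; congr (_ + _).
by apply: eq_bigr => j _; rewrite -jumpE.
Qed.

Let x0 n k : 0 <= x n k.
Proof. by rewrite !mulr_ge0 ?expR_ge0 ?ltW// mesh_gt0. Qed.

Let b0 n : b n 0 = 1. Proof. by rewrite /b invr1. Qed.

Let bp n k : 0 < b n k. Proof. by rewrite invr_gt0. Qed.

Let E0 n k : 0 < E n k. Proof. exact: expq_gt0. Qed.

Let E'0 n k : 0 < E' n k. Proof. exact: expq_gt0. Qed.

Let F0 n k : 0 <= F n k. Proof. by rewrite mulr_ge0 ?expq'_ge0. Qed.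

Let bS n k : b n k.+1 = b n k / (1 + x n k * (E n k * E' n k) / b n k).
Proof.
rewrite {1}/b /st chain_aS ?mesh_gt0// -/(st n k) jumpE invfM.
by congr (_ / (1 + _)); rewrite /E'; ring.
Qed.

Let At := c * expA X t.

Let At0 : 0 < At.
Proof. by rewrite mulr_gt0// (expA_gt0 t0 cX)// t0/=. Qed.

Let M := At + 1.

(** All that is used about the path at level [n]: small increments, small rates before division by
    b, and Riemann sums uniformly close to c A. *)
Definition fine_mesh (theta : R) (n : nat) : Prop :=
  [/\ forall k, (k < 2 ^ n)%N -> `|incr n k| <= theta,
      forall k, (k < 2 ^ n)%N -> x n k <= theta &
      forall k, (k <= 2 ^ n)%N ->
        `|\sum_(j < k) x n j - c * expA X (grid n k)| <= theta].

Lemma near_fine_mesh theta : 0 < theta -> \forall n \near \oo, fine_mesh theta n.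
Proof.
move=> th0; have [B B0 XB] := path_bounded t0 cX.
have r0 : 0 < theta / (c * expR (2 * B)) by rewrite divr_gt0// mulr_gt0// expR_gt0.
have r1 : 0 < theta / c by rewrite divr_gt0.
near=> n; split.
- by near: n; exact: (path_increment_small t0 cX th0).
- move=> k kn.
  have hn : mesh n < theta / (c * expR (2 * B)) by near: n; exact: mesh_small.
  have /andP[g0 g1] := grid_itv t0 (ltnW kn).
  have XkB : X (grid n k) <= B by apply: XB; rewrite g0.
  apply: (@le_trans _ _ (c * mesh n * expR (2 * B))).
    by rewrite ler_wpM2l ?ler_expR ?ler_pM2l// mulr_ge0 ?ltW// mesh_gt0.
  rewrite mulrAC mulrC -ler_pdivlMr ?mulr_gt0 ?expR_gt0//; exact: ltW.
- move=> k kn.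
  rewrite (_ : \sum_(j < k) x n j =
    c * \sum_(j < k) mesh n * expR (2 * X (grid n j))); last first.
    by rewrite mulr_sumr; apply: eq_bigr => j _; rewrite mulrA.
  rewrite -mulrBr normrM (gtr0_norm c0) mulrC -ler_pdivlMr//.
  by move: k kn; near: n; exact: riemann_sum.
Unshelve. all: by end_near. Qed.

Section fixed_level.
Variables (th : R) (n : nat).
Hypotheses (th0 : 0 < th) (th1 : 10 * th <= 1).
Hypothesis fm : fine_mesh (th / 32) n.

Let N := (2 ^ n)%N.

Let small k : (k < N)%N -> `|2 * incr n k| <= th / 16.
Proof.
move=> kN; have [/(_ k kN) h _ _] := fm.
by rewrite normrM ger0_norm//; move: h; lra.
Qed.

Let expq_small w : `|w| <= th / 16 -> `|expq w - 1| <= th.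
Proof.
move=> w16; have [->|w0] := eqVneq w 0.
  by rewrite /expq eqxx subrr normr0 ltW.
have w2 : `|w| <= 2^-1 by have := th1; lra.
have := expq_taylor1 w0 w2.
set q := (expq w - 1) / w => qle.
rewrite (_ : expq w - 1 = q * w); last by rewrite /q divfK.
rewrite normrM; have q2 : `|q| <= 2.
  rewrite -(subrK 2^-1 q) (le_trans (ler_normD _ _))//.
  by rewrite (@ger0_norm _ 2^-1) ?invr_ge0//; lra.
apply: (@le_trans _ _ (2 * (th / 16))); last by have := th0; lra.
exact: ler_pM.
Qed.

Let E1 k : (k < N)%N -> `|E n k - 1| <= th.
Proof. by move=> kN; exact/expq_small/small. Qed.

Let E'1 k : (k < N)%N -> `|E' n k - 1| <= th.
Proof. by move=> kN; apply: expq_small; rewrite normrN; exact: small. Qed.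

Let F1 k : (k < N)%N -> `|F n k - 1| <= th.
Proof.
move=> kN; have w16 := small kN; have w2 : `|2 * incr n k| <= 2^-1.
  by have := th1; lra.
rewrite (_ : F n k - 1 = 2 * (expq' (2 * incr n k) - 2^-1)); last first.
  by rewrite /F; lra.
rewrite normrM ger0_norm//; have := expq'_taylor0 w2.
by move: w16; have := th0; lra.
Qed.

Let xtau k : (k < N)%N -> x n k <= th.
Proof.
by move=> kN; have [_ /(_ k kN) h _] := fm; apply: le_trans h _; have := th0; lra.
Qed.

Let Ak k := c * expA X (grid n k).

Let xA k : (k <= N)%N -> `|\sum_(j < k) x n j - Ak k| <= th.
Proof.
by move=> kN; have [_ _ /(_ k kN) h] := fm; apply: le_trans h _; have := th0; lra.
Qed.

Let AkAt k : (k <= N)%N -> Ak k <= At.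
Proof.
move=> kN; have /andP[g0 g1] := grid_itv t0 kN.
by rewrite ler_pM2l// (expA_mono t0 cX).
Qed.

Let AM k : (k <= N)%N -> Ak k + th <= M.
Proof. by move=> kN; apply: lerD; [exact: AkAt|have := th1; have := th0; lra]. Qed.

Lemma level_ge : 1 - At - (1 + 3 * M) * th <= b n N.
Proof.
have h := recursion_ge_limit (x0 n) (b0 n) (bp n) (E0 n) (E'0 n) (bS n)
  (ltW th0) th1 E1 E'1 xA AM (leqnn N).
by apply: le_trans h; rewrite /Ak (grid_last t).
Qed.

Variable mm : R.
Hypotheses (mm0 : 0 < mm) (bN : mm <= b n N).

Lemma level_b k : (k <= N)%N ->
  `|b n k - (1 - c * expA X (grid n k))| <= (1 + 3 * M + 4 * M / mm) * th.
Proof.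
move=> kN; have h := recursion_limit (x0 n) (b0 n) (bp n) (E0 n) (E'0 n) (bS n)
  (ltW th0) th1 E1 E'1 xtau (ltW th0) xA AM mm0 bN kN.
by apply: le_trans h _; lra.
Qed.

Let C := 2 * (M / mm * (3 + 4 / mm)).

Lemma level_D k : (k <= N)%N -> `|D n k + ln (b n k)| <= C * th.
Proof.
move=> kN; have h := recursion_sum_limit (x0 n) (b0 n) (bp n) (E0 n) (E'0 n)
  (bS n) (ltW th0) th1 E1 E'1 xtau (ltW th0) xA AM mm0 bN kN.
by apply: le_trans h _; rewrite /C; lra.
Qed.

Lemma level_J : `|\sum_(j < N) ln (1 + x n j / b n j * F n j) + ln (b n N)|
  <= C * th.
Proof.
have h := recursion_jacobian_limit (x0 n) (b0 n) (bp n) (E0 n) (E'0 n)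
  (bS n) (ltW th0) th1 E1 E'1 F1 xtau (ltW th0) xA AM mm0 bN (leqnn N) (F0 n).
by apply: le_trans h _; rewrite /C; lra.
Qed.

Lemma level_S : C * th <= 8^-1 ->
  `|\sum_(j < N) x n j * expR (2 * D n j) - ((b n N)^-1 - 1)|
  <= M / mm ^+ 2 * (3 + 4 * C) * th.
Proof.
move=> Cth.
have h := recursion_exponential_limit (x0 n) (b0 n) (bp n) (E0 n) (E'0 n)
  (bS n) (ltW th0) th1 E1 E'1 xtau (ltW th0) xA AM mm0 bN.
apply: le_trans (h _) _; first by move: Cth; rewrite /C; lra.
rewrite -[leRHS]mulrA; apply: ler_wpM2l; last by rewrite /C; lra.
by rewrite divr_ge0 ?sqr_ge0// /M addr_ge0// ltW.
Qed.

Lemma level_jump k : (k < N)%N -> 0 <= x n k / b n k * E n k <= 2 / mm * th.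
Proof.
move=> kN; rewrite mulr_ge0 ?(ltW (E0 _ _))// ?divr_ge0 ?(ltW (bp _ _))//=.
have bm : mm <= b n k.
  apply: le_trans bN _; rewrite -(subnKC (ltnW kN)); elim: (N - k)%N.
    by rewrite addn0.
  by move=> j IH; rewrite addnS (le_trans (recursion_nonincreasing
    (x0 n) (bp n) (E0 n) (E'0 n) (bS n) _)).
have E2 : E n k <= 2.
  by have := E1 kN; rewrite ler_norml => /andP[_]; have := th1; lra.
rewrite (_ : 2 / mm * th = th / mm * 2); last by ring.
apply: ler_pM => //; first by rewrite divr_ge0 ?(ltW (bp _ _)).
  by rewrite ltW.
apply: ler_pM => //; first by rewrite invr_ge0 ltW.
  exact: xtau.
by rewrite lef_pV2 ?posrE.
Qed.

End fixed_level.

Let potential n := c / 2 * (expR (2 * X t) / b n (2 ^ n)%N).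

Let tpotentialE n : tpotential c (st n (2 ^ n)%N) = potential n.
Proof. by rewrite /tpotential psiE (grid_last t) /potential /b invrK. Qed.

Let good n k := (`|phi n k.+1 - phi n k| <= 20^-1) &&
  (c * mesh n * expR (2 * phi n k) <= 20^-1).

(** When no cutoff is active the weight splits into the test functional, the damping exponential and
    the Jacobian, each of which has its own limit. *)
Let weightE n : (forall k, (k < 2 ^ n)%N -> good n k) -> W n (2 ^ n)%N =
  \prod_(k < 2 ^ n) gl n k (phi n k.+1) *
  (expR (- (6 * \sum_(j < 2 ^ n) x n j * expR (2 * D n j))) *
   expR (\sum_(j < 2 ^ n) ln (1 + x n j / b n j * F n j))).
Proof.
move=> gd; rewrite /W /chain_weight.
rewrite mulr_sumr -sumrN !expR_sum -!big_split/=.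
apply: eq_bigr => k _; rewrite /tweight -/(st n k) -/(phi n k).
have -> : phi n k + shift (rate c (mesh n) (st n k)) (incr n k) = phi n k.+1.
  by rewrite {2}/phi /st chain_phiS -/(st n k) /shift addrA.
rewrite /cutw -/(good n k) gd// mulr1 -mulrA; congr (_ * _).
have J1 : 1 <= shift' (rate c (mesh n) (st n k)) (incr n k).
  by rewrite shift'_ge1// rateE divr_ge0// ltW.
rewrite ger0_norm ?(le_trans ler01)//; congr (_ * _).
  by congr (expR (- (_ * _))); rewrite phiE mulrDr expRD /x !mulrA.
have -> : 1 + x n k / b n k * F n k = shift' (rate c (mesh n) (st n k)) (incr n k).
  by rewrite /shift' rateE /F; ring.
by rewrite lnK// posrE (lt_le_trans ltr01).
Qed.

(** The factors are the limits of the test functional along X - ln(1 - c A), of the damping in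
    [cutw], of the Jacobian and of exp(- [tpotential]). For c A_t >= 1 the transformed path explodes
    by time t, and the weights tend to 0. *)
Definition path_limit : R :=
  if At < 1 then
    \prod_(j < 2 ^ m0) g j (X (grid m0 j.+1) - ln (1 - c * expA X (grid m0 j.+1))) *
    (expR (- (6 * (At / (1 - At)))) * ((1 - At)^-1 *
      expR (- (c / 2 * (expR (2 * X t) / (1 - At))))))
  else 0.

Let cvg_of_bound (u : nat -> R) (l K th0 : R) : 0 < th0 -> 0 <= K ->
  (forall th, 0 < th -> th <= th0 -> \forall n \near \oo, `|u n - l| <= K * th) ->
  u n @[n --> \oo] --> l.
Proof.
move=> th00 K0 H; apply/cvgrPdist_le => e e0.
pose th := Num.min th0 (e / (K + 1)).
have K1 : 0 < K + 1 by rewrite ltr_wpDl.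
have thp : 0 < th by rewrite lt_min th00 divr_gt0.
have thl : th <= th0 by rewrite ge_min lexx.
apply: filterS (H th thp thl) => n /le_trans; rewrite distrC; apply.
apply: (@le_trans _ _ (K * (e / (K + 1)))).
  by rewrite ler_wpM2l// ge_min lexx orbT.
rewrite mulrCA ler_piMr ?(ltW e0)//.
by rewrite ler_pdivrMr// mul1r lerDl.
Qed.

Section subcritical.
Hypothesis At1 : At < 1.

(** Half of the limit of [b] at time t: [level_ge] keeps [b] above it for fine meshes. *)
Let mm := (1 - At) / 2.
Let mm0 : 0 < mm. Proof. by rewrite divr_gt0// subr_gt0. Qed.
Let C := 2 * (M / mm * (3 + 4 / mm)).

Let M0 : 0 < M. Proof. by rewrite addr_gt0. Qed.

Let C0 : 0 <= C.
Proof.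
have i0 : 0 <= mm^-1 by rewrite invr_ge0 ltW.
by apply: mulr_ge0 => //; apply: mulr_ge0; [rewrite mulr_ge0// ltW|rewrite addr_ge0// mulr_ge0].
Qed.

Let p1 : 0 < 1 + 3 * M. Proof. by rewrite ltr_wpDr// mulr_ge0// ltW. Qed.
Let p3 : 0 < C + 1. Proof. by rewrite ltr_wpDl. Qed.
Let p4 : 0 < 2 / mm + 1. Proof. by rewrite ltr_wpDl// divr_ge0// ltW. Qed.
Let p5 : 0 < expR 1 / mm ^+ 2.
Proof. by rewrite divr_gt0 ?expR_gt0// exprn_gt0. Qed.

(** Each entry of the minimum yields one of the five inequalities of [thmP]; the two with 1/20 keep
    the steps within the cutoff. *)
Let thm := Num.min (Num.min 10^-1 (mm / (1 + 3 * M)))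
  (Num.min (8^-1 / (C + 1)) (Num.min (20^-1 / (2 / mm + 1))
    (20^-1 / (expR 1 / mm ^+ 2)))).

Let thm0 : 0 < thm.
Proof.
rewrite !lt_min; apply/andP; split; [apply/andP; split|apply/and3P; split].
- by rewrite invr_gt0.
- exact: divr_gt0.
- by apply: divr_gt0 => //; rewrite invr_gt0.
- by apply: divr_gt0 => //; rewrite invr_gt0.
- by apply: divr_gt0 => //; rewrite invr_gt0.
Qed.

Let thmP th : 0 < th -> th <= thm -> [/\ 10 * th <= 1, (1 + 3 * M) * th <= mm,
  C * th <= 8^-1, (2 / mm + 1) * th <= 20^-1 & th * (expR 1 / mm ^+ 2) <= 20^-1].
Proof.
move=> th0; rewrite !le_min => /andP[/andP[h1 h2] /and3P[h3 h4 h5]].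
split.
- by move: h1; lra.
- by rewrite mulrC -ler_pdivlMr.
- apply: (@le_trans _ _ ((C + 1) * th)); first by rewrite ler_wpM2r// ?lerDl// ltW.
  by rewrite mulrC -ler_pdivlMr.
- by rewrite mulrC -ler_pdivlMr.
- by rewrite -ler_pdivlMr.
Qed.

Let level th : 0 < th -> th <= thm ->
  \forall n \near \oo, fine_mesh (th / 32) n /\ mm <= b n (2 ^ n)%N.
Proof.
move=> th0 /(thmP th0)[h1 h2 _ _ _].
have th32 : 0 < th / 32 by rewrite divr_gt0.
apply: filterS (near_fine_mesh th32) => n fm; split=> //.
by apply: le_trans (level_ge th0 h1 fm); move: h2; rewrite /mm; lra.
Qed.

Let Kb := 1 + 3 * M + 4 * M / mm.

Let Kb0 : 0 <= Kb.
Proof. by rewrite addr_ge0 ?(ltW p1)// divr_ge0 ?(ltW mm0)// mulr_ge0// ltW. Qed.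

Let cvg_b (s : R) (k : nat -> nat) : (\forall n \near \oo, (k n <= 2 ^ n)%N /\
    grid n (k n) = s) ->
  b n (k n) @[n --> \oo] --> 1 - c * expA X s.
Proof.
move=> ks; apply: (cvg_of_bound thm0 Kb0) => th th0 thl.
have [h1 _ _ _ _] := thmP th0 thl.
near=> n; have [kn <-] : (k n <= 2 ^ n)%N /\ grid n (k n) = s by near: n.
have [fm bm] : fine_mesh (th / 32) n /\ mm <= b n (2 ^ n)%N.
  by near: n; exact: level.
exact: (level_b th0 h1 fm mm0 bm kn).
Unshelve. all: by end_near. Qed.

Let ks_last : \forall n \near \oo, ((2 ^ n) <= 2 ^ n)%N /\ grid n (2 ^ n)%N = t.
Proof. by near=> n; split => //; exact: grid_last. Unshelve. all: by end_near. Qed.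

Let cvg_bN : b n (2 ^ n)%N @[n --> \oo] --> 1 - At.
Proof. exact: cvg_b ks_last. Qed.

Let expA_lt1 s : 0 <= s <= t -> 0 < 1 - c * expA X s.
Proof.
move=> /andP[s0 s1]; rewrite subr_gt0 (le_lt_trans _ At1)//.
by rewrite ler_pM2l// (expA_mono t0 cX).
Qed.

Let cvg_lnb (s : R) (k : nat -> nat) : 0 <= s <= t ->
  (\forall n \near \oo, (k n <= 2 ^ n)%N /\ grid n (k n) = s) ->
  ln (b n (k n)) @[n --> \oo] --> ln (1 - c * expA X s).
Proof.
move=> s0t /cvg_b H; apply: continuous_cvg H.
exact/continuous_ln/expA_lt1.
Qed.

Let cvg_D (s : R) (k : nat -> nat) : 0 <= s <= t ->
  (\forall n \near \oo, (k n <= 2 ^ n)%N /\ grid n (k n) = s) ->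
  D n (k n) @[n --> \oo] --> - ln (1 - c * expA X s).
Proof.
move=> s0t ks.
have H : D n (k n) + ln (b n (k n)) @[n --> \oo] --> 0.
  apply: (cvg_of_bound thm0 C0) => th th0 thl.
  have [h1 _ _ _ _] := thmP th0 thl.
  near=> n; have [kn _] : (k n <= 2 ^ n)%N /\ grid n (k n) = s by near: n.
  have [fm bm] : fine_mesh (th / 32) n /\ mm <= b n (2 ^ n)%N.
    by near: n; exact: level.
  by rewrite subr0; exact: (level_D th0 h1 fm mm0 bm kn).
rewrite (_ : (fun n => D n (k n)) = fun n =>
    D n (k n) + ln (b n (k n)) - ln (b n (k n))); last first.
  by apply/funext => n; rewrite addrK.
rewrite -[X in _ --> X]sub0r; exact: cvgB H (cvg_lnb s0t ks).
Unshelve. all: by end_near. Qed.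

Let cvg_J : \sum_(j < 2 ^ n) ln (1 + x n j / b n j * F n j) @[n --> \oo]
  --> - ln (1 - At).
Proof.
have H : \sum_(j < 2 ^ n) ln (1 + x n j / b n j * F n j) + ln (b n (2 ^ n)%N)
    @[n --> \oo] --> 0.
  apply: (cvg_of_bound thm0 C0) => th th0 thl.
  have [h1 _ _ _ _] := thmP th0 thl.
  near=> n; have [fm bm] : fine_mesh (th / 32) n /\ mm <= b n (2 ^ n)%N.
    by near: n; exact: level.
  by rewrite subr0; exact: (level_J th0 h1 fm mm0 bm).
have tt : 0 <= t <= t by rewrite lexx ltW.
rewrite (_ : (fun n => \sum_(j < 2 ^ n) _) = fun n =>
    \sum_(j < 2 ^ n) ln (1 + x n j / b n j * F n j) + ln (b n (2 ^ n)%N)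
    - ln (b n (2 ^ n)%N)); last by apply/funext => n; rewrite addrK.
rewrite -[X in _ --> X]sub0r; exact: cvgB H (cvg_lnb tt ks_last).
Unshelve. all: by end_near. Qed.

Let cvg_S : \sum_(j < 2 ^ n) x n j * expR (2 * D n j) @[n --> \oo]
  --> At / (1 - At).
Proof.
have K0 : 0 <= M / mm ^+ 2 * (3 + 4 * C).
  by rewrite mulr_ge0 ?divr_ge0 ?sqr_ge0 ?(ltW M0)// addr_ge0// mulr_ge0.
have H : \sum_(j < 2 ^ n) x n j * expR (2 * D n j) - ((b n (2 ^ n)%N)^-1 - 1)
    @[n --> \oo] --> 0.
  apply: (cvg_of_bound thm0 K0) => th th0 thl.
  have [h1 _ h3 _ _] := thmP th0 thl.
  near=> n; have [fm bm] : fine_mesh (th / 32) n /\ mm <= b n (2 ^ n)%N.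
    by near: n; exact: level.
  by rewrite subr0; exact: (level_S th0 h1 fm mm0 bm h3).
have A1 : 1 - At != 0 by rewrite gt_eqF// subr_gt0.
rewrite (_ : (fun n => \sum_(j < 2 ^ n) _) = fun n =>
    \sum_(j < 2 ^ n) x n j * expR (2 * D n j) - ((b n (2 ^ n)%N)^-1 - 1)
    + ((b n (2 ^ n)%N)^-1 - 1)); last by apply/funext => n; rewrite subrK.
rewrite (_ : At / (1 - At) = 0 + ((1 - At)^-1 - 1)); last by field.
exact: cvgD H (cvgB (cvgV A1 cvg_bN) (cvg_cst (1 : R))).
Unshelve. all: by end_near. Qed.

(** Below criticality [b] stays away from 0, so the jumps and the damping rates along the
    transformed walk are uniformly small, and the cutoff is eventually inactive. *)
Let near_good : \forall n \near \oo, forall k, (k < 2 ^ n)%N -> good n k.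
Proof.
have [h1 h2 h3 h4 h5] := thmP thm0 (lexx _).
apply: filterS (level thm0 (lexx _)) => n [fm bm] k kn.
have lj := level_jump thm0 h1 fm mm0 bm kn.
have lD : `|D n k + ln (b n k)| <= 8^-1.
  exact: le_trans (level_D thm0 h1 fm mm0 bm (ltnW kn)) h3.
have bmk : mm <= b n k.
  apply: le_trans bm _; rewrite -(subnKC (ltnW kn)); elim: (_ - k)%N.
    by rewrite addn0.
  by move=> j IH; rewrite addnS (le_trans (recursion_nonincreasing
    (x0 n) (bp n) (E0 n) (E'0 n) (bS n) _)).
have [f1 f2 _] := fm; apply/andP; split.
  rewrite !phiE /D big_ord_recr/=.
  rewrite (_ : _ - _ = incr n k + x n k / b n k * E n k); last first.
    by rewrite /incr; ring.
  move: lj => /andP[j0 j1].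
  rewrite (le_trans (ler_normD _ _))// (ger0_norm j0).
  have := f1 k kn; have := thm0; move: h4 j1; lra.
rewrite phiE mulrDr expRD mulrA -/(x n k).
apply: le_trans h5; apply: ler_pM => //.
  by apply: le_trans (f2 k kn) _; have := thm0; lra.
(* As D + ln b is at most 1/8, e^{2D} is at most e / b^2, hence at most e / mm^2. *)
apply: (@le_trans _ _ (expR (1 - 2 * ln (b n k)))).
  by rewrite ler_expR; move: lD; rewrite ler_norml => /andP[_]; lra.
rewrite expRD ler_wpM2l ?expR_ge0// expRN mulr2n mulrDl mul1r expRD.
rewrite lnK ?posrE// -expr2 lef_pV2 ?posrE ?exprn_gt0//.
by rewrite ler_pXn2r ?nnegrE// ltW.
Qed.

Let cvg_prodr (K : nat) (u : nat -> nat -> R) (l : nat -> R) :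
  (forall j, (j < K)%N -> u n j @[n --> \oo] --> l j) ->
  \prod_(j < K) u n j @[n --> \oo] --> \prod_(j < K) l j.
Proof.
elim: K => [|K IH] H.
  by under eq_fun do rewrite big_ord0; rewrite big_ord0; exact: cvg_cst.
under eq_fun do rewrite big_ord_recr/=; rewrite big_ord_recr/=.
by apply: cvgM; [apply: IH => j jK; apply/H/ltnW|exact: H].
Qed.

Let cvg_G : \prod_(k < 2 ^ n) gl n k (phi n k.+1) @[n --> \oo] -->
  \prod_(j < 2 ^ m0)
    g j (X (grid m0 j.+1) - ln (1 - c * expA X (grid m0 j.+1))).
Proof.
have e : \forall n \near \oo, \prod_(j < 2 ^ m0) g j (phi n (j.+1 * 2 ^ (n - m0))%N)
    = \prod_(k < 2 ^ n) gl n k (phi n k.+1).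
  near=> n; rewrite /gl -(prod_refine g m0 (n - m0) (phi n)) subnKC//.
  by near: n; exact: nbhs_infty_ge.
apply: cvg_trans (near_eq_cvg e) _.
apply: (cvg_prodr (u := fun n j => g j (phi n (j.+1 * 2 ^ (n - m0))%N))
  (l := fun j => g j (X (grid m0 j.+1) - ln (1 - c * expA X (grid m0 j.+1))))).
move=> j jK.
apply: (@continuous_cvg _ _ _ _ _ (fun n => phi n (j.+1 * 2 ^ (n - m0))%N) (g j)).
  exact: cg.
have s0t := grid_itv t0 jK.
have ks : \forall n \near \oo, (j.+1 * 2 ^ (n - m0) <= 2 ^ n)%N /\
    grid n (j.+1 * 2 ^ (n - m0)) = grid m0 j.+1.
  near=> n; have mn : (m0 <= n)%N by near: n; exact: nbhs_infty_ge.
  have en : (2 ^ n = 2 ^ m0 * 2 ^ (n - m0))%N by rewrite -expnD subnKC.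
  split; first by rewrite en leq_mul2r jK orbT.
  rewrite /grid /mesh -!natrX en !natrM.
  field; rewrite !pnatr_eq0 -!lt0n !expn_gt0//.
apply: cvg_trans (cvgD (cvg_cst (X (grid m0 j.+1))) (cvg_D s0t ks)).
apply: near_eq_cvg; near=> n; rewrite phiE.
by have [_ ->] : (j.+1 * 2 ^ (n - m0) <= 2 ^ n)%N /\
    grid n (j.+1 * 2 ^ (n - m0)) = grid m0 j.+1 by near: n.
Unshelve. all: by end_near. Qed.

Let cvg_subcritical :
  W n (2 ^ n)%N * expR (- tpotential c (st n (2 ^ n)%N)) @[n --> \oo]
  --> path_limit.
Proof.
have A1 : 0 < 1 - At by rewrite subr_gt0.
rewrite /path_limit At1.
have cE (u : nat -> R) (l : R) : u n @[n --> \oo] --> l ->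
    expR (u n) @[n --> \oo] --> expR l.
  by move=> ul; exact: (continuous_cvg _ (@continuous_expR R l) ul).
have cS : expR (- (6 * \sum_(j < 2 ^ n) x n j * expR (2 * D n j))) @[n --> \oo]
    --> expR (- (6 * (At / (1 - At)))).
  exact: (cE _ _ (cvgN (cvgM (cvg_cst (6 : R)) cvg_S))).
have cP : expR (- potential n) @[n --> \oo] -->
    expR (- (c / 2 * (expR (2 * X t) / (1 - At)))).
  have A1n : 1 - At != 0 by rewrite gt_eqF.
  exact: (cE _ _ (cvgN (cvgM (cvg_cst (c / 2))
    (cvgM (cvg_cst (expR (2 * X t))) (cvgV A1n cvg_bN))))).
have cJ : expR (\sum_(j < 2 ^ n) ln (1 + x n j / b n j * F n j)) @[n --> \oo]
    --> (1 - At)^-1.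
  rewrite (_ : (1 - At)^-1 = expR (- ln (1 - At))); last by rewrite expRN lnK.
  exact: cE cvg_J.
have H := cvgM cvg_G (cvgM cS (cvgM cJ cP)).
have e : \forall n \near \oo, \prod_(k < 2 ^ n) gl n k (phi n k.+1) *
    (expR (- (6 * \sum_(j < 2 ^ n) x n j * expR (2 * D n j))) *
     (expR (\sum_(j < 2 ^ n) ln (1 + x n j / b n j * F n j)) *
      expR (- potential n))) =
    W n (2 ^ n)%N * expR (- tpotential c (st n (2 ^ n)%N)).
  near=> n.
  have gd : forall k, (k < 2 ^ n)%N -> good n k by near: n; exact: near_good.
  by rewrite tpotentialE (weightE gd) !mulrA.
apply: cvg_trans (near_eq_cvg e) _; exact: H.
Unshelve. all: by end_near. Qed.

Lemma cvg_path_weight_subcritical :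
  W n (2 ^ n)%N * expR (- tpotential c (st n (2 ^ n)%N)) @[n --> \oo]
  --> path_limit.
Proof. exact: cvg_subcritical. Qed.

End subcritical.

Let gl01 n k y : 0 <= gl n k y <= 1.
Proof. exact: refine_itv. Qed.

Lemma path_weight_itv n :
  0 <= W n (2 ^ n)%N * expR (- tpotential c (st n (2 ^ n)%N)) <= 1.
Proof.
have W0 : 0 <= W n (2 ^ n)%N.
  apply: chain_weight_ge0 => j s' y; apply: tweight_ge0 => *.
  by apply: cutw_ge0 => // *; exact: gl01.
have P0 : 0 <= tpotential c (st n (2 ^ n)%N).
  by rewrite /tpotential !mulr_ge0 ?expR_ge0 ?ltW// invr_gt0.
rewrite mulr_ge0 ?expR_ge0//= -[leRHS]mulr1 ler_pM ?expR_ge0//.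
  apply: le_trans (chain_weight_le c0 (mesh_gt0 t0 n) (gl01 n) _ _) _.
  rewrite -[leRHS]expR0 ler_expR oppr_le0 sumr_ge0// => j _.
  by apply: chain_delta_ge0 => //; exact: mesh_gt0.
by rewrite -[leRHS]expR0 ler_expR oppr_le0.
Qed.

(** In the supercritical case, a weight exceeding some e > 0 at a fine level would force [b] at time
    t above e^2, while [b] must be close to 1 - c A_t <= 0. *)
Lemma cvg_path_weight :
  W n (2 ^ n)%N * expR (- tpotential c (st n (2 ^ n)%N)) @[n --> \oo]
  --> path_limit.
Proof.
have [At1|At1] := ltP At 1; first exact: cvg_path_weight_subcritical.
rewrite /path_limit ltNge At1/=.
apply/cvgrPdist_le => e e0.
pose mm := e ^+ 2; have mm0 : 0 < mm by rewrite exprn_gt0.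
have M0 : 0 < M by rewrite addr_gt0.
pose K := 1 + 3 * M + 4 * M / mm.
have K0 : 0 < K.
  have p1 : 0 < 1 + 3 * M by rewrite ltr_wpDr// mulr_ge0// ltW.
  by rewrite ltr_wpDr// divr_ge0 ?(ltW mm0)// mulr_ge0// ltW.
pose th := Num.min 10^-1 (mm / (2 * K)).
have th0 : 0 < th by rewrite lt_min invr_gt0 ltr0n/= divr_gt0// mulr_gt0.
have th1 : 10 * th <= 1.
  have : th <= 10^-1 by rewrite ge_min lexx.
  by lra.
have thK : K * th < mm.
  have : th <= mm / (2 * K) by rewrite ge_min lexx orbT.
  rewrite -(ler_pM2l K0) => /le_lt_trans; apply.
  rewrite (_ : K * (mm / (2 * K)) = mm / 2); last by field; rewrite gt_eqF.
  by rewrite ltr_pdivrMr// ltr_pMr// ltr1n.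
have th32 : 0 < th / 32 by rewrite divr_gt0.
apply: filterS (near_fine_mesh th32) => n fm.
have /andP[W0 W1] := path_weight_itv n.
rewrite sub0r normrN ger0_norm// leNgt; apply/negP => We.
have P0 : 0 <= tpotential c (st n (2 ^ n)%N).
  by rewrite /tpotential !mulr_ge0 ?expR_ge0 ?ltW// invr_gt0.
have eW : e < W n (2 ^ n)%N.
  apply: lt_le_trans We _; rewrite ler_piMr//.
    apply: chain_weight_ge0 => j s' y; apply: tweight_ge0 => *.
    by apply: cutw_ge0 => // *; exact: gl01.
  by rewrite -[leRHS]expR0 ler_expR oppr_le0.
have := chain_weight_bound c0 (mesh_gt0 t0 n) (gl01 n) (incr n) (2 ^ n)%N.
case=> [We0|]; first by move: eW; rewrite /W We0 ltNge ltW.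
rewrite -/(st n (2 ^ n)%N) -/(phi n (2 ^ n)%N) -/(W n (2 ^ n)%N).
rewrite psiE phiE (eq_bigr (fun j : 'I__ => x n j / b n j * E n j)) => [|j _]; last first.
  exact: jumpE.
rewrite -/(D n (2 ^ n)%N) => -[aD WD].
(* From W <= e^{-D} follows e < e^{-D}, and a e^{2 psi} <= e^{2 phi} at the final time reads 1/b <=
   e^{2D}; together they give b > e^2, here with [e] the tolerance. *)
have bm : mm <= b n (2 ^ n)%N.
  have eD : e < expR (- D n (2 ^ n)%N) by exact: lt_le_trans eW WD.
  rewrite /b -[leLHS]invrK lef_pV2 ?posrE ?invr_gt0//.
  apply: (@le_trans _ _ (expR (2 * D n (2 ^ n)%N))).
    move: aD; rewrite mulrDr expRD [leRHS]mulrC ler_pM2r ?expR_gt0//.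
  rewrite /mm -[leLHS]invrK lef_pV2 ?posrE ?invr_gt0 ?expR_gt0 ?exprn_gt0//.
  rewrite -expRN -mulrN mulr2n mulrDl mul1r expRD expr2.
  by apply: ler_pM; exact: ltW.
have := level_b th0 th1 fm mm0 bm (leqnn _).
rewrite (grid_last t) -/At ler_norml => /andP[_].
by have := thK; have := bm; have := At1; rewrite /K; lra.
Qed.

End path_limit.

(** * The Borel sigma-field of the path space and its determining functionals *)

Section Cspace_topology.
Context {R : realType} (t : R).

Lemma Cspace_nbhsP (phi : Cspace t) (P : set (Cspace t)) :
  nbhs phi P <-> exists2 e : R, 0 < e &
    forall psi : Cspace t, (forall s, `|phi s - psi s| < e) -> P psi.
Proof.
split.
- case/nbhsP => V [W entW WV] VP; move: entW.
  rewrite uniform_entourage => -[E entE EW].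
  move: entE; rewrite -entourage_ballE => -[e e0 eE].
  exists e => // psi H; apply/VP/xsectionP/WV/EW => /= s _.
  exact/eE/H.
- case=> e e0 H; apply/nbhsP.
  exists [set z : Cspace t * Cspace t | forall s, `|z.1 s - z.2 s| < e].
    exists [set z : {uniform set_type (`[0, t] : set R) -> R} *
      {uniform set_type (`[0, t] : set R) -> R} | forall s, `|z.1 s - z.2 s| < e];
      last by [].
    rewrite uniform_entourage.
    exists [set z : R * R | `|z.1 - z.2| < e]; last first.
      by move=> z /= zs s; exact: zs.
    by rewrite -entourage_ballE; exists e.
  by move=> psi /xsectionP; exact: H.
Qed.

End Cspace_topology.

Lemma bigcapT_countable_measurable d (T : measurableType d) (I : countType)
    (F : I -> set T) :
  (forall i, measurable (F i)) -> measurable (\bigcap_i F i).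
Proof.
move=> mF; rewrite -[X in measurable X]setCK; apply: measurableC.
rewrite setC_bigcap; apply: countable_bigcupT_measurable => // i.
exact/measurableC/mF.
Qed.

Section Cspace_borel.
Context {R : realType} (t : R).
Hypothesis t0 : 0 < t.

Lemma mem_segment (s : R) : 0 <= s <= t -> s \in (`[0, t]%classic : set R).
Proof. by move=> st; rewrite inE/= in_itv. Qed.

Lemma extend_in (phi : Cspace t) (s : R) (st : s \in (`[0, t]%classic : set R)) :
  extend phi s = phi (SigSub st).
Proof. by rewrite -(extendE phi (SigSub st)). Qed.

Lemma set_val_segment (s : set_type (`[0, t]%classic : set R)) :
  0 <= set_val s <= t.
Proof. by have := set_valP s; rewrite /= in_itv. Qed.

Lemma Cspace_ext (phi psi : Cspace t) :
  (forall s, 0 <= s <= t -> extend phi s = extend psi s) -> phi = psi.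
Proof.
move=> H; have : Cspace_fun phi = Cspace_fun psi.
  by apply/funext => s; rewrite -!extendE; apply/H/set_val_segment.
case: phi psi {H} => [f [[cf]]] [g [[cg]]]; rewrite /Cspace_fun/= => fg.
by subst g; rewrite (Prop_irrelevance cf cg).
Qed.

Lemma Cspace_ball (phi : Cspace t) (O : set (Cspace t)) : open O -> O phi ->
  exists2 e : R, 0 < e & forall psi : Cspace t,
    (forall s, 0 <= s <= t -> `|extend phi s - extend psi s| < e) -> O psi.
Proof.
move=> oO Op; have /Cspace_nbhsP[e e0 H] : nbhs phi O by exact: open_nbhs_nbhs.
exists e => // psi Hpsi; apply: H => s.
by rewrite -!extendE; apply/Hpsi/set_val_segment.
Qed.

Lemma extend_measurable (s : R) : 0 <= s <= t ->
  measurable_fun setT ((fun phi => extend phi s) : borel (Cspace t) -> R).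
Proof.
move=> st; apply: (measurability _ (RGenOInfty.measurableE R)) => _ [_ [q ->] <-].
rewrite setTI; apply: sub_sigma_algebra.
suff : open ([set phi | q < extend phi s] : set (Cspace t)).
  congr open; apply/seteqP; split => phi;
    by rewrite /preimage/= in_itv/= andbT.
rewrite openE => phi /= qs; apply/Cspace_nbhsP.
exists (extend phi s - q); first by rewrite subr_gt0.
move=> psi /(_ (SigSub (mem_segment st))).
by rewrite -!extend_in /= ltr_norml => /andP[_]; lra.
Qed.

Lemma grid_near (m : nat) (s : R) : 0 <= s <= t ->
  exists2 j, (0 < j <= 2 ^ m)%N & `|grid t m j - s| <= mesh t m.
Proof.
move=> /andP[s0 st]; have h0 := mesh_gt0 t0 m.
pose z := s / mesh t m.
have z0 : 0 <= z by rewrite divr_ge0// ltW.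
have /andP[z1 z2] := truncn_itv z0.
have sz : s = z * mesh t m by rewrite divfK ?gt_eqF.
have zN : z <= (2 ^ m)%:R.
  by rewrite ler_pdivrMr// -[(2 ^ m)%:R * _]/(grid t m (2 ^ m)) grid_last.
have [k0|k0] := posnP (Num.truncn z).
  (* Node 0 is excluded, so a point of the first cell is attached to node 1. *)
  exists 1%N; first by rewrite expn_gt0.
  rewrite /grid mul1r; move: z2; rewrite k0 => z2.
  rewrite ger0_norm; first by rewrite lerBlDr lerDl.
  by rewrite subr_ge0 sz ler_piMl// ltW.
exists (Num.truncn z).
  by rewrite k0/= -(ler_nat R) (le_trans z1).
rewrite {1}sz /grid -mulrBl normrM (gtr0_norm h0) ler_piMl ?(ltW h0)//.
by rewrite distrC ger0_norm ?subr_ge0// lerBlDl natr1 ltW.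
Qed.

(* Only positive grid times are used, so that the value at [0] is never
   constrained. *)
Definition cylinder (m : nat) (g : nat -> R -> R) : set (Cspace t) :=
  [set phi | forall j, (j < 2 ^ m)%N -> 0 < g j (extend phi (grid t m j.+1))].

Definition cylinders : set (set (Cspace t)) :=
  [set E | exists (m : nat) (g : nat -> R -> R), [/\ forall j x, 0 <= g j x <= 1,
    forall j, continuous (g j) & E = cylinder m g]].

(** It expresses the half-line x > q as the positivity set of a continuous function with values in
    [0, 1], and, applied to r x with r growing, approximates the indicator of x > 0 from below. *)
Definition clamp (x : R) : R := Num.min 1 (Num.max 0 x).

Lemma clamp_itv x : 0 <= clamp x <= 1.
Proof. by rewrite /clamp le_min ler01 le_max lexx ge_min lexx. Qed.

Lemma clamp_gt0 x : (0 < clamp x) = (0 < x).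
Proof. by rewrite /clamp lt_min ltr01 lt_max ltxx. Qed.

Lemma continuous_clamp : continuous clamp.
Proof.
move=> x; apply: continuous_min; first exact: cvg_cst.
by apply: continuous_max; [exact: cvg_cst|exact: cvg_id].
Qed.

Local Notation cyl := (g_sigma_algebraType cylinders).

Lemma cylinder_extend_measurable n k : (0 < k <= 2 ^ n)%N ->
  measurable_fun setT ((fun phi => extend phi (grid t n k)) : cyl -> R).
Proof.
case: k => // k /andP[_ kn].
apply: (measurability _ (RGenOInfty.measurableE R)) => _ [_ [q ->] <-].
rewrite setTI; apply: sub_sigma_algebra.
exists n, (fun j x => if j == k then clamp (x - q) else 1); split.
- by move=> j x; case: ifP => _; [exact: clamp_itv|rewrite ler01 lexx].
- have cc : continuous (fun x : R => clamp (x - q)).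
    move=> x; apply: (@continuous_comp _ _ _ (fun x : R => x - q) clamp).
      by apply: cvgB; [exact: cvg_id|exact: cvg_cst].
    exact: continuous_clamp.
  by move=> j; case: (j == k) => //; exact: cst_continuous.
- apply/seteqP; split => phi /=.
    rewrite /preimage/= in_itv/= andbT => qs j jn.
    by case: eqP => [->|_]; rewrite ?clamp_gt0 ?subr_gt0.
  move/(_ k kn); rewrite eqxx clamp_gt0 subr_gt0.
  by rewrite /preimage/= in_itv/= andbT.
Qed.

(** The index holds a grid level, rational heights at its nodes and a precision. Only dyadic values
    are constrained, so a tube is a countable intersection of cylinder events; as there are
    countably many tubes, they act as a countable base for uniform convergence. *)
Let tube (i : nat * seq rat * nat) : set (Cspace t) :=
  [set psi | forall n k j, (0 < k <= 2 ^ n)%N -> (j <= 2 ^ i.1.1)%N ->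
     `|grid t n k - grid t i.1.1 j| <= mesh t i.1.1 ->
     `|extend psi (grid t n k) - ratr (nth 0 i.1.2 j)| <= i.2.+1%:R^-1].

Let tube_measurable i : measurable (tube i : set cyl).
Proof.
pose H (a : nat * nat * nat) : set cyl := [set psi | (0 < a.1.2 <= 2 ^ a.1.1)%N -> (a.2 <= 2 ^ i.1.1)%N ->
     `|grid t a.1.1 a.1.2 - grid t i.1.1 a.2| <= mesh t i.1.1 ->
     `|extend psi (grid t a.1.1 a.1.2) - ratr (nth 0 i.1.2 a.2)| <= i.2.+1%:R^-1].
rewrite (_ : tube i = \bigcap_a H a); last first.
  apply/seteqP; split => [psi T [[n k] j] _ /=|psi T n k j]; first exact: T.
  exact: (T (n, k, j) I).
apply: bigcapT_countable_measurable => -[[n k] j]; rewrite /H/=.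
have [kn|kn] := boolP (0 < k <= 2 ^ n)%N; last first.
  by rewrite (_ : mkset _ = setT)//; apply/seteqP; split.
have [jN|jN] := boolP (j <= 2 ^ i.1.1)%N; last first.
  by rewrite (_ : mkset _ = setT)//; apply/seteqP; split.
have [jm|jm] := boolP (`|grid t n k - grid t i.1.1 j| <= mesh t i.1.1); last first.
  by rewrite (_ : mkset _ = setT)//; apply/seteqP; split.
have me := cylinder_extend_measurable kn.
have mf : measurable_fun setT ((fun psi => `|extend psi (grid t n k) -
    ratr (nth 0 i.1.2 j)|) : cyl -> R).
  by apply: measurableT_comp => //; exact: measurable_funB.
have := mf measurableT _ (measurable_itv `]-oo, i.2.+1%:R^-1 : R]).
rewrite setTI; congr measurable; apply/seteqP; split => psi /=.
  by rewrite /preimage/= in_itv/= => H1 _ _ _.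
by rewrite /preimage/= in_itv/= => /(_ isT isT isT).
Qed.

Let tube_close i (phi psi : Cspace t) : tube i phi -> tube i psi ->
  forall s, 0 <= s <= t ->
    `|extend phi s - extend psi s| <= 2 * i.2.+1%:R^-1.
Proof.
move=> Tphi Tpsi s st; apply/ler_addgt0Pr => e e0.
have e2 : 0 < e / 2 by rewrite divr_gt0.
have [r1 r10 H1] := segment_unif_continuous (@extend_continuous R t phi) e2.
have [r2 r20 H2] := segment_unif_continuous (@extend_continuous R t psi) e2.
(* The point [s] is approached by a node of a very fine grid, where both paths are constrained by
   the same rational height; uniform continuity pays the arbitrarily small error. *)
have [n [h1 h2]] : exists n, mesh t n < r1 /\ mesh t n < r2.
  near \oo => n; exists n; split.
    by near: n; exact: mesh_small.
  by near: n; exact: mesh_small.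
have [k kn ks] := grid_near n st.
have gk : 0 <= grid t n k <= t by apply: grid_itv => //; case/andP: kn.
have [j jm ju] := grid_near i.1.1 gk; rewrite distrC in ju.
have jN : (j <= 2 ^ i.1.1)%N by case/andP: jm.
have := Tphi n k j kn jN ju; have := Tpsi n k j kn jN ju.
have := H1 _ _ gk st (le_lt_trans ks h1); have := H2 _ _ gk st (le_lt_trans ks h2).
set a := extend phi s; set b := extend psi s; set u := extend phi _.
set v := extend psi _; set q := ratr _; set z := i.2.+1%:R^-1.
rewrite !ler_norml => /andP[? ?] /andP[? ?] /andP[? ?] /andP[? ?].
by apply/andP; split; lra.
Unshelve. all: by end_near. Qed.

Let tube_cover (phi : Cspace t) (r : nat) : exists i, i.2 = r /\ tube i phi.
Proof.
pose e : R := 2^-1 * r.+1%:R^-1.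
have e0 : 0 < e by rewrite mulr_gt0.
have [d d0 H] := segment_unif_continuous (@extend_continuous R t phi) e0.
have [m hm] : exists m, mesh t m < d.
  by near \oo => m; exists m; near: m; exact: mesh_small.
have Q (j : nat) : exists q : rat, `|extend phi (grid t m j) - ratr q| <= e.
  have : extend phi (grid t m j) < extend phi (grid t m j) + e by rewrite ltrDl.
  move=> /rat_in_itvoo[q]; rewrite in_itv/= => /andP[q1 q2]; exists q.
  by rewrite ler_norml; apply/andP; split; lra.
exists (m, mkseq (fun j => projT1 (cid (Q j))) (2 ^ m).+1, r); split=> //.
move=> n k j kn jN /= jk; rewrite nth_mkseq//; case: cid => q /= hq.
have gk : 0 <= grid t n k <= t by apply: grid_itv => //; case/andP: kn.
have := H _ _ gk (grid_itv t0 jN) (le_lt_trans jk hm).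
move: hq; rewrite /e; set z := r.+1%:R^-1; set v := ratr q.
set u := extend _ _; set v' := extend _ _.
rewrite !ler_norml => /andP[? ?] /andP[? ?].
by apply/andP; split; lra.
Unshelve. all: by end_near. Qed.

(** An open set is the countable union of the tubes it contains, by [tube_cover] and [tube_close];
    conversely evaluations are continuous, so cylinders are Borel. *)
Lemma measurable_CspaceE :
  (measurable : set (set (borel (Cspace t)))) = <<s cylinders >>.
Proof.
apply/seteqP; split.
- apply: smallest_sub; first exact: smallest_sigma_algebra.
  move=> O oO.
  pose F i := if `[< tube i `<=` O >] then tube i else set0.
  rewrite (_ : O = \bigcup_i F i).
    apply: (@countable_bigcupT_measurable _ cyl) => // i.
    by rewrite /F; case: ifP => _; [exact: tube_measurable|exact: measurable0].
  apply/seteqP; split => [phi Op|phi [i _]]; last first.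
    by rewrite /F; case: asboolP => // iO /iO.
  have [e e0 H] := Cspace_ball oO Op.
  have [r hr] : exists r : nat, 2 * r.+1%:R^-1 < e.
    exists (Num.truncn (2 / e)).
    by rewrite ltr_pdivrMr// mulrC -ltr_pdivrMr// truncnS_gt.
  have [i [ir Ti]] := tube_cover phi r.
  exists i => //; rewrite /F; case: asboolP => // iO; case: iO => psi Tpsi.
  apply: H => s st; apply: le_lt_trans (tube_close Ti Tpsi st) _.
  by rewrite ir.
- apply: smallest_sub; first exact: sigma_algebra_measurable.
  move=> _ [m [g [g01 cg ->]]].
  have -> : cylinder m g = \bigcap_j (if (j < 2 ^ m)%N then
      [set phi : borel (Cspace t) | 0 < g j (extend phi (grid t m j.+1))] else setT).
    apply/seteqP; split => [phi H j _|phi H j jm].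
      by case: ifP => // jm; exact: H.
    by have := H j I; rewrite jm.
  apply: bigcapT_measurable => j; case: ifP => // jm.
  have me := extend_measurable (grid_itv t0 jm).
  have mg := measurableT_comp (continuous_measurable_fun (cg j)) me.
  have := mg measurableT _ (measurable_itv `]0 : R, +oo[).
  rewrite setTI; congr measurable; apply/seteqP; split => phi.
    by rewrite /preimage/= in_itv/= andbT.
  by rewrite /preimage/= in_itv/= andbT.
Qed.

Lemma measurable_Cspace d (T : measurableType d) (Y : T -> Cspace t) :
  (forall s, 0 <= s <= t -> measurable_fun setT (fun w => extend (Y w) s)) ->
  measurable_fun setT (Y : T -> borel (Cspace t)).
Proof.
move=> mY; apply: (measurability _ measurable_CspaceE).
move=> _ [_ [m [g [g01 cg ->]]] <-]; rewrite setTI.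
have -> : Y @^-1` cylinder m g = \bigcap_j (if (j < 2 ^ m)%N then
    [set w | 0 < g j (extend (Y w) (grid t m j.+1))] else setT).
  apply/seteqP; split => [w H j _|w H j jm].
    by case: ifP => // jm; exact: H.
  by have := H j I; rewrite jm.
apply: bigcapT_measurable => j; case: ifP => // jm.
have me := mY _ (grid_itv t0 jm).
have mg := measurableT_comp (continuous_measurable_fun (cg j)) me.
have := mg measurableT _ (measurable_itv `]0 : R, +oo[).
rewrite setTI; congr measurable; apply/seteqP; split => phi.
  by rewrite /preimage/= in_itv/= andbT.
by rewrite /preimage/= in_itv/= andbT.
Qed.

Definition cylinder_prod (m : nat) (g : nat -> R -> R) (phi : Cspace t) : R :=
  \prod_(j < 2 ^ m) g j (extend phi (grid t m j.+1)).

Lemma grid_refine (m i k : nat) : grid t (m + i) (k * 2 ^ i) = grid t m k.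
Proof.
rewrite /grid /mesh exprD natrM natrX.
by field; rewrite !expf_neq0.
Qed.

Lemma cylinder_prod_refine (m i : nat) g phi :
  cylinder_prod (m + i) (refine g i) phi = cylinder_prod m g phi.
Proof.
rewrite /cylinder_prod (prod_refine g m i (fun k => extend phi (grid t (m + i) k))).
by apply: eq_bigr => j _; rewrite grid_refine.
Qed.

Lemma cylinderE m g : (forall j x, 0 <= g j x <= 1) ->
  cylinder m g = [set phi | 0 < cylinder_prod m g phi].
Proof.
move=> g01; apply/seteqP; split => phi /= H.
  by apply: prodr_gt0 => j _; exact: H.
move=> j jm; have /andP[g0 _] := g01 j (extend phi (grid t m j.+1)).
rewrite lt_neqAle g0 andbT; apply: contraTN H => /eqP gj.
by rewrite /cylinder_prod (bigD1 (Ordinal jm))//= -gj mul0r ltxx.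
Qed.

Lemma cylinder_prod_itv m g phi : (forall j x, 0 <= g j x <= 1) ->
  0 <= cylinder_prod m g phi <= 1.
Proof.
move=> g01; apply/andP; split.
  by apply: prodr_ge0 => j _; have /andP[] := g01 j (extend phi (grid t m j.+1)).
by apply: prodr_ile1 => j _; exact: g01.
Qed.

Lemma continuous_refine (g : nat -> R -> R) i :
  (forall k, continuous (g k)) -> forall k, continuous (refine g i k).
Proof.
move=> cg; elim: i => [|i IH] k; first exact: cg.
by rewrite /=; case: (odd k); [exact: IH|exact: cst_continuous].
Qed.

(** Both cylinders are moved to the common level m + m' by [refine], where the product of the test
    functions describes the intersection. *)
Lemma cylinders_setI : setI_closed cylinders.
Proof.
move=> _ _ [m [g [g01 cg ->]]] [m' [g' [g'01 cg' ->]]].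
exists (m + m')%N, (fun j x => refine g m' j x * refine g' m j x); split.
- move=> j x; have /andP[a0 a1] := refine_itv m' g01 j x.
  have /andP[b0 b1] := refine_itv m g'01 j x.
  by rewrite mulr_ge0//= -[leRHS]mulr1 ler_pM.
- move=> j x; apply: cvgM; exact: continuous_refine.
- rewrite !cylinderE//; last first.
    move=> j x; have /andP[a0 a1] := refine_itv m' g01 j x.
    have /andP[b0 b1] := refine_itv m g'01 j x.
    by rewrite mulr_ge0//= -[leRHS]mulr1 ler_pM.
  apply/seteqP; split => phi /=; rewrite /cylinder_prod big_split/=;
    rewrite -/(cylinder_prod (m + m') (refine g m') phi);
    rewrite -/(cylinder_prod (m + m') (refine g' m) phi);
    rewrite cylinder_prod_refine addnC cylinder_prod_refine.
    by move=> [? ?]; rewrite mulr_gt0.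
  have /andP[a0 _] := cylinder_prod_itv m phi g01.
  have /andP[b0 _] := cylinder_prod_itv m' phi g'01.
  rewrite !lt_neqAle a0 b0 mulr_ge0// !andbT eq_sym mulf_eq0 negb_or.
  by rewrite !(eq_sym 0) => /andP.
Qed.

Lemma cylinder_prod_measurable m g : (forall k, measurable_fun setT (g k)) ->
  measurable_fun setT (cylinder_prod m g : borel (Cspace t) -> R).
Proof.
move=> mg.
have mh (j : 'I_(2 ^ m)) : j \in index_enum 'I_(2 ^ m) -> measurable_fun setT
    ((fun phi => g j (extend phi (grid t m j.+1))) : borel (Cspace t) -> R).
  move=> _; apply: (measurableT_comp (mg j)).
  exact: (extend_measurable (grid_itv t0 (ltn_ord j))).
exact: measurable_prod mh.
Qed.

Lemma cvg_prodr (K : nat) (u : nat -> nat -> R) (l : nat -> R) :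
  (forall j, (j < K)%N -> u n j @[n --> \oo] --> l j) ->
  \prod_(j < K) u n j @[n --> \oo] --> \prod_(j < K) l j.
Proof.
elim: K => [|K IH] H.
  by under eq_fun do rewrite big_ord0; rewrite big_ord0; exact: cvg_cst.
under eq_fun do rewrite big_ord_recr/=; rewrite big_ord_recr/=.
by apply: cvgM; [apply: IH => j jK; apply/H/ltnW|exact: H].
Qed.

(** The indicator of a cylinder is the increasing limit of products of the functions min(1, r g_j),
    so its measure is determined by integrals of product functionals. *)
Lemma measure_cylinder (mu : {measure set (borel (Cspace t)) -> \bar R}) (m : nat)
    (g : nat -> R -> R) :
  (forall j x, 0 <= g j x <= 1) -> (forall j, continuous (g j)) ->
  mu (cylinder m g) = limn (fun r : nat => (\int[mu]_phi
    (cylinder_prod m (fun j x => clamp (r.+1%:R * g j x)) phi)%:E)%E).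
Proof.
move=> g01 cg.
pose gr (r : nat) j (x : R) := clamp (r.+1%:R * g j x).
have gr01 r j x : 0 <= gr r j x <= 1 by exact: clamp_itv.
have mgr r k : measurable_fun setT (gr r k).
  apply: (measurableT_comp (continuous_measurable_fun continuous_clamp)).
  by apply: measurable_funM => //; exact: (continuous_measurable_fun (cg k)).
rewrite -monotone_convergence//.
- rewrite -[in LHS](setIT (cylinder m g)) -integral_indic//; last first.
    rewrite measurable_CspaceE; apply: sub_sigma_algebra; exists m, g; split=> //.
  apply: eq_integral => phi _; apply/esym/cvg_lim => //.
  apply: cvg_EFin; first by near=> r.
  rewrite (_ : \1_(cylinder m g) phi = \prod_(j < 2 ^ m)
     (0 < g j (extend phi (grid t m j.+1)))%R%:R); last first.
    rewrite indicE; have [|H] := boolP (phi \in cylinder m g).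
      by rewrite inE => H; rewrite big1// => j _; rewrite H.
    apply/esym/eqP/prodf_eq0; move: H; rewrite notin_setE.
    move=> /existsNP[j /not_implyP[jm /negP gj]].
    by exists (Ordinal jm) => //=; rewrite (negbTE gj).
  apply: (cvg_prodr (u := fun r j => gr r j (extend phi (grid t m j.+1)))
    (l := fun j => (0 < g j (extend phi (grid t m j.+1)))%R%:R)) => j jm.
  set y := extend _ _; have /andP[g0 _] := g01 j y.
  move: g0; rewrite le_eqVlt => /predU1P[g0|g0].
    rewrite -g0 ltxx; apply: cvg_near_cst; near=> r.
    rewrite /gr -g0 mulr0; apply/eqP.
    by rewrite eq_le (andP (clamp_itv _)).1 andbT leNgt clamp_gt0 ltxx.
  rewrite g0; apply: cvg_near_cst; near=> r.
  rewrite /gr /clamp; apply/eqP; rewrite min_l//.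
  rewrite le_max -ler_pdivrMr// div1r; apply/orP; right.
  have : (Num.truncn (g j y)^-1 <= r)%N by near: r; exact: nbhs_infty_ge.
  rewrite -ltnS -(ler_nat R) => /(le_trans _); apply.
  exact/ltW/truncnS_gt.
- move=> r; apply/measurable_EFinP; exact: (cylinder_prod_measurable m (mgr r)).
- by move=> r phi _; rewrite lee_fin (andP (cylinder_prod_itv m phi (gr01 r))).1.
- move=> phi _ r r' rr'; rewrite lee_fin; apply: ler_prod => j _.
  rewrite (andP (clamp_itv _)).1/=.
  rewrite /clamp le_min ge_min lexx/= ge_min ge_max !le_max lexx/=.
  apply/orP; right; apply/orP; right; rewrite ler_wpM2r ?ler_nat//.
  by have /andP[] := g01 j (extend phi (grid t m j.+1)).
Unshelve. all: by end_near. Qed.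

Lemma Cspace_measure_unique (mu nu : {measure set (borel (Cspace t)) -> \bar R}) :
  (mu setT < +oo)%E ->
  (forall (m : nat) (g : nat -> R -> R), (forall j x, 0 <= g j x <= 1) -> (forall j, continuous (g j)) ->
    (\int[mu]_phi (cylinder_prod m g phi)%:E =
     \int[nu]_phi (cylinder_prod m g phi)%:E)%E) ->
  forall E, measurable E -> mu E = nu E.
Proof.
move=> fmu H E mE.
apply: (@measure_unique _ R (borel (Cspace t)) cylinders (fun=> setT) _ _ _ _ mu nu _ _ _ mE).
- exact: measurable_CspaceE.
- exact: cylinders_setI.
- move=> _; exists 0%N, (fun _ _ => 1); split.
  + by move=> _ _; rewrite ler01 lexx.
  + by move=> _; exact: cst_continuous.
  + by apply/seteqP; split=> // phi _ j _; exact: ltr01.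
- by rewrite bigcup_const//; exists 0%N.
- move=> _ [m [g [g01 cg ->]]]; rewrite !measure_cylinder//.
  congr (limn _); apply/funext => r; apply: H => [j x|j].
    exact: clamp_itv.
  have cc : continuous (fun x : R => clamp (r.+1%:R * g j x)).
    move=> x; apply: (@continuous_comp _ _ _ (fun x : R => r.+1%:R * g j x) clamp).
      by apply: cvgM; [exact: cvg_cst|exact: cg].
    exact: continuous_clamp.
  exact: cc.
- by [].
Qed.

(** Uniqueness is applied to the images under [Y1] and [Y2] of the measures with densities [w1] and
    [w2]; testing on product functionals then suffices for all nonnegative [F]. *)
Lemma Cspace_weighted_law_unique d (T : measurableType d)
    (P : {measure set T -> \bar R}) (Y1 Y2 : T -> Cspace t) (w1 w2 : T -> R) :
  measurable_fun setT (Y1 : T -> borel (Cspace t)) ->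
  measurable_fun setT (Y2 : T -> borel (Cspace t)) ->
  measurable_fun setT w1 -> measurable_fun setT w2 ->
  (forall w, 0 <= w1 w) -> (forall w, 0 <= w2 w) ->
  (\int[P]_w (w1 w)%:E < +oo)%E ->
  (forall (m : nat) (g : nat -> R -> R), (forall j x, 0 <= g j x <= 1) -> (forall j, continuous (g j)) ->
    (\int[P]_w (cylinder_prod m g (Y1 w) * w1 w)%:E =
     \int[P]_w (cylinder_prod m g (Y2 w) * w2 w)%:E)%E) ->
  forall F : borel (Cspace t) -> \bar R, measurable_fun setT F ->
  (forall phi, 0 <= F phi)%E ->
  (\int[P]_w (F (Y1 w) * (w1 w)%:E) = \int[P]_w (F (Y2 w) * (w2 w)%:E))%E.
Proof.
move=> mY1 mY2 mw1 mw2 w10 w20 fw1 H F mF F0.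
have key (Y : T -> borel (Cspace t)) (w : T -> R) (mY : measurable_fun setT Y)
    (mw : measurable_fun setT w) (w0 : forall x, 0 <= w x)
    (G : borel (Cspace t) -> \bar R) : measurable_fun setT G ->
    (forall phi, 0 <= G phi)%E ->
    (\int[P]_x (G (Y x) * (w x)%:E) =
     \int[pushforward (density_measure P mw w0) Y]_phi G phi)%E.
  move=> mG G0; rewrite [RHS]ge0_integral_pushforward//= preimage_setT.
  by rewrite ge0_integral_density//; exact: measurableT_comp.
rewrite (key _ _ mY1 mw1 w10)// (key _ _ mY2 mw2 w20)//.
have {}key Y w mY mw w0 := key Y w mY mw w0.
pose m1 := pushforward (density_measure P mw1 w10) (Y1 : T -> borel (Cspace t)).
pose m2 := pushforward (density_measure P mw2 w20) (Y2 : T -> borel (Cspace t)).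
apply: eq_measure_integral => E mE _.
apply: (@Cspace_measure_unique m1 m2) => //.
move=> m g g01 cg.
have mG : measurable_fun setT
    ((fun phi => (cylinder_prod m g phi)%:E) : borel (Cspace t) -> \bar R).
  apply/measurable_EFinP; apply: cylinder_prod_measurable => k.
  exact: continuous_measurable_fun.
have G0 (phi : borel (Cspace t)) : (0 <= (cylinder_prod m g phi)%:E)%E.
  by rewrite lee_fin (andP (cylinder_prod_itv m phi g01)).1.
rewrite /m1 /m2 -!key//.
by under eq_integral do rewrite -EFinM; rewrite H//;
  under eq_integral do rewrite EFinM.
Qed.

End Cspace_borel.

Lemma measurable_invr {R : realType} : measurable_fun setT (fun x : R => x^-1).
Proof.
(* The last branch agrees with the convention that the inverse of 0 is 0. *)
apply: (eq_measurable_fun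
    (fun x : R => if 0 < x then expR (- ln x) else
      if x < 0 then - expR (- ln (- x)) else 0)) => [x _|].
  case: ltgtP => [x0|x0|<-]; rewrite ?invr0//.
    by rewrite expRN lnK ?posrE ?oppr_gt0// ?invrN ?opprK.
    by rewrite expRN lnK ?posrE ?oppr_gt0// ?invrN ?opprK.
apply: measurable_fun_ifT => //; first exact: measurable_fun_ltr.
  by apply: measurableT_comp => //; apply: measurableT_comp.
apply: measurable_fun_ifT => //; first exact: measurable_fun_ltr.
apply: measurableT_comp => //; apply: measurableT_comp => //.
by apply: measurableT_comp => //; apply: measurableT_comp.
Qed.

(** * Algebra and measurability of dilations *)

Section transform_algebra.
Context {R : realType} (t : R).
Hypothesis t0 : 0 < t.
Implicit Types phi : Cspace t.

Lemma extend_expA_gt0 phi (s : R) : 0 < s <= t -> 0 < expA (extend phi) s.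
Proof. exact: (expA_gt0 t0 (@extend_continuous R t phi)). Qed.

Lemma extend_expA_le phi (s : R) : s <= t ->
  expA (extend phi) s <= expA (extend phi) t.
Proof. by move=> st; apply: expA_le => //; exact: extend_continuous. Qed.

(** Reparametrization of [transform] by c = (e^z - 1) / A_t, in which the path becomes phi - ln(1 +
    c A) and the inverse map has parameter -c. *)
Definition dilate (c : R) phi : Cspace t :=
  transform (ln (1 + c * expA (extend phi) t)) phi.

Lemma transform_extend (z : R) phi (s : R) : 0 <= s <= t ->
  extend (transform z phi) s = extend phi s -
    ln (1 + expA (extend phi) s / expA (extend phi) t * (expR z - 1)).
Proof.
move=> st; rewrite [LHS](extend_in _ (mem_segment st)).
by rewrite (extend_in phi (mem_segment st)).
Qed.

Lemma transform_dilate (z : R) phi :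
  transform z phi = dilate ((expR z - 1) / expA (extend phi) t) phi.
Proof.
have A0 : 0 < expA (extend phi) t by apply: extend_expA_gt0; rewrite t0/=.
rewrite /dilate divfK ?gt_eqF//; congr (transform _ phi).
by rewrite addrC subrK expRK.
Qed.

Section dilate.
Variables (c : R) (phi : Cspace t).
Hypothesis c1 : 0 < 1 + c * expA (extend phi) t.

Lemma dilate_arg_gt0 (s : R) : 0 <= s <= t -> 0 < 1 + c * expA (extend phi) s.
Proof.
move=> /andP[s0 s1]; have := extend_expA_le phi s1; have := expA_ge0 (extend phi) s.
have [c0|c0] := leP 0 c => A0 A1; first by rewrite ltr_wpDr// mulr_ge0.
by apply: lt_le_trans c1 _; rewrite lerD2l ler_nM2l.
Qed.

Lemma dilate_extend (s : R) : 0 <= s <= t ->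
  extend (dilate c phi) s = extend phi s - ln (1 + c * expA (extend phi) s).
Proof.
move=> st; rewrite transform_extend// lnK ?posrE//.
rewrite [1 + c * _]addrC addrK mulrCA divfK//.
by rewrite gt_eqF// extend_expA_gt0// t0/=.
Qed.

(** Both sides vanish at 0 and have the derivative e^{2 phi} / (1 + c A)^2 inside the interval; the
    mean value theorem on their difference concludes. *)
Lemma dilate_expA (s : R) : 0 <= s <= t ->
  expA (extend (dilate c phi)) s =
  expA (extend phi) s / (1 + c * expA (extend phi) s).
Proof.
move=> /andP[s0 s1]; set A := expA (extend phi); set A' := expA _.
have [->|sn0] := eqVneq s 0; first by rewrite /A /A' !expA0 mul0r.
have sp : 0 < s by rewrite lt_neqAle eq_sym sn0.
have cphi := @extend_continuous R t phi.
have cphi' := @extend_continuous R t (dilate c phi).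
pose f x := A' x - A x / (1 + c * A x).
have df x : 0 < x < t -> is_derive x 1 f 0.
  move=> xt; have /andP[x0 x1] := xt.
  have xt' : 0 <= x <= t by rewrite !ltW.
  have d1 := is_derive_expA cphi xt.
  have d2 := is_derive_expA cphi' xt.
  have g0 := dilate_arg_gt0 xt'.
  have d3 : is_derive x 1 (fun x => (1 + c * A x)^-1)
      (- (1 + c * A x) ^- 2 *: (c * expR (2 * extend phi x))).
    apply: is_deriveV; first by rewrite gt_eqF.
    by apply: is_derive_eq; rewrite /GRing.scale/=; ring.
  rewrite /f; apply: is_derive_eq.
  rewrite dilate_extend// mulrBr expRD -mulrN.
  rewrite (_ : expR (2 * - ln (1 + c * expA (extend phi) x)) =
     (1 + c * A x) ^- 2); last first.
    by rewrite mulrN expRN mulr2n mulrDl mul1r expRD lnK ?posrE// expr2.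
  by rewrite /GRing.scale/=; field; rewrite gt_eqF.
have cf : {within `[0, t], continuous f}.
  have cA := expA_continuous (ltW t0) cphi.
  have cA' := expA_continuous (ltW t0) cphi'.
  apply/subspace_continuousP => x xt.
  have HA := (subspace_continuousP _ _).1 cA x xt.
  have HA' := (subspace_continuousP _ _).1 cA' x xt.
  apply: cvgB; first exact: HA'.
  apply: cvgM; first exact: HA.
  apply: cvgV.
    by rewrite gt_eqF// dilate_arg_gt0//; move: xt; rewrite /= in_itv.
  by apply: cvgD; [exact: cvg_cst|apply: cvgM; [exact: cvg_cst|exact: HA]].
have [x||x _] := @MVT _ f (cst 0) 0 s sp.
- rewrite in_itv/= => /andP[x0 xs]; apply: df; rewrite x0/=.
  exact: lt_le_trans xs s1.
- apply: continuous_subspaceW cf => x /=; rewrite !in_itv/= => /andP[-> xs]/=.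
  exact: le_trans xs s1.
- rewrite /f {2}/A' /A !expA0 mul0r subrr subr0 mul0r => /eqP.
  by rewrite subr_eq0 => /eqP.
Qed.

Lemma dilate_expA_arg : 1 - c * expA (extend (dilate c phi)) t =
  (1 + c * expA (extend phi) t)^-1.
Proof. by rewrite dilate_expA ?lexx ?ltW//; field; rewrite gt_eqF. Qed.

Lemma dilateK : dilate (- c) (dilate c phi) = phi.
Proof.
have c2 : 0 < 1 + - c * expA (extend (dilate c phi)) t.
  by rewrite mulNr dilate_expA_arg invr_gt0.
apply: Cspace_ext => s st.
have p1 := dilate_arg_gt0 st.
rewrite {1}/dilate transform_extend// lnK ?posrE//.
rewrite [1 + - c * _]addrC addrK mulrCA divfK; last first.
  rewrite gt_eqF// extend_expA_gt0// t0/=//.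
rewrite dilate_extend// dilate_expA//.
rewrite (_ : 1 + - c * _ = (1 + c * expA (extend phi) s)^-1); last first.
  by field; rewrite gt_eqF.
by rewrite lnV ?posrE// opprK subrK.
Qed.

End dilate.

(** A pointwise limit of Riemann sums, each a finite combination of measurable evaluations. *)
Lemma expA_measurable (s : R) : 0 <= s <= t ->
  measurable_fun setT ((fun phi => expA (extend phi) s) : borel (Cspace t) -> R).
Proof.
move=> /andP[s0 st]; have [->|sn0] := eqVneq s 0.
  have m0 : measurable_fun setT (cst 0 : borel (Cspace t) -> R).
    exact: measurable_cst.
  by apply: eq_measurable_fun m0 => phi _; rewrite expA0.
have sp : 0 < s by rewrite lt_neqAle eq_sym sn0.
pose S n (phi : borel (Cspace t)) : R :=
  \sum_(j < 2 ^ n) mesh s n * expR (2 * extend phi (grid s n j)).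
have mS n : measurable_fun setT (S n).
  have mj (j : 'I_(2 ^ n)) : measurable_fun setT
    ((fun phi => mesh s n * expR (2 * extend phi (grid s n j))) :
       borel (Cspace t) -> R).
    apply: measurable_funM => //; apply: measurableT_comp => //.
    apply: measurable_funM => //; apply: extend_measurable.
    by have /andP[-> /le_trans->] := grid_itv sp (ltnW (ltn_ord j)).
  exact: (measurable_sum (index_enum 'I_(2 ^ n)) mj).
apply: (measurable_fun_cvg mS) => phi _; apply/cvgrPdist_le => e e0.
have cs : {within `[0, s], continuous (extend phi)}.
  apply: continuous_subspaceW (@extend_continuous R t phi) => x /=.
  by rewrite !in_itv/= => /andP[-> /le_trans->].
apply: filterS (riemann_sum sp cs e0) => n /(_ (2 ^ n)%N (leqnn _)).
by rewrite grid_last distrC.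
Qed.

Lemma measurable_transform d (T : measurableType d) (Z : T -> R)
    (Y : T -> Cspace t) :
  measurable_fun setT Z -> measurable_fun setT (Y : T -> borel (Cspace t)) ->
  measurable_fun setT ((fun w => transform (Z w) (Y w)) : T -> borel (Cspace t)).
Proof.
move=> mZ mY; apply: (measurable_Cspace t0) => s st.
under eq_fun do rewrite transform_extend//.
have tt : 0 <= t <= t by rewrite lexx ltW.
apply: measurable_funB; first exact: (measurableT_comp (extend_measurable st) mY).
apply: (measurableT_comp (@measurable_ln R)).
apply: measurable_funD => //; apply: measurable_funM.
  apply: measurable_funM; first exact: (measurableT_comp (expA_measurable st) mY).
  apply: (measurableT_comp measurable_invr).
  exact: (measurableT_comp (expA_measurable tt) mY).
by apply: measurable_funB => //; exact: measurableT_comp.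
Qed.

Lemma measurable_dilate d (T : measurableType d) (c : T -> R)
    (Y : T -> Cspace t) :
  measurable_fun setT c -> measurable_fun setT (Y : T -> borel (Cspace t)) ->
  measurable_fun setT ((fun w => dilate (c w) (Y w)) : T -> borel (Cspace t)).
Proof.
move=> mc mY; apply: measurable_transform => //.
have tt : 0 <= t <= t by rewrite lexx ltW.
apply: (measurableT_comp (@measurable_ln R)).
apply: measurable_funD => //; apply: measurable_funM => //.
exact: (measurableT_comp (expA_measurable tt) mY).
Qed.

End transform_algebra.

(** * Limit of the plain walk, and quasi-invariance for positive parameters *)

Section chain_ext.
Context {R : realType} {d : measure_display} {S : measurableType d}.
Variables (step : S -> R -> S) (u : nat -> S -> R -> R) (s0 : S).

Lemma eq_chain_state (xi xi' : nat -> R) k :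
  (forall i, (i < k)%N -> xi i = xi' i) ->
  chain_state step s0 xi k = chain_state step s0 xi' k.
Proof.
elim: k => //= k IH H; rewrite IH ?H// => i ik; apply: H; exact: ltnW.
Qed.

Lemma eq_chain_weight (xi xi' : nat -> R) k :
  (forall i, (i < k)%N -> xi i = xi' i) ->
  chain_weight step u s0 xi k = chain_weight step u s0 xi' k.
Proof.
move=> H; apply: eq_bigr => i _; rewrite H// (@eq_chain_state xi xi')// => j ji.
exact/H/(ltn_trans ji).
Qed.

End chain_ext.

Section walk_limit.
Context {R : realType}.
Variables (t c : R) (X : R -> R) (m : nat) (g : nat -> R -> R).
Hypotheses (t0 : 0 < t) (c0 : 0 < c).
Hypothesis cX : {within `[0, t], continuous X}.
Hypothesis X0 : X 0 = 0.
Hypothesis g01 : forall k x, 0 <= g k x <= 1.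

Let wk n := chain_weight (@walk R)
  (wweight (cutw c (mesh t n) (refine g (n - m)))) 0 (incr t X n) (2 ^ n).

Let walkE n k : chain_state (@walk R) 0 (incr t X n) k = X (grid t n k).
Proof.
elim: k => [|k IH]; first by rewrite /grid mul0r X0.
by rewrite /= IH /walk /incr addrC subrK.
Qed.

Let wkE n : wk n = \prod_(k < 2 ^ n)
  cutw c (mesh t n) (refine g (n - m)) k (X (grid t n k)) (X (grid t n k.+1)).
Proof.
apply: eq_bigr => k _; rewrite /wweight walkE.
by rewrite /incr addrC subrK.
Qed.

Lemma walk_weight_itv n : 0 <= wk n <= 1.
Proof.
have r01 := refine_itv (n - m) g01.
apply/andP; split; first by apply: prodr_ge0 => k _; apply: cutw_ge0.
apply: prodr_ile1 => k _; rewrite /wweight; set x := chain_state _ _ _ _.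
set y := x + _; rewrite cutw_ge0//= /cutw.
have /andP[a b] := r01 k y.
rewrite -[leRHS]mulr1 ler_pM ?mulr_ge0 ?expR_ge0//; last by case: (_ && _).
rewrite -[leRHS]mulr1 ler_pM ?expR_ge0//.
rewrite -[leRHS]expR0 ler_expR oppr_le0 !mulr_ge0 ?expR_ge0 ?ltW//.
Qed.

(** On a fine mesh the cutoff is inactive along the path itself, and the damping exponents form a
    Riemann sum of 6 c A_t. *)
Lemma cvg_walk_weight : wk n @[n --> \oo] -->
  \prod_(j < 2 ^ m) g j (X (grid t m j.+1)) * expR (- (6 * (c * expA X t))).
Proof.
have e20 : 0 < 20^-1 :> R by rewrite invr_gt0.
have e : \forall n \near \oo,
    \prod_(j < 2 ^ m) g j (X (grid t m j.+1)) *
    expR (- (6 * (c * \sum_(j < 2 ^ n) mesh t n * expR (2 * X (grid t n j))))) =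
    wk n.
  near=> n; rewrite wkE /cutw !big_split/=.
  have mn : (m <= n)%N by near: n; exact: nbhs_infty_ge.
  have -> : \prod_(k < 2 ^ n) refine g (n - m) k (X (grid t n k.+1)) =
      \prod_(j < 2 ^ m) g j (X (grid t m j.+1)).
    have := prod_refine g m (n - m) (fun k => X (grid t n k)).
    rewrite (subnKC mn) => ->; apply: eq_bigr => j _; congr (g j (X _)).
    by have := grid_refine t m (n - m) j.+1; rewrite (subnKC mn).
  rewrite [X in _ = _ * X]big1 ?mulr1; last first.
    move=> k _; apply/eqP; rewrite pnatr_eq1 eqb1; apply/andP; split.
      move: (nat_of_ord k) (ltn_ord k).
      by near: n; exact: (path_increment_small t0 cX e20).
    have fm : fine_mesh t c X 20^-1 n by near: n; exact: near_fine_mesh.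
    by have [_ /(_ k (ltn_ord k)) ? _] := fm.
  rewrite -expR_sum; congr (_ * expR _).
  rewrite mulr_sumr mulr_sumr -sumrN; apply: eq_bigr => k _.
  by rewrite (mulrA c).
apply: cvg_trans (near_eq_cvg e) _.
apply: cvgM; first exact: cvg_cst.
have H : \sum_(j < 2 ^ n) mesh t n * expR (2 * X (grid t n j)) @[n --> \oo]
    --> expA X t.
  apply/cvgrPdist_le => r r0.
  apply: filterS (riemann_sum t0 cX r0) => n Hn; have := Hn (2 ^ n)%N (leqnn _).
  by rewrite (grid_last t) distrC.
have H' : - (6 * (c * \sum_(j < 2 ^ n) mesh t n * expR (2 * X (grid t n j))))
    @[n --> \oo] --> - (6 * (c * expA X t)).
  by apply: cvgN; apply: cvgM; [exact: cvg_cst|apply: cvgM => //; exact: cvg_cst].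
exact: (continuous_cvg _ (@continuous_expR R (- (6 * (c * expA X t)))) H').
Unshelve. all: by end_near. Qed.

End walk_limit.

Lemma cvg_integral_itv01 {R : realType} d (T : measurableType d)
    (P : probability T R) (f_ : nat -> T -> R) (f : T -> R) :
  (forall n, measurable_fun setT (f_ n)) -> measurable_fun setT f ->
  (forall n w, 0 <= f_ n w <= 1) ->
  {ae P, forall w, f_ n w @[n --> \oo] --> f w} ->
  (\int[P]_w (f_ n w)%:E @[n --> \oo] --> \int[P]_w (f w)%:E)%E.
Proof.
move=> mf_ mf f01 ff.
have [] := @dominated_convergence _ _ _ P setT measurableT
  (fun n w => (f_ n w)%:E) (fun w => (f w)%:E) (cst 1%E).
- by move=> n; exact/measurable_EFinP.
- exact/measurable_EFinP.
- by apply: filterS ff => w fw _; apply: cvg_EFin => //; exact: nearW.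
- exact: finite_measure_integrable_cst.
- apply: aeW => w n _ /=; rewrite lee_fin ger0_norm;
    by have /andP[] := f01 n w.
- by move=> _ _.
Qed.

(** Jacobian times the exponential of the drop in potential from its initial value c / 2. *)
Definition dilate_density {R : realType} (t c : R) (phi : Cspace t) : R :=
  let A := c * expA (extend phi) t in
  if A < 1 then (1 - A)^-1 * expR (- (c / 2 * (expR (2 * extend phi t) / (1 - A) - 1)))
  else 0.

Lemma measurable_dilate_density {R : realType} (t : R) d (T : measurableType d)
    (c : T -> R) (Z : T -> Cspace t) : 0 < t ->
  measurable_fun setT c -> measurable_fun setT (Z : T -> borel (Cspace t)) ->
  measurable_fun setT (fun w => dilate_density (c w) (Z w)).
Proof.
move=> t0 mc mZ; have tt : 0 <= t <= t by rewrite lexx ltW.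
have mA : measurable_fun setT (fun w => c w * expA (extend (Z w)) t).
  by apply: measurable_funM => //; exact: (measurableT_comp (expA_measurable tt) mZ).
apply: measurable_fun_ifT => //; first exact: measurable_fun_ltr.
have mV : measurable_fun setT (fun w => (1 - c w * expA (extend (Z w)) t)^-1).
  by apply: (measurableT_comp measurable_invr); exact: measurable_funB.
apply: measurable_funM => //; apply: measurableT_comp => //.
apply: measurableT_comp => //; apply: measurable_funM; first exact: measurable_funM.
apply: measurable_funB => //; apply: measurable_funM => //.
apply: measurableT_comp => //; apply: measurable_funM => //.
exact: (measurableT_comp (extend_measurable tt) mZ).
Qed.

Section brownian_density.
Context {R : realType} {d : measure_display} {T : measurableType d}.
Variables (P : probability T R) (B : continuous_process R T).
Hypothesis BM : brownian_motion P B.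
Variables (t c : R).
Hypotheses (t0 : 0 < t) (c0 : 0 < c).

Let Y w := process_path t B w.
Let path w := extend (Y w).

Lemma process_path_extend w s : 0 <= s <= t -> path w s = B s w.
Proof. by move=> st; rewrite /path (extend_in _ (mem_segment st)). Qed.

Let cpath w : {within `[0, t], continuous (path w)}.
Proof. exact: extend_continuous. Qed.

Lemma measurable_process_path :
  measurable_fun setT (Y : T -> borel (Cspace t)).
Proof.
apply: measurable_Cspace => // s st.
apply: (eq_measurable_fun (B s)) => [w _|]; first by rewrite -process_path_extend.
by apply: process_measurable; case/andP: st.
Qed.

Lemma ae_path0 (Q : T -> Prop) : (forall w, path w 0 = 0 -> Q w) ->
  {ae P, forall w, Q w}.
Proof.
case: BM => B0 _ _ H; apply: filterS B0 => w Bw; apply: H.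
by rewrite process_path_extend// lexx ltW.
Qed.

Lemma dilate_density_ge0 (phi : Cspace t) : 0 <= dilate_density c phi.
Proof.
rewrite /dilate_density; case: ifP => // A1.
by rewrite mulr_ge0 ?expR_ge0// invr_ge0 subr_ge0 ltW.
Qed.

Section product.
Variables (m : nat) (g : nat -> R -> R).
Hypothesis g01 : forall k x, 0 <= g k x <= 1.
Hypothesis cg : forall k, continuous (g k).

Let u n := cutw c (mesh t n) (refine g (n - m)).
Let W n w := chain_weight (tstep c (mesh t n)) (tweight c (mesh t n) (u n))
  (0, 0, 1) (incr t (path w) n) (2 ^ n) *
  expR (- tpotential c (chain_state (tstep c (mesh t n)) (0, 0, 1)
     (incr t (path w) n) (2 ^ n))).
Let W' n w := chain_weight (@walk R) (wweight (u n)) 0 (incr t (path w) n) (2 ^ n).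

Let mu_ n k : measurable_fun setT (fun z : R * R => u n k z.1 z.2).
Proof.
apply: measurable_cutw; apply: measurable_refine => j.
exact: continuous_measurable_fun.
Qed.

Let u0 n k x y : 0 <= u n k x y.
Proof. by apply: cutw_ge0; exact: refine_itv. Qed.

Let incrE n w i : (i < 2 ^ n)%N ->
  incr t (path w) n i = B (i.+1%:R * mesh t n) w - B (i%:R * mesh t n) w.
Proof.
by move=> iN; rewrite /incr !process_path_extend//; apply: grid_itv => //; exact: ltnW.
Qed.

(** [chain_int_transform] started from (0, 0, 1), whose potential is c / 2, read on the Brownian
    increments at both ends through [brownian_chain_int]. *)
Let level n : (\int[P]_w (W n w)%:E =
  (expR (- (c / 2)))%:E * \int[P]_w (W' n w)%:E)%E.
Proof.
have h0 := mesh_gt0 t0 n.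
have mv : measurable_fun setT (fun s : R * R * R => expR (- tpotential c s)).
  exact: (measurableT_comp (@measurable_expR R)
    (measurableT_comp (@oppr_measurable R setT) (@measurable_tpotential R c))).
have E1 := brownian_chain_int BM h0 (@measurable_tstep _ c (mesh t n))
  (@measurable_tweight _ c (mesh t n) (u n) (mu_ n))
  mv
  (tweight_ge0 c (mesh t n) (u0 n)) (fun s => expR_ge0 _) (0, 0, 1) (2 ^ n).
have E2 := brownian_chain_int BM h0 (@measurable_walk R)
  (@measurable_wweight _ (u n) (mu_ n)) (measurable_cst (1 : R)) (fun k s y => u0 n k s (s + y))
  (fun s => ler01) 0 (2 ^ n).
transitivity (chain_int (mesh t n) (tstep c (mesh t n)) (tweight c (mesh t n) (u n))
  (fun s => expR (- tpotential c s)) (2 ^ n) 0 (0, 0, 1)).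
  rewrite -E1; apply: eq_integral => w _; rewrite /W.
  by rewrite (eq_chain_state _ _ (@incrE n w)) (eq_chain_weight _ _ _ (@incrE n w)).
rewrite chain_int_transform//; congr (_ * _)%E.
  by rewrite /tpotential /= mulr0 expR0 !mulr1.
rewrite -E2; apply: eq_integral => w _; rewrite /W' mulr1.
by rewrite (eq_chain_weight _ _ _ (@incrE n w)).
Qed.

Let mincr n i : (i < 2 ^ n)%N -> measurable_fun setT (fun w => incr t (path w) n i).
Proof.
move=> iN; apply: (eq_measurable_fun
  (fun w => B (i.+1%:R * mesh t n) w - B (i%:R * mesh t n) w)).
  by move=> w _; rewrite incrE.
by apply: measurable_funB; apply: process_measurable;
  rewrite mulr_ge0// ltW// mesh_gt0.
Qed.

Let mW n : measurable_fun setT (W n).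
Proof.
have := measurable_chain (@measurable_tstep _ c (mesh t n))
  (@measurable_tweight _ c (mesh t n) (u n) (mu_ n)) (0, 0, 1) (@mincr n).
move=> H; apply: measurable_funM; first exact: (measurableT_comp measurable_fst H).
apply: measurableT_comp => //; apply: measurableT_comp => //.
apply: measurableT_comp (@measurable_tpotential R c) _.
exact: (measurableT_comp measurable_snd H).
Qed.

Let mW' n : measurable_fun setT (W' n).
Proof.
have := measurable_chain (@measurable_walk R)
  (@measurable_wweight _ (u n) (mu_ n)) 0 (@mincr n).
by move=> H; exact: (measurableT_comp measurable_fst H).
Qed.

Let limitE w : path_limit t c (path w) m g = expR (- (c / 2)) *
  (cylinder_prod m g (dilate (- c) (Y w)) *
   (expR (- (6 * (c * expA (extend (dilate (- c) (Y w))) t))) *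
    dilate_density c (Y w))).
Proof.
rewrite /path_limit /dilate_density -/(path w); set A := expA _ t.
case: ifP => [A1|]; last by rewrite !mulr0.
have c1 : 0 < 1 + - c * expA (extend (Y w)) t by rewrite mulNr subr_gt0.
rewrite dilate_expA// ?lexx ?(ltW t0)// -/(path w) -/A mulNr.
rewrite [RHS]mulrCA; congr (_ * _).
  apply: eq_bigr => j _; rewrite dilate_extend ?mulNr ?subr_gt0//.
  by apply: (grid_itv t0).
rewrite [RHS]mulrCA; congr (expR (- (6 * _)) * _); first by rewrite mulrA.
rewrite [RHS]mulrCA; congr (_ * _); rewrite -expRD; congr expR.
by rewrite mulrBr mulr1; lra.
Qed.

(** The mesh tends to 0 in [level]; both integrands lie in [0, 1] and converge almost surely, on the
    event that the path starts from 0. *)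
Lemma brownian_dilate_product :
  (\int[P]_w (cylinder_prod m g (Y w) * expR (- (6 * (c * expA (path w) t))))%:E =
   \int[P]_w (cylinder_prod m g (dilate (- c) (Y w)) *
     (expR (- (6 * (c * expA (extend (dilate (- c) (Y w))) t))) *
       dilate_density c (Y w)))%:E)%E.
Proof.
have mY := measurable_process_path.
have tt : 0 <= t <= t by rewrite lexx ltW.
have md : measurable_fun setT ((fun w => dilate (- c) (Y w)) : T -> borel (Cspace t)).
  by apply: measurable_dilate => //; exact: measurable_cst.
have mA (Z : T -> Cspace t) : measurable_fun setT (Z : T -> borel (Cspace t)) ->
    measurable_fun setT (fun w => expR (- (6 * (c * expA (extend (Z w)) t)))).
  move=> mZ; apply: measurableT_comp => //; apply: measurableT_comp => //.
  apply: measurable_funM => //; apply: measurable_funM => //.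
  exact: (measurableT_comp (expA_measurable tt) mZ).
have mcyl : measurable_fun setT (cylinder_prod m g : borel (Cspace t) -> R).
  by apply: cylinder_prod_measurable => // k; exact: continuous_measurable_fun.
pose L1 w := cylinder_prod m g (Y w) * expR (- (6 * (c * expA (path w) t))).
pose L2 w := cylinder_prod m g (dilate (- c) (Y w)) *
     (expR (- (6 * (c * expA (extend (dilate (- c) (Y w))) t))) *
       dilate_density c (Y w)).
have mL1 : measurable_fun setT L1.
  by apply: measurable_funM; [exact: (measurableT_comp mcyl mY)|exact: mA].
have mL2 : measurable_fun setT L2.
  apply: measurable_funM; first exact: (measurableT_comp mcyl md).
  apply: measurable_funM; first exact: mA.
  by apply: measurable_dilate_density => //; exact: measurable_cst.
have C1 : (\int[P]_w (W' n w)%:E @[n --> \oo] --> \int[P]_w (L1 w)%:E)%E.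
  apply: cvg_integral_itv01 => //.
    by move=> n w; exact: walk_weight_itv.
  by apply: ae_path0 => w X0; exact: cvg_walk_weight.
have C2 : (\int[P]_w (W n w)%:E @[n --> \oo] -->
    \int[P]_w (expR (- (c / 2)) * L2 w)%:E)%E.
  apply: (cvg_integral_itv01 mW) => //; first by apply: measurable_funM.
    by move=> n w; exact: path_weight_itv.
  apply: ae_path0 => w X0; rewrite -limitE; exact: cvg_path_weight.
have C3 : ((expR (- (c / 2)))%:E * \int[P]_w (W' n w)%:E @[n --> \oo] -->
    (expR (- (c / 2)))%:E * \int[P]_w (L1 w)%:E)%E by apply: cvgeZl.
have {}C2 : ((expR (- (c / 2)))%:E * \int[P]_w (W' n w)%:E @[n --> \oo] -->
    \int[P]_w (expR (- (c / 2)) * L2 w)%:E)%E.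
  by under eq_fun do rewrite -level.
have L20 w : 0 <= L2 w.
  have /andP[? _] := cylinder_prod_itv m (dilate (- c) (Y w)) g01.
  by rewrite !mulr_ge0 ?expR_ge0 ?dilate_density_ge0.
have C4 := cvg_unique _ C2 C3.
have E : ((expR (- (c / 2)))%:E * \int[P]_w (L1 w)%:E =
    (expR (- (c / 2)))%:E * \int[P]_w (L2 w)%:E)%E.
  transitivity (\int[P]_w (expR (- (c / 2)) * L2 w)%:E)%E; first by rewrite C4.
  under eq_integral do rewrite EFinM.
  rewrite ge0_integralZl_EFin ?expR_ge0//; last exact/measurable_EFinP.
  by move=> w _; rewrite lee_fin.
(* Multiplying by the inverse constant cancels the common factor without any division in the
   extended reals. *)
have : ((expR (c / 2))%:E * ((expR (- (c / 2)))%:E * \int[P]_w (L1 w)%:E) =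
  (expR (c / 2))%:E * ((expR (- (c / 2)))%:E * \int[P]_w (L2 w)%:E))%E by rewrite E.
by rewrite !muleA -EFinM expRxMexpNx_1 !mul1e.
Qed.

End product.

(** The damping e^{-6 c A_t} appears on both sides, evaluated at the path where [F] is evaluated, so
    testing with F e^{6 c A_t} removes it. *)
Lemma brownian_dilate (F : borel (Cspace t) -> \bar R) :
  measurable_fun setT F -> (forall phi, 0 <= F phi)%E ->
  (\int[P]_w F (Y w) =
   \int[P]_w (F (dilate (- c) (Y w)) * (dilate_density c (Y w))%:E))%E.
Proof.
move=> mF F0; have mY := measurable_process_path.
have tt : 0 <= t <= t by rewrite lexx ltW.
have md : measurable_fun setT ((fun w => dilate (- c) (Y w)) : T -> borel (Cspace t)).
  by apply: measurable_dilate => //; exact: measurable_cst.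
pose e (phi : borel (Cspace t)) := 6 * (c * expA (extend phi) t).
have me : measurable_fun setT (e : borel (Cspace t) -> R).
  apply: measurable_funM => //; apply: measurable_funM => //.
  exact: expA_measurable.
have meN : measurable_fun setT ((fun phi => expR (- e phi)) : borel (Cspace t) -> R).
  by apply: measurableT_comp => //; exact: measurableT_comp.
pose w1 w := expR (- e (Y w)).
pose w2 w := expR (- e (dilate (- c) (Y w))) * dilate_density c (Y w).
have H := @Cspace_weighted_law_unique _ _ t0 _ _ P Y (fun w => dilate (- c) (Y w))
  w1 w2 mY md _ _ _ _ _ brownian_dilate_product
  (fun phi => F phi * (expR (e phi))%:E)%E.
transitivity (\int[P]_w (F (Y w) * (expR (e (Y w)))%:E * (w1 w)%:E))%E.
  apply: eq_integral => w _.
  by rewrite -muleA -EFinM expRxMexpNx_1 mule1.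
rewrite H.
- apply: eq_integral => w _.
  by rewrite -muleA -EFinM mulrA expRxMexpNx_1 mul1r.
- exact: (measurableT_comp meN mY).
- apply: measurable_funM; first exact: (measurableT_comp meN md).
  by apply: measurable_dilate_density => //; exact: measurable_cst.
- by move=> w; exact: expR_ge0.
- by move=> w; rewrite mulr_ge0 ?expR_ge0 ?dilate_density_ge0.
- apply: (@le_lt_trans _ _ (\int[P]_w 1)%E).
    apply: ge0_le_integral => //.
    + by move=> w _; rewrite lee_fin expR_ge0.
    + by apply/measurable_EFinP; exact: (measurableT_comp meN mY).
    + move=> w _; rewrite lee_fin -[leRHS]expR0 ler_expR oppr_le0.
      by rewrite /e mulr_ge0// mulr_ge0 ?expA_ge0// ltW.
  by rewrite integral_cst//= mul1e probability_setT ltry.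
- apply: emeasurable_funM => //; apply/measurable_EFinP.
  exact: measurableT_comp.
- by move=> phi; rewrite mule_ge0// lee_fin expR_ge0.
Qed.

End brownian_density.

(** * The independent Brownian motion at the random time A_t *)

Section countable_index.
Context {R : realType} {d : measure_display} {T : measurableType d}.
Variable N : T -> nat.
Hypothesis mN : forall k, measurable (N @^-1` [set k]).

Let bigcupN : \bigcup_k (N @^-1` [set k]) = setT.
Proof. by apply/seteqP; split => // w _; exists (N w). Qed.

Lemma measurable_index d' (U : measurableType d') (f : nat -> T -> U) :
  (forall k, measurable_fun setT (f k)) ->
  measurable_fun setT (fun w => f (N w) w).
Proof.
move=> mf _ V mV; rewrite setTI.
rewrite (_ : _ @^-1` V = \bigcup_k (N @^-1` [set k] `&` f k @^-1` V)).
  apply: bigcupT_measurable => k; apply: measurableI => //.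
  by rewrite -[X in measurable X]setTI; exact: mf.
apply/seteqP; split => [w fw|w [k _ [/= <-]]//].
by exists (N w).
Qed.

Lemma eq_integral_index (mu : {measure set T -> \bar R}) (f g : nat -> T -> \bar R) :
  (forall k, measurable_fun setT (f k)) -> (forall k, measurable_fun setT (g k)) ->
  (forall k w, 0 <= f k w)%E -> (forall k w, 0 <= g k w)%E ->
  (forall k, \int[mu]_(w in N @^-1` [set k]) f k w =
             \int[mu]_(w in N @^-1` [set k]) g k w)%E ->
  (\int[mu]_w f (N w) w = \int[mu]_w g (N w) w)%E.
Proof.
move=> mf mg f0 g0 fg.
have tN : trivIset setT (fun k => N @^-1` [set k]).
  by apply/trivIsetP => i j _ _ ij; rewrite -preimage_setI set1I
    ifF ?preimage_set0//; apply/negP => /set_mem/= ji; rewrite ji eqxx in ij.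
rewrite -bigcupN !ge0_integral_bigcup//.
- apply: eq_eseriesr => k _; transitivity (\int[mu]_(w in N @^-1` [set k]) f k w)%E.
    by apply: eq_integral => w /set_mem/= ->.
  by rewrite fg; apply: eq_integral => w /set_mem/= ->.
- by rewrite bigcupN; exact: measurable_index.
- by rewrite bigcupN; exact: measurable_index.
Qed.

End countable_index.

Section upper_approximation.
Context {R : realType}.

(** With [upper_node], this rounds a time up to a multiple of 1 / (m + 1). Countably many values
    allow conditioning by summation, and the rounded times are positive, as the law of an increment
    requires. *)
Definition upper_index (m : nat) (a : R) : nat := Num.truncn (m.+1%:R * a).

Definition upper_node (m k : nat) : R := k.+1%:R / m.+1%:R.

Lemma upper_node_gt0 m k : 0 < upper_node m k.
Proof. by rewrite divr_gt0. Qed.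

Lemma cvg_upper_node (a : R) : 0 <= a ->
  upper_node m (upper_index m a) @[m --> \oo] --> a.
Proof.
move=> a0; apply: (@squeeze_cvgr _ _ _ _ (fun=> a) (fun m : nat => a + m.+1%:R^-1)).
- apply: nearW => m; rewrite /upper_node /upper_index.
  have /truncn_itv/andP[] : 0 <= m.+1%:R * a by rewrite mulr_ge0.
  set k := Num.truncn _ => k1 k2; rewrite ler_pdivlMr// mulrC (ltW k2)/=.
  rewrite ler_pdivrMr// mulrDl mulVf// -natr1 lerD2r mulrC//.
- exact: cvg_cst.
- rewrite -[X in _ --> X]addr0; apply: cvgD; first exact: cvg_cst.
  exact: cvg_harmonic.
Qed.

Lemma measurable_upper_index d (T : measurableType d) (a : T -> R) m k :
  measurable_fun setT a -> (forall w, 0 <= a w) ->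
  measurable ((fun w => upper_index m (a w)) @^-1` [set k]).
Proof.
move=> ma a0.
rewrite (_ : _ @^-1` _ = (fun w => m.+1%:R * a w) @^-1` `[k%:R, k.+1%:R[%classic).
  rewrite -[X in measurable X]setTI; apply: measurable_funM => //.
apply/seteqP; split => w /=; rewrite in_itv/=.
  by move=> <-; apply: truncn_itv; rewrite mulr_ge0.
by move=> /truncn_def.
Qed.

End upper_approximation.

Lemma ge0_integral_normal_scale {R : realType} (s : R) (f : R -> \bar R) :
  0 < s -> measurable_fun setT f -> (forall x, 0 <= f x)%E ->
  (\int[normal_prob 0 s]_x f x = \int[normal_prob 0 1]_x f (s * x)%R)%E.
Proof.
move=> s0 mf f0.
have ms : measurable_fun setT (fun x : R => s * x) by exact: measurable_funM.
have mfs : measurable_fun setT (fun x : R => f (s * x)) by exact: measurableT_comp mf ms.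
rewrite (ge0_integral_normal_prob 0 s mf f0).
rewrite (ge0_integral_normal_prob 0 1 mfs (fun x => f0 (s * x))).
have ds (x : R) : is_derive x 1 (fun x : R => s * x) s.
  have := is_deriveZ s (is_derive_id x 1).
  by rewrite scaler1; apply.
rewrite (@ge0_substitution_increasing R setT (fun x => s * x) (fun=> s)
  (fun y => y / s) _ measurableT _ _ (fun x _ => ds x))//.
- apply: eq_integral => x _; rewrite -muleA -EFinM; congr (_ * _%:E)%E.
  rewrite !normal_pdfE ?gt_eqF// /normal_peak /normal_fun !subr0.
  rewrite exprMn expr1n mul1r -mulrnAr sqrtrM ?sqr_ge0// sqrtr_sqr gtr0_norm//.
  rewrite (_ : - (s ^+ 2 * x ^+ 2) / _ = - x ^+ 2 / (1 *+ 2)); last first.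
    by field; rewrite gt_eqF.
  by field; rewrite ?gt_eqF// sqrtr_gt0 mulrn_wgt0// pi_gt0.
- by move=> x y _ _ xy; rewrite ltr_pM2l.
- by move=> x; apply: cvg_cst.
- by move=> x _; rewrite ltW.
- by move=> y; rewrite mulrC divfK// gt_eqF.
- apply: emeasurable_funM => //; apply/measurable_EFinP; exact: measurable_normal_pdf.
- by move=> x; rewrite mule_ge0// lee_fin normal_pdf_ge0.
Qed.

Lemma cvg_integral_eitv01 {R : realType} d (T : measurableType d)
    (P : probability T R) (f_ : nat -> T -> \bar R) (f : T -> \bar R) :
  (forall n, measurable_fun setT (f_ n)) -> measurable_fun setT f ->
  (forall n w, 0 <= f_ n w <= 1)%E ->
  (forall w, f_ n w @[n --> \oo] --> f w) ->
  (\int[P]_w f_ n w @[n --> \oo] --> \int[P]_w f w)%E.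
Proof.
move=> mf_ mf f01 ff.
have [] := @dominated_convergence _ _ _ P setT measurableT f_ f (cst 1%E) mf_ mf.
- by apply: aeW => w _; exact: ff.
- exact: finite_measure_integrable_cst.
- by apply: aeW => w n _ /=; have /andP[f0 f1] := f01 n w; rewrite gee0_abs.
- by move=> _ _.
Qed.

Lemma cvg_process {R : realType} d (T : measurableType d)
    (X : continuous_process R T) (w : T) (u : nat -> R) (a : R) :
  (forall n, 0 <= u n) -> u n @[n --> \oo] --> a -> 0 <= a ->
  X (u n) w @[n --> \oo] --> X a w.
Proof.
move=> u0 ua a0; have /subspace_continuousP/(_ a) H := @process_continuous _ _ _ X w.
apply: (cvg_comp u (fun s => X s w) _ (H _)); last by rewrite /= in_itv/= a0.
move=> V /= VA; have : \forall n \near \oo, `[0, +oo[%classic (u n) -> V (u n).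
  exact: ua _ VA.
by apply: filterS => n; apply; rewrite /= in_itv/= u0.
Qed.

Section random_time.
Context {R : realType} {d : measure_display} {T : measurableType d}.
Variables (P : probability T R) (B beta : continuous_process R T) (t : R).
Hypothesis t0 : 0 < t.
Hypothesis BMbeta : brownian_motion P beta.
Hypothesis indep : independent_processes P B beta.

Let Y w := process_path t B w.
Let A (phi : Cspace t) := expA (extend phi) t.

Let mY : measurable_fun setT (Y : T -> borel (Cspace t)).
Proof. exact: measurable_process_path. Qed.

Let mA : measurable_fun setT (A : borel (Cspace t) -> R).
Proof. by apply: expA_measurable; rewrite lexx ltW. Qed.

Let generated (X : R -> T -> R) := g_sigma_algebraType
  (\bigcup_(q in `[0, +oo[) g_sigma_algebra_preimage (X q) : set (set T)).

Let generated_measurable (X : R -> T -> R) s : 0 <= s ->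
  measurable_fun setT (X s : generated X -> R).
Proof.
move=> s0 _ V mV; apply: sub_sigma_algebra; exists s; last by exists V.
by rewrite /= in_itv/= s0.
Qed.

Lemma independent_path_increment (s : R) : 0 < s ->
  forall (U : set (borel (Cspace t))) (V : set R), measurable U -> measurable V ->
  P (Y @^-1` U `&` increment beta 0 s @^-1` V) =
  (P (Y @^-1` U) * P (increment beta 0 s @^-1` V))%E.
Proof.
move=> s0 U V mU mV; apply: indep.
  have mYB : measurable_fun setT (Y : generated B -> borel (Cspace t)).
    apply: measurable_Cspace => // r rt.
    apply: (eq_measurable_fun (B r : generated B -> R)) => [w _|].
      by rewrite -(process_path_extend B w rt).
    by apply: generated_measurable; case/andP: rt.
  by have := mYB measurableT U mU; rewrite setTI.
have mI : measurable_fun setT (increment beta 0 s : generated beta -> R).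
  by apply: measurable_funB; apply: generated_measurable => //; exact: ltW.
by have := mI measurableT V mV; rewrite setTI.
Qed.

Lemma integral_fixed_time (s : R) (G : borel (Cspace t) * R -> \bar R) :
  0 < s -> measurable_fun setT G -> (forall z, 0 <= G z)%E ->
  (\int[P]_w G (Y w, beta s w) =
   \int[P]_w \int[normal_prob 0 1]_xi G (Y w, Num.sqrt s * xi)%R)%E.
Proof.
move=> s0 mG G0.
have mI : measurable_fun setT (increment beta 0 s).
  by apply: measurable_funB; apply: process_measurable => //; exact: ltW.
have mbeta := process_measurable beta (ltW s0).
(* The value of [beta] is replaced by its increment from time 0, almost surely equal, since
   independence and the Gaussian law are available for increments. *)
transitivity (\int[P]_w G (Y w, increment beta 0 s w))%E.
  apply: ge0_ae_eq_integral => //.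
  - by apply: measurableT_comp mG _; exact: measurable_fun_pair.
  - by apply: measurableT_comp mG _; exact: measurable_fun_pair.
  - case: BMbeta => beta0 _ _; apply: filterS beta0 => w bw _ /=.
    by rewrite /increment bw subr0.
rewrite (@ge0_integral_independent _ _ _ P _ _ _ _ (Y : T -> borel (Cspace t))
  (increment beta 0 s : T -> measurableTypeR R) G)//; last first.
  exact: independent_path_increment.
apply: eq_integral => w _.
have mGw : measurable_fun setT (fun y => G (Y w, y)).
  exact: measurableT_comp mG (pair1_measurable _).
have s0' : 0 <= (0 : R) < s by rewrite lexx.
have := brownian_increment_law BMbeta s0' mGw (fun y => G0 _).
rewrite subr0 => ->; rewrite ge0_integral_normal_scale// sqrtr_gt0//.
Qed.

Lemma measurable_random_time : measurable_fun setT (fun w => beta (A (Y w)) w).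
Proof.
apply: (@measurable_fun_cvg _ _ _ _
  (fun m w => beta (upper_node m (upper_index m (A (Y w)))) w)).
- move=> m; apply: (measurable_index (N := fun w => upper_index m (A (Y w)))
    _ (f := fun k w => beta (upper_node m k) w)).
    by move=> k; apply: measurable_upper_index => [|w]; [
      exact: (measurableT_comp mA mY)|exact: expA_ge0].
  by move=> k; apply: process_measurable; exact/ltW/upper_node_gt0.
- move=> w _; apply: cvg_process.
  + by move=> m; exact/ltW/upper_node_gt0.
  + exact/cvg_upper_node/expA_ge0.
  + exact: expA_ge0.
Qed.

Section bounded_functional.
Variable H : borel (Cspace t) * R -> R.
Hypothesis mH : measurable_fun setT H.
Hypothesis H01 : forall z, 0 <= H z <= 1.
Hypothesis cH : forall phi, continuous (fun y => H (phi, y)).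

Let H0 z : (0 <= (H z)%:E)%E.
Proof. by rewrite lee_fin; case/andP: (H01 z). Qed.

Let H1 z : ((H z)%:E <= 1)%E.
Proof. by rewrite lee_fin; case/andP: (H01 z). Qed.

Let N m w := upper_index m (A (Y w)).

Let mN m k : measurable (N m @^-1` [set k]).
Proof.
by apply: measurable_upper_index => [|w]; [
  exact: (measurableT_comp mA mY)|exact: expA_ge0].
Qed.

Let gauss (a : R) phi := (\int[normal_prob 0 1]_xi (H (phi, Num.sqrt a * xi))%:E)%E.

Let mHs (a : R) : measurable_fun setT
  (fun z : borel (Cspace t) * R => (H (z.1, Num.sqrt a * z.2))%:E).
Proof.
apply/measurable_EFinP; apply: (measurableT_comp mH).
apply: measurable_fun_pair; first exact: measurable_fst.
by apply: measurable_funM => //; exact: measurable_snd.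
Qed.

Let mHy phi (a : R) : measurable_fun setT (fun xi => H (phi, Num.sqrt a * xi)).
Proof.
have := measurableT_comp (mHs a) (pair1_measurable (phi : borel (Cspace t))).
by move/measurable_EFinP.
Qed.

Let mgauss (a : R) : measurable_fun setT (gauss a : borel (Cspace t) -> \bar R).
Proof.
apply: (@measurable_fun_fubini_tonelli_F _ _ _ _ _ (normal_prob 0 1)
  (fun z : borel (Cspace t) * R => (H (z.1, Num.sqrt a * z.2))%:E)) => //.
exact: mHs.
Qed.

Let gauss01 a phi : (0 <= gauss a phi <= 1)%E.
Proof.
apply/andP; split; first by apply: integral_ge0 => xi _.
apply: (@le_trans _ _ (\int[normal_prob 0 1]_xi 1)%E).
  by apply: ge0_le_integral => //; apply/measurable_EFinP; exact: mHy.
by rewrite integral_cst//= mul1e probability_setT.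
Qed.

Let level m : (\int[P]_w (H (Y w, beta (upper_node m (N m w)) w))%:E =
  \int[P]_w gauss (upper_node m (N m w)) (Y w))%E.
Proof.
apply: (eq_integral_index (@mN m)
  (f := fun k w => (H (Y w, beta (upper_node m k) w))%:E)
  (g := fun k w => gauss (upper_node m k) (Y w))) => //.
- move=> k; apply/measurable_EFinP; apply: (measurableT_comp mH).
  apply: measurable_fun_pair => //; apply: process_measurable.
  exact/ltW/upper_node_gt0.
- by move=> k; exact: (measurableT_comp (mgauss _) mY).
- by move=> k w; have /andP[] := gauss01 (upper_node m k) (Y w).
move=> k; pose D : set (borel (Cspace t)) := [set phi | upper_index m (A phi) = k].
have mD : measurable D by apply: (measurable_upper_index m k mA) => phi; exact: expA_ge0.
pose G (z : borel (Cspace t) * R) := ((H z)%:E * (\1_D z.1)%:E)%E.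
have mG : measurable_fun setT G.
  apply: emeasurable_funM; first exact/measurable_EFinP.
  have m1 : measurable_fun setT (\1_D : borel (Cspace t) -> R) by exact: measurable_indic.
  by apply/measurable_EFinP; apply: (measurableT_comp m1 measurable_fst).
have G0 z : (0 <= G z)%E by rewrite mule_ge0.
have DE (f : T -> \bar R) : (\int[P]_(w in N m @^-1` [set k]) f w =
    \int[P]_w (f w * (\1_D (Y w))%:E))%E.
  rewrite integral_mkcond; apply: eq_integral => w _.
  rewrite patchE indicE; case: ifPn => [/set_mem Nw|Nw].
    by rewrite mem_set ?mule1.
  by rewrite memNset ?mule0// => Dw; move: Nw; rewrite mem_set.
rewrite !DE; have := integral_fixed_time (upper_node_gt0 m k) mG G0.
rewrite /G /= => ->; apply: eq_integral => w _.
rewrite ge0_integralZr//.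
by apply/measurable_EFinP; exact: mHy.
Qed.

(** At the rounded times the identity is a sum of fixed-time identities over the values of the index
    ([level]). Letting the rounding vanish uses continuity of [beta] and of [H] in its last
    variable, with bounded convergence on both sides. *)
Lemma integral_random_time :
  (\int[P]_w (H (Y w, beta (A (Y w)) w))%:E =
   \int[P]_w \int[normal_prob 0 1]_xi (H (Y w, Num.sqrt (A (Y w)) * xi))%:E)%E.
Proof.
have cvgN w : upper_node m (N m w) @[m --> \oo] --> A (Y w).
  exact/cvg_upper_node/expA_ge0.
have cvgS w xi : Num.sqrt (upper_node m (N m w)) * xi @[m --> \oo] -->
    Num.sqrt (A (Y w)) * xi.
  apply: cvgM; last exact: cvg_cst.
  exact: (continuous_cvg _ (@sqrt_continuous R (A (Y w))) (cvgN w)).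
have C1 : (\int[P]_w (H (Y w, beta (upper_node m (N m w)) w))%:E @[m --> \oo] -->
    \int[P]_w (H (Y w, beta (A (Y w)) w))%:E)%E.
  apply: cvg_integral_eitv01.
  - move=> m; apply/measurable_EFinP; apply: (measurableT_comp mH).
    apply: measurable_fun_pair => //.
    apply: (measurable_index (@mN m) (f := fun k w => beta (upper_node m k) w)).
    by move=> k; apply: process_measurable; exact/ltW/upper_node_gt0.
  - apply/measurable_EFinP; apply: (measurableT_comp mH).
    by apply: measurable_fun_pair => //; exact: measurable_random_time.
  - by move=> n w; rewrite H0 H1.
  - move=> w; apply: cvg_EFin; first exact: nearW.
    have cb : beta (upper_node m (N m w)) w @[m --> \oo] --> beta (A (Y w)) w.
      by apply: cvg_process => [m|//|]; [exact/ltW/upper_node_gt0|exact: expA_ge0].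
    exact: (continuous_cvg _ (@cH (Y w) (beta (A (Y w)) w)) cb).
have mlim : measurable_fun setT (fun w => gauss (A (Y w)) (Y w)).
  apply: (emeasurable_fun_cvg (fun m w => gauss (upper_node m (N m w)) (Y w))).
    move=> m; apply: (measurable_index (@mN m)
      (f := fun k w => gauss (upper_node m k) (Y w))).
    by move=> k; exact: (measurableT_comp (mgauss _) mY).
  move=> w _; apply: cvg_integral_eitv01.
  - by move=> m; apply/measurable_EFinP; exact: mHy.
  - by apply/measurable_EFinP; exact: mHy.
  - by move=> n xi; rewrite H0 H1.
  - move=> xi; apply: cvg_EFin; first exact: nearW.
    exact: (continuous_cvg _ (@cH (Y w) (Num.sqrt (A (Y w)) * xi)) (cvgS w xi)).
have C2 : (\int[P]_w gauss (upper_node m (N m w)) (Y w) @[m --> \oo] -->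
    \int[P]_w gauss (A (Y w)) (Y w))%E.
  apply: cvg_integral_eitv01 => //.
  - move=> m; apply: (measurable_index (@mN m)
      (f := fun k w => gauss (upper_node m k) (Y w))).
    by move=> k; exact: (measurableT_comp (mgauss _) mY).
  - move=> w; apply: cvg_integral_eitv01.
    + by move=> m; apply/measurable_EFinP; exact: mHy.
    + by apply/measurable_EFinP; exact: mHy.
    + by move=> n xi; rewrite H0 H1.
    + move=> xi; apply: cvg_EFin; first exact: nearW.
      exact: (continuous_cvg _ (@cH (Y w) (Num.sqrt (A (Y w)) * xi)) (cvgS w xi)).
have {}C1 : (\int[P]_w gauss (upper_node m (N m w)) (Y w) @[m --> \oo] -->
    \int[P]_w (H (Y w, beta (A (Y w)) w))%:E)%E.
  by under eq_fun do rewrite -level.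
exact: (cvg_unique _ C1 C2).
Qed.

End bounded_functional.

End random_time.

(** * From the Gaussian variable to the dilation parameter *)

Section hyperbolic.
Context {R : realType}.

Definition cosh (x : R) : R := (expR x + expR (- x)) / 2.

Lemma cosh_gt0 (x : R) : 0 < cosh x.
Proof. by rewrite divr_gt0// addr_gt0// expR_gt0. Qed.

Lemma Argsh_arg_gt0 (x : R) : 0 < x + Num.sqrt (1 + x ^+ 2).
Proof.
have h : `|x| < Num.sqrt (1 + x ^+ 2).
  by rewrite -sqrtr_sqr ltr_sqrt ?ltrDr// ltr_pwDl// sqr_ge0.
by have := ler_norm (- x); rewrite normrN => h'; lra.
Qed.

Lemma ArgshK (x : R) : sinh (Argsh x) = x.
Proof.
have p := Argsh_arg_gt0 x.
rewrite /sinh expRN /Argsh lnK ?posrE//.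
have e : (x + Num.sqrt (1 + x ^+ 2))^-1 = Num.sqrt (1 + x ^+ 2) - x.
  apply: (mulIf (lt0r_neq0 p)); rewrite mulVf ?gt_eqF//.
  have := @sqr_sqrtr R (1 + x ^+ 2); rewrite addr_ge0 ?sqr_ge0// => /(_ isT).
  by rewrite expr2 => E; rewrite mulrDr !mulrBl E; ring.
by rewrite e; lra.
Qed.

Lemma measurable_Argsh : measurable_fun setT (@Argsh R).
Proof.
apply: measurableT_comp => //; apply: measurable_funD => //.
apply: measurableT_comp.
  by apply: continuous_measurable_fun; exact: sqrt_continuous.
by apply: measurable_funD => //; exact: measurable_funX.
Qed.

End hyperbolic.

Section gaussian_transform.
Context {R : realType}.
Variables (x b A : R).
Hypothesis A0 : 0 < A.
Local Notation mu := (@lebesgue_measure R).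

(* With [y = e^b sinh x + sqrt A * xi], the equation
   [sinh (x + b - ln (1 + c * A)) = y] amounts to [tau c = - xi]. *)
Definition tau (c : R) : R :=
  (expR b * sinh x - (expR (x + b) / (1 + c * A) - (1 + c * A) / expR (x + b)) / 2) /
  Num.sqrt A.

Definition tau' (c : R) : R :=
  Num.sqrt A / 2 * (expR (x + b) / (1 + c * A) ^+ 2 + (expR (x + b))^-1).

(** This is c = (e^z - 1) / A for the subscript z of the theorem, with the value of [beta] replaced
    by - sqrt A * y. *)
Definition tau_inv (y : R) : R :=
  (expR (x + b - Argsh (expR b * sinh x - Num.sqrt A * y)) - 1) / A.

Let D : set R := [set c | 0 < 1 + c * A].

Let sA0 : 0 < Num.sqrt A. Proof. by rewrite sqrtr_gt0. Qed.

Let sAA : Num.sqrt A * Num.sqrt A = A.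
Proof. by rewrite -expr2 sqr_sqrtr// ltW. Qed.

Lemma is_derive_tau c : 0 < 1 + c * A -> is_derive c 1 tau (tau' c).
Proof.
move=> c1; have e0 := expR_gt0 (x + b).
have d1 : is_derive c 1 (fun c => 1 + c * A) A.
  by apply: is_derive_eq; rewrite /GRing.scale/=; ring.
have d2 : is_derive c 1 (fun c => (1 + c * A)^-1) (- (1 + c * A) ^- 2 *: A).
  by apply: is_deriveV; rewrite gt_eqF.
rewrite /tau; apply: is_derive_eq; rewrite /tau' /GRing.scale/=.
move: sA0 sAA; set q := Num.sqrt A => q0 qA.
rewrite !mulr0 !add0r !mul1r.
have c1' : 1 + c * (q * q) != 0 by rewrite qA gt_eqF.
rewrite -qA; field; rewrite c1' !gt_eqF//.
Qed.

Lemma tau'_gt0 c : 0 < tau' c.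
Proof.
have e0 := expR_gt0 (x + b).
rewrite mulr_gt0 ?divr_gt0// ltr_wpDl ?invr_gt0// divr_ge0 ?sqr_ge0// ltW//.
Qed.

Lemma tau_increasing : {in D &, {homo tau : c c' / c < c'}}.
Proof.
move=> c c' /set_mem Dc /set_mem Dc' cc'.
have e0 := expR_gt0 (x + b); rewrite /D/= in Dc Dc'.
rewrite ltr_pM2r ?invr_gt0// ltrD2l ltrN2 ltr_pM2r ?invr_gt0//.
rewrite ltrB// ?ltr_pM2r ?invr_gt0// ?ltr_pM2l ?ltf_pV2 ?posrE// ltrD2l ltr_pM2r//.
Qed.

Lemma tau_inv_in y : D (tau_inv y).
Proof. by rewrite /D /tau_inv /= divfK ?gt_eqF// addrC subrK expR_gt0. Qed.

Lemma tau_invK y : tau (tau_inv y) = y.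
Proof.
rewrite /tau; have -> : 1 + tau_inv y * A =
    expR (x + b - Argsh (expR b * sinh x - Num.sqrt A * y)).
  by rewrite /tau_inv divfK ?gt_eqF// addrC subrK.
set a := Argsh _.
have -> : (expR (x + b) / expR (x + b - a) - expR (x + b - a) / expR (x + b)) / 2 = sinh a.
  rewrite -!expRN -!expRD /sinh; congr ((expR _ - expR _) / 2); ring.
by rewrite ArgshK; field; rewrite gt_eqF.
Qed.

Lemma tauK c : 0 < 1 + c * A -> tau_inv (tau c) = c.
Proof.
move=> Dc; have e := tau_invK (tau c); have D' := tau_inv_in (tau c).
have [h|h|//] := ltgtP (tau_inv (tau c)) c.
  by have := tau_increasing (mem_set D') (mem_set Dc) h; rewrite e ltxx.
by have := tau_increasing (mem_set Dc) (mem_set D') h; rewrite e ltxx.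
Qed.

Let mlin : measurable_fun setT (fun c : R => 1 + c * A).
Proof. by apply: measurable_funD => //; exact: measurable_funM. Qed.

Lemma measurable_tau : measurable_fun setT tau.
Proof.
apply: measurable_funM => //; apply: measurable_funB => //.
apply: measurable_funM => //; apply: measurable_funB; apply: measurable_funM => //.
exact: (measurableT_comp measurable_invr mlin).
Qed.

Lemma measurable_tau' : measurable_fun setT tau'.
Proof.
apply: measurable_funM => //; apply: measurable_funD => //.
apply: measurable_funM => //; apply: (measurableT_comp measurable_invr).
exact: measurable_funX.
Qed.

Lemma measurable_tau_inv : measurable_fun setT tau_inv.
Proof.
apply: measurable_funM => //; apply: measurable_funB => //.
apply: measurableT_comp => //; apply: measurable_funB => //.
by apply: (measurableT_comp measurable_Argsh); apply: measurable_funB.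
Qed.

Lemma normal_pdfN (y : R) : normal_pdf 0 1 (- y) = normal_pdf 0 1 y.
Proof. by rewrite !normal_pdfE ?oner_neq0// /normal_fun !subr0 sqrrN. Qed.

Lemma ge0_integral_tau (f : R -> \bar R) : measurable_fun setT f ->
  (forall c, 0 <= f c)%E ->
  (\int[normal_prob 0 1]_xi f (tau_inv (- xi)) =
   \int[mu]_(c in [set c | (0 < 1 + c * A)%R])
     (f c * (normal_pdf 0 1 (tau c) * tau' c)%:E))%E.
Proof.
move=> mf f0; have mpdf := measurable_normal_pdf (0 : R) 1.
have mD : measurable D.
  rewrite (_ : D = setT `&` (fun c : R => 1 + c * A) @^-1` `]0, +oo[%classic).
    exact: mlin.
  by apply/seteqP; split => c /=; rewrite in_itv/= ?andbT// => -[].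
have mft : measurable_fun setT (fun y => f (tau_inv y)).
  exact: measurableT_comp mf measurable_tau_inv.
rewrite ge0_integral_normal_prob//; last first.
  by apply: measurableT_comp mft _; exact: oppr_measurable.
(* Reflecting the symmetric Gaussian variable removes the minus sign, after which the increasing
   substitution y = tau c applies. *)
rewrite ge0_integralNT; first last.
- by move=> y; rewrite mule_ge0// lee_fin normal_pdf_ge0.
- apply: emeasurable_funM; last exact/measurable_EFinP.
  by apply: measurableT_comp mft _; exact: oppr_measurable.
under eq_integral do rewrite opprK normal_pdfN.
rewrite (@ge0_substitution_increasing R D tau tau' tau_inv _ mD _ tau_increasing
  (fun c Dc => is_derive_tau Dc)).
- apply: eq_integral => c /set_mem Dc; rewrite tauK//.
  by rewrite -muleA -EFinM.
- move=> c c' Dc Dc' e /andP[ce ec']; rewrite /D/= in Dc Dc' *.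
  by apply: lt_le_trans Dc _; rewrite lerD2l ler_pM2r.
- apply: continuous_in_subspaceT => c /set_mem Dc.
  apply: cvgM; first exact: cvg_cst.
  apply: cvgD; last exact: cvg_cst.
  apply: cvgM; first exact: cvg_cst.
  apply: cvgV; first by rewrite expf_neq0// gt_eqF.
  apply: (@cvg_comp _ _ _ (fun c => 1 + c * A) (fun r => r ^+ 2)).
    by apply: cvgD; [exact: cvg_cst|apply: cvgM; [exact: cvg_id|exact: cvg_cst]].
  exact: exprn_continuous.
- by move=> c _; exact/ltW/tau'_gt0.
- exact: tau_inv_in.
- exact: tau_invK.
- exact: measurable_tau.
- exact: measurable_tau'.
- by apply: emeasurable_funM => //; exact/measurable_EFinP.
- by move=> y; rewrite mule_ge0// lee_fin normal_pdf_ge0.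
Qed.

End gaussian_transform.

(** * The averaged density has total mass one *)

Section total_mass.
Context {R : realType}.
Variables (x b A : R).
Hypothesis A0 : 0 < A.
Local Notation mu := (@lebesgue_measure R).

Let M := expR b * cosh x.
Let C := cosh (x + b).

Let M0 : 0 < M. Proof. by rewrite mulr_gt0 ?expR_gt0 ?cosh_gt0. Qed.
Let C0 : 0 < C. Proof. exact: cosh_gt0. Qed.

Let sA0 : 0 < Num.sqrt A. Proof. by rewrite sqrtr_gt0. Qed.

Let sAA : Num.sqrt A * Num.sqrt A = A.
Proof. by rewrite -expr2 sqr_sqrtr// ltW. Qed.

Let s (c : R) := 1 - c * A.
Let D : set R := [set c | c * A < 1].

Let G c := (M / Num.sqrt (s c) - C * Num.sqrt (s c)) / Num.sqrt A.
Let G' c := Num.sqrt A / 2 * (C / Num.sqrt (s c) + M / (s c * Num.sqrt (s c))).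

(** The positive root r of C r^2 + sqrt A y r = M, which is the equation G c = y in the unknown r =
    sqrt(1 - c A). *)
Let root y := (Num.sqrt (A * y ^+ 2 + 4 * C * M) - Num.sqrt A * y) / (2 * C).
Let Gi y := (1 - root y ^+ 2) / A.

Let odd y := Num.sqrt A * y / Num.sqrt (A * y ^+ 2 + 4 * C * M).

Let disc_gt0 y : 0 < A * y ^+ 2 + 4 * C * M.
Proof. 
have h : 0 <= A * y ^+ 2 by rewrite mulr_ge0 ?sqr_ge0// ltW.
have h' : 0 < 4 * C * M by apply: mulr_gt0 => //; apply: mulr_gt0.
exact: ltr_wpDl. Qed.

Let sdisc y : Num.sqrt A * `|y| < Num.sqrt (A * y ^+ 2 + 4 * C * M).
Proof.
rewrite -[`|y|]sqrtr_sqr -sqrtrM ?ltW// ltr_sqrt//.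
by rewrite ltrDl; apply: mulr_gt0 => //; apply: mulr_gt0.
Qed.

Let odd_itv y : -1 <= odd y <= 1.
Proof.
rewrite -ler_norml /odd normrM normfV (gtr0_norm (x := Num.sqrt _))// ?sqrtr_gt0//.
by rewrite ler_pdivrMr ?sqrtr_gt0// mul1r normrM (gtr0_norm sA0) ltW.
Qed.

Let oddN y : odd (- y) = - odd y.
Proof. by rewrite /odd sqrrN mulrN mulNr. Qed.

Let sqrt_s_gt0 c : D c -> 0 < Num.sqrt (s c).
Proof. by rewrite /D /= sqrtr_gt0 subr_gt0. Qed.

Let sqrt_sK c : D c -> Num.sqrt (s c) ^+ 2 = s c.
Proof. by rewrite /D /= => h; rewrite sqr_sqrtr// subr_ge0 ltW. Qed.

Let root_gt0 y : 0 < root y.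
Proof.
apply: divr_gt0; last exact: mulr_gt0.
rewrite subr_gt0; apply: le_lt_trans (sdisc y).
by rewrite ler_pM2l// ler_norm.
Qed.

Let s_Gi y : s (Gi y) = root y ^+ 2.
Proof. by rewrite /s /Gi; field; rewrite gt_eqF. Qed.

Let Gi_in y : D (Gi y).
Proof.
have := root_gt0 y => r0; have : 0 < s (Gi y) by rewrite s_Gi exprn_gt0.
by rewrite /s subr_gt0.
Qed.

Let GiK y : G (Gi y) = y.
Proof.
have r0 := root_gt0 y.
rewrite /G s_Gi sqrtr_sqr gtr0_norm//.
have e : C * root y ^+ 2 + Num.sqrt A * y * root y = M.
  rewrite /root; set q := Num.sqrt (_ + _).
  have qq : q * q = A * y ^+ 2 + 4 * C * M by rewrite -expr2 sqr_sqrtr// ltW.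
  have -> : C * ((q - Num.sqrt A * y) / (2 * C)) ^+ 2 +
      Num.sqrt A * y * ((q - Num.sqrt A * y) / (2 * C)) =
      (q * q - (Num.sqrt A * Num.sqrt A) * y ^+ 2) / (4 * C).
    by field; rewrite gt_eqF.
  by rewrite qq sAA; field; rewrite gt_eqF.
rewrite -e; field; rewrite !gt_eqF//.
Qed.

Let is_derive_G c : D c -> is_derive c 1 G (G' c).
Proof.
move=> Dc; have q0 := sqrt_s_gt0 Dc; have qq := sqrt_sK Dc.
have s0 : 0 < s c by rewrite subr_gt0.
have d1 : is_derive c 1 s (- A).
  by rewrite /s; apply: is_derive_eq; rewrite /GRing.scale/=; ring.
have ds := is_derive1_sqrt s0.
have d2 : is_derive c 1 (fun c => Num.sqrt (s c)) ((2 * Num.sqrt (s c))^-1 * - A).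
  exact: (@is_derive1_comp _ Num.sqrt s).
have d3 : is_derive c 1 (fun c => (Num.sqrt (s c))^-1)
    (- (Num.sqrt (s c)) ^- 2 *: ((2 * Num.sqrt (s c))^-1 * - A)).
  by apply: is_deriveV; rewrite gt_eqF.
rewrite /G; apply: is_derive_eq; rewrite /G' /GRing.scale/=.
rewrite !mulr0 !add0r ?addr0.
move: q0 qq sA0 sAA; set q := Num.sqrt (s c) => q0 <-.
set a := Num.sqrt A => a0 aA; rewrite -aA; field; rewrite !gt_eqF//.
Qed.

Let G'_gt0 c : D c -> 0 < G' c.
Proof.
move=> Dc; have q0 := sqrt_s_gt0 Dc.
have s0 : 0 < s c by rewrite subr_gt0.
have h1 : 0 < C / Num.sqrt (s c) by rewrite divr_gt0.
have h2 : 0 < M / (s c * Num.sqrt (s c)) by rewrite divr_gt0// mulr_gt0.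
by rewrite mulr_gt0 ?divr_gt0// addr_gt0.
Qed.

Let G_increasing : {in D &, {homo G : c c' / c < c'}}.
Proof.
move=> c c' /set_mem Dc /set_mem Dc' cc'.
have q0 := sqrt_s_gt0 Dc; have q0' := sqrt_s_gt0 Dc'.
have qq : Num.sqrt (s c') < Num.sqrt (s c).
  by rewrite ltr_sqrt ?subr_gt0// ltrD2l ltrN2 ltr_pM2r.
rewrite ltr_pM2r ?invr_gt0//; apply: ltrB; first by rewrite ltr_pM2l// ltf_pV2.
by rewrite ltr_pM2l.
Qed.

(** With s = 1 - c A, the dilated path has endpoint b - ln s and functional A / s, so tau is (e^b
    sinh x / s - sinh(x + b)) sqrt s / sqrt A. Comparing with [G], the formula cosh u cosh v - sinh
    u sinh v = cosh(u - v) gives G^2 - tau^2 = c (e^{2b} / s - 1), which is exactly what the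
    exponential in the density supplies ([E2]). The Jacobian tau' / s is (1 - odd(G)) G' ([E1]). *)
Let density_identity c : D c ->
  normal_pdf 0 1 (tau x (b - ln (1 - c * A)) (A / (1 - c * A)) c) *
    tau' x (b - ln (1 - c * A)) (A / (1 - c * A)) c *
    ((1 - c * A)^-1 * expR (- (c / 2 * (expR (2 * b) / (1 - c * A) - 1)))) =
  normal_pdf 0 1 (G c) * (1 - odd (G c)) * G' c.
Proof.
move=> Dc; have q0 := sqrt_s_gt0 Dc; have qq := sqrt_sK Dc.
have S0 : 0 < s c by rewrite subr_gt0.
have cE : c = (1 - s c) / A by rewrite /s; field; rewrite gt_eqF.
have X0 := expR_gt0 x; have E0 := expR_gt0 b.
have eb : expR (b - ln (s c)) = expR b / s c by rewrite expRD expRN lnK.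
have exb : expR (x + (b - ln (s c))) = expR x * (expR b / s c) by rewrite expRD eb.
have e1 : 1 + c * (A / s c) = (s c)^-1 by rewrite /s; field; rewrite gt_eqF.
have e2 : expR (2 * b) = expR b ^+ 2 by rewrite mulr2n mulrDl mul1r expRD.
have aq : Num.sqrt (A / s c) = Num.sqrt A / Num.sqrt (s c).
  by rewrite sqrtrM ?ltW// sqrtrV// ltW.
have ME : M = expR b * (expR x + (expR x)^-1) / 2 by rewrite /M /cosh expRN mulrA.
have CE : C = (expR x * expR b + (expR x * expR b)^-1) / 2.
  by rewrite /C /cosh expRN expRD.
have d0 : 0 < M / Num.sqrt (s c) + C * Num.sqrt (s c).
  by rewrite addr_gt0 ?divr_gt0// mulr_gt0.
have oddE : odd (G c) = (M / Num.sqrt (s c) - C * Num.sqrt (s c)) /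
    (M / Num.sqrt (s c) + C * Num.sqrt (s c)).
  rewrite /odd (_ : A * G c ^+ 2 + 4 * C * M =
      (M / Num.sqrt (s c) + C * Num.sqrt (s c)) ^+ 2).
    by rewrite sqrtr_sqr gtr0_norm// /G mulrCA divff ?mulr1// gt_eqF.
  rewrite /G; move: q0 sA0 sAA; set q := Num.sqrt (s c); set a := Num.sqrt A.
  by move=> q0 a0 <-; field; rewrite !gt_eqF.
have E1 : tau' x (b - ln (s c)) (A / s c) c / s c = (1 - odd (G c)) * G' c.
  rewrite /tau' exb e1 aq oddE /G'.
  have -> : (1 - (M / Num.sqrt (s c) - C * Num.sqrt (s c)) /
      (M / Num.sqrt (s c) + C * Num.sqrt (s c))) =
      2 * (C * Num.sqrt (s c)) / (M / Num.sqrt (s c) + C * Num.sqrt (s c)).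
    move: (M / Num.sqrt (s c)) (C * Num.sqrt (s c)) d0 => m k u0.
    by field; rewrite gt_eqF.
  have -> : Num.sqrt A / 2 * (C / Num.sqrt (s c) + M / (s c * Num.sqrt (s c))) =
      Num.sqrt A / (2 * s c) * (M / Num.sqrt (s c) + C * Num.sqrt (s c)).
    by move: q0 qq; set q := Num.sqrt (s c) => q0 <-; field; rewrite gt_eqF.
  have -> : 2 * (C * Num.sqrt (s c)) / (M / Num.sqrt (s c) + C * Num.sqrt (s c)) *
     (Num.sqrt A / (2 * s c) * (M / Num.sqrt (s c) + C * Num.sqrt (s c))) =
     C * Num.sqrt (s c) * Num.sqrt A / s c.
    move: (M / Num.sqrt (s c) + C * Num.sqrt (s c)) d0 => u u0.
    by field; rewrite !gt_eqF.
  rewrite CE; move: q0 qq; set q := Num.sqrt (s c) => q0 <-.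
  by field; rewrite !gt_eqF.
have E2 : tau x (b - ln (s c)) (A / s c) c ^+ 2 + c * (expR b ^+ 2 / s c - 1) =
    G c ^+ 2.
  rewrite (_ : c * (expR b ^+ 2 / s c - 1) =
    (1 - s c) / A * (expR b ^+ 2 / s c - 1)); last by rewrite -cE.
  rewrite /tau exb eb e1 aq /G ME CE /sinh expRN.
  move: q0 qq sA0 sAA; set q := Num.sqrt (s c) => q0 <-.
  set a := Num.sqrt A => a0 <-.
  by field; rewrite !gt_eqF.
rewrite -/(s c) e2 !normal_pdfE ?oner_neq0// /normal_fun !subr0.
set p := normal_peak 1.
transitivity (p * (expR (- tau x (b - ln (s c)) (A / s c) c ^+ 2 / (1 ^+ 2 *+ 2)) *
    expR (- (c / 2 * (expR b ^+ 2 / s c - 1)))) *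
    (tau' x (b - ln (s c)) (A / s c) c / s c)).
  ring.
rewrite -expRD E1 -E2 -!mulrA; congr (_ * (expR _ * _)).
by rewrite expr1n; field; rewrite gt_eqF.
Qed.

(* [dc] times the density of [c] is [phi(w) (1 - odd w) dw] with [w = G c], and
   the odd part does not contribute. *)
Lemma tau_density_mass :
  (\int[mu]_(c in [set c | (c * A < 1)%R])
    (normal_pdf 0 1 (tau x (b - ln (1 - c * A)) (A / (1 - c * A)) c) *
     tau' x (b - ln (1 - c * A)) (A / (1 - c * A)) c *
     ((1 - c * A)^-1 * expR (- (c / 2 * (expR (2 * b) / (1 - c * A) - 1)))))%:E
   = 1)%E.
Proof.
have mpdf := measurable_normal_pdf (0 : R) 1.
have mlin : measurable_fun setT s.
  by apply: measurable_funB => //; exact: measurable_funM.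
have mD : measurable D.
  rewrite (_ : D = setT `&` s @^-1` `]0, +oo[%classic); first exact: mlin.
  by apply/seteqP; split => c /=; rewrite /s in_itv/= ?andbT subr_gt0// => -[].
have msqrt : measurable_fun setT (@Num.sqrt R).
  by apply: continuous_measurable_fun; exact: sqrt_continuous.
have mq : measurable_fun setT (fun c => Num.sqrt (s c)) by exact: measurableT_comp.
have mqV : measurable_fun setT (fun c => (Num.sqrt (s c))^-1).
  exact: (measurableT_comp measurable_invr).
have mG : measurable_fun setT G.
  by apply: measurable_funM => //; apply: measurable_funB; exact: measurable_funM.
have mG' : measurable_fun setT G'.
  apply: measurable_funM => //; apply: measurable_funD; first exact: measurable_funM.
  apply: measurable_funM => //; apply: (measurableT_comp measurable_invr).
  exact: measurable_funM.
have modd : measurable_fun setT odd.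
  apply: measurable_funM; first exact: measurable_funM.
  apply: (measurableT_comp measurable_invr); apply: measurableT_comp => //.
  by apply: measurable_funD => //; apply: measurable_funM => //; exact: measurable_funX.
pose H y := normal_pdf 0 1 y * (1 - odd y).
have mH : measurable_fun setT H.
  by apply: measurable_funM => //; exact: measurable_funB.
have H0 y : 0 <= H y.
  by rewrite mulr_ge0 ?normal_pdf_ge0// subr_ge0; case/andP: (odd_itv y).
transitivity (\int[mu]_y (H y)%:E)%E.
  rewrite (@ge0_substitution_increasing R D G G' Gi _ mD _ G_increasing
    (fun c Dc => is_derive_G Dc)).
  - apply: eq_integral => c /set_mem Dc; rewrite -EFinM; congr (_%:E).
    exact: density_identity.
  - move=> c c' Dc Dc' e /andP[ce ec']; rewrite /D/= in Dc Dc' *.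
    by apply: le_lt_trans Dc'; rewrite ler_pM2r.
  - apply: continuous_in_subspaceT => c /set_mem Dc.
    have cs : s c @[c --> c] --> s c.
      by apply: cvgB; [exact: cvg_cst|apply: cvgM; [exact: cvg_id|exact: cvg_cst]].
    have cq : Num.sqrt (s c) @[c --> c] --> Num.sqrt (s c).
      exact: (continuous_cvg _ (@sqrt_continuous R (s c)) cs).
    apply: cvgM; first exact: cvg_cst.
    have q0 := sqrt_s_gt0 Dc; have s0 : 0 < s c by rewrite subr_gt0.
    apply: cvgD; apply: cvgM; first exact: cvg_cst.
    + by apply: cvgV => //; rewrite gt_eqF.
    + exact: cvg_cst.
    + by apply: cvgV; [rewrite gt_eqF// mulr_gt0|exact: cvgM].
  - by move=> c Dc; exact/ltW/G'_gt0.
  - exact: Gi_in.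
  - exact: GiK.
  - exact: mG.
  - exact: mG'.
  - exact/measurable_EFinP.
  - by move=> y; rewrite lee_fin.
(* Adding the integral to its reflection cancels the odd part while every integrand stays
   nonnegative; what remains is twice the Gaussian mass. The value 2 also excludes an infinite
   [J]. *)
pose J := (\int[mu]_y (H y)%:E)%E.
have J2 : (J + J = 2%:E)%E.
  have mHE : measurable_fun setT (fun y => (H y)%:E) by exact/measurable_EFinP.
  have HE0 y : (0 <= (H y)%:E)%E by rewrite lee_fin.
  rewrite {2}/J (ge0_integralNT mHE HE0).
  have mHN : measurable_fun setT (fun y : R => H (- y)).
    by apply: measurableT_comp mH _; exact: oppr_measurable.
  have mHNE : measurable_fun setT (fun y : R => (H (- y))%:E) by exact/measurable_EFinP.
  rewrite /J -ge0_integralD//.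
  transitivity (\int[mu]_y (2%:E * (normal_pdf 0 1 y)%:E))%E.
    apply: eq_integral => y _; rewrite -EFinD -EFinM; congr (_%:E).
    by rewrite /H normal_pdfN oddN; ring.
  rewrite ge0_integralZl_EFin ?integral_normal_pdf ?mule1//.
    by move=> y _; rewrite lee_fin normal_pdf_ge0.
  exact/measurable_EFinP.
rewrite -/J; have J0 : (0 <= J)%E.
  by apply: integral_ge0 => y _; rewrite lee_fin.
move: J J0 J2 => [r| |]//= r0 [] e; congr (_%:E); lra.
Qed.

End total_mass.

(** * Quasi-invariance for parameters of both signs *)

Section signed_dilation.
Context {R : realType} {d : measure_display} {T : measurableType d}.
Variables (P : probability T R) (B : continuous_process R T).
Hypothesis BM : brownian_motion P B.
Variables (t : R).
Hypothesis t0 : 0 < t.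

Let Y w := process_path t B w.

Let tt : 0 <= t <= t. Proof. by rewrite lexx ltW. Qed.

Lemma dilate0 (phi : Cspace t) : dilate 0 phi = phi.
Proof.
apply: Cspace_ext => s st; rewrite dilate_extend ?mul0r ?addr0 ?ltr01//.
by rewrite ln1 subr0.
Qed.

(** The dilation replaces 1 - c A_t by its reciprocal, so Jacobians and exponents cancel, as they
    must for the density of the inverse map. *)
Lemma dilate_density_inv (c : R) (phi : Cspace t) : c * expA (extend phi) t < 1 ->
  dilate_density (- c) (dilate (- c) phi) * dilate_density c phi = 1.
Proof.
move=> c1; have s0 : 0 < 1 + - c * expA (extend phi) t by rewrite mulNr subr_gt0.
have A1 : - c * expA (extend (dilate (- c) phi)) t < 1.
  by rewrite -subr_gt0 dilate_expA_arg// invr_gt0.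
rewrite /dilate_density c1 A1 dilate_expA_arg// dilate_extend// invrK.
rewrite mulNr; set S := 1 - _; have S0 : 0 < S by rewrite subr_gt0.
have -> : expR (2 * (extend phi t - ln S)) = expR (2 * extend phi t) / S ^+ 2.
  by rewrite mulrBr expRD expRN [2 * ln S]mulrC mulrDr mulr1 expRD lnK.
rewrite mulrACA divff ?gt_eqF// mul1r -expRD -expR0; congr expR.
by clearbody S; field; rewrite !gt_eqF ?expR_gt0.
Qed.

(** For c < 0 the case of the positive parameter -c is applied to the integrand of the right-hand
    side; the two dilations cancel, their densities multiply to 1, and the indicator records where
    the density of parameter -c is nonzero. *)
Lemma brownian_dilate_signed (c : R) (F : borel (Cspace t) -> \bar R) :
  measurable_fun setT F -> (forall phi, 0 <= F phi)%E ->
  (\int[P]_w (F (Y w) * (0 < 1 + c * expA (extend (Y w)) t)%R%:R%:E) =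
   \int[P]_w (F (dilate (- c) (Y w)) * (dilate_density c (Y w))%:E))%E.
Proof.
move=> mF F0; have A0 w : 0 <= expA (extend (Y w)) t by exact: expA_ge0.
have [c0|c0|<-] := ltgtP 0 c; last 1 first.
- apply: eq_integral => w _; rewrite oppr0 dilate0 mul0r addr0 ltr01.
  by rewrite /dilate_density !mul0r ltr01 subr0 invr1 oppr0 expR0 mulr1.
- rewrite -brownian_dilate//; apply: eq_integral => w _.
  by rewrite ltr_wpDr ?mule1// mulr_ge0// ltW.
have c0' : 0 < - c by rewrite oppr_gt0.
pose F' (phi : borel (Cspace t)) :=
  (F (dilate (- c) phi) * (dilate_density c phi)%:E)%E.
have md : measurable_fun setT (@dilate_density R t c : borel (Cspace t) -> R).
  by apply: measurable_dilate_density.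
have mF' : measurable_fun setT F'.
  apply: emeasurable_funM; last exact/measurable_EFinP.
  apply: measurableT_comp mF _.
  exact: (measurable_dilate t0 (measurable_cst (- c)) (@measurable_id _ _ setT)).
have F'0 phi : (0 <= F' phi)%E by rewrite mule_ge0// lee_fin dilate_density_ge0.
rewrite -[RHS]/(\int[P]_w F' (Y w))%E (brownian_dilate BM t0 c0' mF' F'0).
apply: eq_integral => w _; rewrite /F' !opprK.
have [c1|c1] := ltP (- c * expA (extend (Y w)) t) 1.
  have c2 : 0 < 1 + c * expA (extend (Y w)) t.
    by move: c1; rewrite mulNr; lra.
  rewrite c2 mule1 -muleA -EFinM dilateK//.
  by have := dilate_density_inv c1; rewrite opprK => ->; rewrite mule1.
rewrite ltNge; have -> : 1 + c * expA (extend (Y w)) t <= 0.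
  by move: c1; rewrite mulNr; lra.
by rewrite mule0 [dilate_density (- c) _]/dilate_density ltNge c1 mule0.
Qed.

End signed_dilation.

(** * Averaging over the random parameter and equality in law *)

Section path_continuity.
Context {R : realType}.

Lemma continuous_prodr (K : nat) (f : nat -> R -> R) :
  (forall j, (j < K)%N -> continuous (f j)) ->
  continuous (fun y => \prod_(j < K) f j y).
Proof.
elim: K => [|K IH] cf y.
  by under eq_fun do rewrite big_ord0; exact: cvg_cst.
under eq_fun do rewrite big_ord_recr.
by apply: cvgM; [apply: IH => j jK; apply/cf/ltnW|exact: cf].
Qed.

Lemma continuous_Argsh : continuous (@Argsh R).
Proof.
move=> y; apply: (@cvg_comp _ _ _ (fun y : R => y + Num.sqrt (1 + y ^+ 2)) (@ln R)).
  apply: cvgD; first exact: cvg_id.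
  apply: (@cvg_comp _ _ _ (fun y : R => 1 + y ^+ 2) Num.sqrt).
    by apply: cvgD; [exact: cvg_cst|exact: exprn_continuous].
  exact: sqrt_continuous.
by apply: continuous_ln; exact: Argsh_arg_gt0.
Qed.

Lemma continuous_transform_extend (t s : R) (phi : Cspace t) : 0 < t -> 0 <= s <= t ->
  continuous (fun z => extend (transform z phi) s).
Proof.
move=> t0 st z; under eq_fun do rewrite transform_extend//.
apply: cvgB; first exact: cvg_cst.
apply: (@cvg_comp _ _ _ (fun z => 1 + expA (extend phi) s / expA (extend phi) t *
  (expR z - 1)) (@ln R)).
  apply: cvgD; first exact: cvg_cst.
  apply: cvgM; first exact: cvg_cst.
  by apply: cvgB; [exact: continuous_expR|exact: cvg_cst].
apply: continuous_ln.
exact: (transform_arg_gt0 z phi (SigSub (mem_segment st))).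
Qed.

End path_continuity.

Section random_transform.
Context {R : realType} {d : measure_display} {T : measurableType d}.
Variables (P : probability T R) (B beta : continuous_process R T) (t x : R).
Hypothesis t0 : 0 < t.
Hypothesis BM : brownian_motion P B.
Hypothesis BMbeta : brownian_motion P beta.
Hypothesis indep : independent_processes P B beta.

Let Y w := process_path t B w.
Let A (phi : Cspace t) := expA (extend phi) t.
Let e (phi : Cspace t) := extend phi t.

Let tt : 0 <= t <= t. Proof. by rewrite lexx ltW. Qed.

Let A0 phi : 0 < A phi.
Proof. by apply: extend_expA_gt0; rewrite ?t0 ?lexx. Qed.

Let mY : measurable_fun setT (Y : T -> borel (Cspace t)).
Proof. exact: measurable_process_path. Qed.

Let mA : measurable_fun setT (A : borel (Cspace t) -> R).
Proof. exact: expA_measurable. Qed.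

Let me : measurable_fun setT (e : borel (Cspace t) -> R).
Proof. exact: extend_measurable. Qed.

Definition shift_path (phi : Cspace t) (y : R) : Cspace t :=
  transform (x + e phi - Argsh (expR (e phi) * sinh x + y)) phi.

Lemma measurable_shift_path d' (T' : measurableType d') (Z : T' -> Cspace t)
    (y : T' -> R) :
  measurable_fun setT (Z : T' -> borel (Cspace t)) -> measurable_fun setT y ->
  measurable_fun setT ((fun w => shift_path (Z w) (y w)) : T' -> borel (Cspace t)).
Proof.
move=> mZ my; apply: measurable_transform => //.
have meZ := measurableT_comp me mZ.
apply: measurable_funB; first exact: measurable_funD.
apply: (measurableT_comp measurable_Argsh); apply: measurable_funD => //.
by apply: measurable_funM => //; exact: measurableT_comp.
Qed.

(* The density of the parameter [c] of the dilation when [y] is a centred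
   Gaussian variable of variance [A phi]. *)
Let q (c : R) phi := normal_pdf 0 1 (tau x (e phi) (A phi) c) * tau' x (e phi) (A phi) c.

Let q_ge0 c phi : 0 <= q c phi.
Proof. by rewrite mulr_ge0 ?normal_pdf_ge0// ltW// tau'_gt0. Qed.

Let mq d' (T' : measurableType d') (c : T' -> R) (Z : T' -> Cspace t) :
  measurable_fun setT c -> measurable_fun setT (Z : T' -> borel (Cspace t)) ->
  measurable_fun setT (fun w => q (c w) (Z w)).
Proof.
move=> mc mZ; have mAZ := measurableT_comp mA mZ; have meZ := measurableT_comp me mZ.
have minv (f : T' -> R) : measurable_fun setT f -> measurable_fun setT (fun w => (f w)^-1).
  exact: (measurableT_comp measurable_invr).
have msqrt : measurable_fun setT (fun w => Num.sqrt (A (Z w))).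
  apply: measurableT_comp mAZ.
  by apply: continuous_measurable_fun; exact: sqrt_continuous.
have mE : measurable_fun setT (fun w => expR (x + e (Z w))).
  by apply: measurableT_comp => //; exact: measurable_funD.
have mr : measurable_fun setT (fun w => 1 + c w * A (Z w)).
  by apply: measurable_funD => //; exact: measurable_funM.
apply: measurable_funM.
  apply: (measurableT_comp (measurable_normal_pdf 0 1)).
  apply: measurable_funM; last exact: minv.
  apply: measurable_funB; first by apply: measurable_funM => //; exact: measurableT_comp.
  apply: measurable_funM => //; apply: measurable_funB; apply: measurable_funM => //;
    exact: minv.
apply: measurable_funM; first exact: measurable_funM.
apply: measurable_funD; last exact: minv.
by apply: measurable_funM => //; apply: minv; exact: measurable_funX.
Qed.

Section product.
Variables (m : nat) (g : nat -> R -> R).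
Hypothesis g01 : forall k x, 0 <= g k x <= 1.
Hypothesis cg : forall k, continuous (g k).

Let cyl := @cylinder_prod R t m g.

Let cyl_ge0 phi : 0 <= cyl phi.
Proof. by case/andP: (cylinder_prod_itv m phi g01). Qed.

Let mcyl : measurable_fun setT (cyl : borel (Cspace t) -> R).
Proof.
by apply: cylinder_prod_measurable => // k; exact: continuous_measurable_fun.
Qed.

Let continuous_cyl phi : continuous (fun y => cyl (shift_path phi y)).
Proof.
apply: (continuous_prodr
  (f := fun j y => g j (extend (shift_path phi y) (grid t m j.+1)))) => j jm y.
apply: (@cvg_comp _ _ _ (fun y => extend (shift_path phi y) (grid t m j.+1)) (g j));
  last exact: cg.
apply: (@cvg_comp _ _ _ (fun y => x + e phi - Argsh (expR (e phi) * sinh x + y))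
  (fun z => extend (transform z phi) (grid t m j.+1))); last first.
  by apply: continuous_transform_extend => //; exact: grid_itv.
apply: cvgB; first exact: cvg_cst.
apply: (@cvg_comp _ _ _ (fun y => expR (e phi) * sinh x + y) (@Argsh R)).
  by apply: cvgD; [exact: cvg_cst|exact: cvg_id].
exact: continuous_Argsh.
Qed.

(** Given the path, the Gaussian average is an average over dilations, with density [q] on the
    parameters such that 1 + c A > 0. *)
Let gaussE phi :
  (\int[normal_prob 0 1]_xi (cyl (shift_path phi (Num.sqrt (A phi) * xi)))%:E =
   \int[lebesgue_measure]_c ((cyl (dilate c phi) * q c phi)%:E *
     (0 < 1 + c * A phi)%R%:R%:E))%E.
Proof.
have mf : measurable_fun setT (fun c => (cyl (dilate c phi))%:E).
  apply/measurable_EFinP; apply: (measurableT_comp mcyl).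
  by apply: (measurable_dilate t0 (@measurable_id _ R setT)); exact: measurable_cst.
have f0 c : (0 <= (cyl (dilate c phi))%:E)%E by rewrite lee_fin.
transitivity (\int[normal_prob 0 1]_xi
    (cyl (dilate (tau_inv x (e phi) (A phi) (- xi)) phi))%:E)%E.
  apply: eq_integral => xi _; congr (cyl _)%:E.
  by rewrite /shift_path (transform_dilate t0) /tau_inv mulrN opprK.
rewrite (ge0_integral_tau x (e phi) (A0 phi) mf f0) integral_mkcond.
apply: eq_integral => c _; rewrite patchE /=.
rewrite (_ : (c \in _) = (0 < 1 + c * A phi)); last by apply/idP/idP; rewrite inE.
by case: (0 < _); rewrite ?mule1 ?mule0// EFinM.
Qed.

(** [dilate (- c) phi] has endpoint and functional exactly those occurring in [tau_density_mass]. *)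
Let mass phi :
  (\int[lebesgue_measure]_c (q c (dilate (- c) phi) * dilate_density c phi)%:E = 1)%E.
Proof.
rewrite -(tau_density_mass x (e phi) (A0 phi)) [RHS]integral_mkcond.
apply: eq_integral => c _; rewrite patchE /= /dilate_density -/(A phi).
rewrite (_ : (c \in _) = (c * A phi < 1)); last by apply/idP/idP; rewrite inE.
case: ifPn => c1; last by rewrite mulr0.
have s0 : 0 < 1 + - c * A phi by rewrite mulNr subr_gt0.
by rewrite /q /e /A dilate_extend// dilate_expA// mulNr.
Qed.

(** Tonelli exchanges the path and the parameter; for each fixed [c], [brownian_dilate_signed] moves
    the dilation from the test functional onto the density; exchanging back, the inner integral is
    [mass]. *)
Lemma random_transform_product :
  (\int[P]_w (cyl (shift_path (Y w) (beta (A (Y w)) w)))%:E =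
   \int[P]_w (cyl (Y w))%:E)%E.
Proof.
have mH : measurable_fun setT
    (fun z : borel (Cspace t) * R => cyl (shift_path z.1 z.2)).
  apply: (measurableT_comp mcyl); apply: measurable_shift_path.
    exact: measurable_fst.
  exact: measurable_snd.
rewrite (integral_random_time t0 BMbeta indep mH)//; last first.
  by move=> z; exact: cylinder_prod_itv.
under eq_integral do rewrite gaussE.
pose K (z : T * R) := ((cyl (dilate z.2 (Y z.1)) * q z.2 (Y z.1))%:E *
     (0 < 1 + z.2 * A (Y z.1))%R%:R%:E)%E.
pose K' (z : T * R) := ((cyl (Y z.1))%:E *
  (q z.2 (dilate (- z.2) (Y z.1)) * dilate_density z.2 (Y z.1))%:E)%E.
have mY1 : measurable_fun setT ((fun z : T * R => Y z.1) : _ -> borel (Cspace t)).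
  exact: (measurableT_comp mY measurable_fst).
have m2 : measurable_fun setT (fun z : T * R => z.2) by exact: measurable_snd.
have mdil (c : T * R -> R) : measurable_fun setT c ->
    measurable_fun setT ((fun z => dilate (c z) (Y z.1)) : _ -> borel (Cspace t)).
  by move=> mc; exact: measurable_dilate.
have mcA : measurable_fun setT (fun z : T * R => z.2 * A (Y z.1)).
  by apply: measurable_funM => //; exact: (measurableT_comp mA mY1).
have mK : measurable_fun setT K.
  apply: emeasurable_funM; apply/measurable_EFinP.
    apply: measurable_funM; last exact: mq.
    exact: (measurableT_comp mcyl (mdil _ m2)).
  apply: (measurableT_comp (f := fun b : bool => b%:R : R)) => //.
  by apply: measurable_fun_ltr => //; exact: measurable_funD.
have mN : measurable_fun setT (fun z : T * R => - z.2).
  exact: (measurableT_comp (@oppr_measurable R setT) m2).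
have mdens : measurable_fun setT (fun z : T * R => dilate_density z.2 (Y z.1)).
  exact: measurable_dilate_density.
have mK' : measurable_fun setT K'.
  apply: emeasurable_funM; apply/measurable_EFinP.
    exact: (measurableT_comp mcyl mY1).
  apply: measurable_funM => //; apply: mq => //; exact: mdil.
have K0 z : (0 <= K z)%E by rewrite mule_ge0// lee_fin// mulr_ge0.
have K'0 z : (0 <= K' z)%E.
  by rewrite mule_ge0// lee_fin// mulr_ge0// dilate_density_ge0.
transitivity (\int[P]_w \int[lebesgue_measure]_c K (w, c))%E => //.
rewrite (@fubini_tonelli _ _ _ _ _ P (@lebesgue_measure R) K mK K0).
transitivity (\int[lebesgue_measure]_c \int[P]_w K' (w, c))%E.
  apply: eq_integral => c _.
  have mF : measurable_fun setT
      ((fun phi => (cyl (dilate c phi) * q c phi)%:E) : borel (Cspace t) -> \bar R).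
    apply/measurable_EFinP; apply: measurable_funM; last first.
      by apply: mq; [exact: measurable_cst|exact: measurable_id].
    apply: (measurableT_comp mcyl); apply: (measurable_dilate t0).
      exact: measurable_cst.
    exact: measurable_id.
  have F0 (phi : borel (Cspace t)) : (0 <= (cyl (dilate c phi) * q c phi)%:E)%E.
    by rewrite lee_fin; apply: mulr_ge0.
  have := brownian_dilate_signed BM t0 c mF F0.
  rewrite /K /= => ->; apply: eq_integral => w _; rewrite /K'/=.
  rewrite -!EFinM; congr (_%:E).
  (* Where c A_t < 1 the two dilations cancel by [dilateK]; elsewhere the density vanishes on both
     sides. *)
  have [c1|c1] := ltP (c * A (Y w)) 1.
    have s0 : 0 < 1 + - c * A (Y w) by rewrite mulNr subr_gt0.
    have := dilateK t0 s0; rewrite opprK => ->.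
    by rewrite /q -!mulrA.
  by rewrite /dilate_density ltNge -/(A (Y w)) c1 /= !mulr0.
rewrite -(@fubini_tonelli _ _ _ _ _ P (@lebesgue_measure R) K' mK' K'0); apply: eq_integral => w _.
rewrite /K' /= ge0_integralZl_EFin//; first by rewrite mass mule1.
- by move=> c _; rewrite lee_fin mulr_ge0// dilate_density_ge0.
- apply/measurable_EFinP; apply: measurable_funM.
    apply: mq => //; apply: (measurable_dilate t0); last exact: measurable_cst.
    exact: oppr_measurable.
  by apply: measurable_dilate_density => //; exact: measurable_cst.
Qed.

End product.

Lemma random_transform_law (F : borel (Cspace t) -> \bar R) :
  measurable_fun setT F -> (forall phi, 0 <= F phi)%E ->
  (\int[P]_w F (shift_path (Y w) (beta (A (Y w)) w)) = \int[P]_w F (Y w))%E.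
Proof.
move=> mF F0; pose one (w : T) : R := 1.
have m1 : measurable_fun setT one by exact: measurable_cst.
have one0 w : 0 <= one w by [].
have mS : measurable_fun setT
    ((fun w => shift_path (Y w) (beta (A (Y w)) w)) : T -> borel (Cspace t)).
  by apply: measurable_shift_path => //; exact: measurable_random_time.
have fin1 : (\int[P]_w (one w)%:E < +oo)%E.
  by rewrite -[ltLHS]/(\int[P]_w 1)%E integral_cst//= mul1e probability_setT ltry.
have H := Cspace_weighted_law_unique t0 mS mY m1 m1 one0 one0 fin1 _ mF F0.
have {H} : (\int[P]_w (F (shift_path (Y w) (beta (A (Y w)) w)) * (one w)%:E) =
    \int[P]_w (F (Y w) * (one w)%:E))%E.
  apply: H => m g g01 cg.
  under eq_integral do rewrite mulr1; under [RHS]eq_integral do rewrite mulr1.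
  exact: random_transform_product.
by under eq_integral do rewrite mule1; under [X in _ = X -> _]eq_integral do rewrite mule1.
Qed.

End random_transform.

Theorem theorem1p1 (R : realType) (d : measure_display) (T : measurableType d)
    (P : probability T R) (t : R) (B beta : continuous_process R T) (x : R) :
  0 < t ->
  brownian_motion P B -> brownian_motion P beta ->
  independent_processes P B beta ->
  identical_in_law P
    (fun w : T =>
       let A_t := expA (fun s => B s w) t in
       transform
         (x + B t w - Argsh (expR (B t w) * sinh x + beta A_t w))
         (process_path t B w) : Cspace t)
    (fun w : T => process_path t B w).
Proof.
move=> t0 BM BMbeta indep; have tt : 0 <= t <= t by rewrite lexx ltW.
have mY : measurable_fun setT ((fun w => process_path t B w) : T -> borel (Cspace t)).
  exact: measurable_process_path.
pose S w := shift_path x (process_path t B w)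
  (beta (expA (extend (process_path t B w)) t) w).
have eT w : extend (process_path t B w) t = B t w by exact: process_path_extend.
(* The restricted path and the process agree on [0, t], the only times entering the functional. *)
have eA w : expA (extend (process_path t B w)) t = expA (fun s => B s w) t.
  apply: eq_Rintegral => s; rewrite inE/= in_itv/= => st.
  by rewrite process_path_extend.
have -> : (fun w : T => let A_t := expA (fun s => B s w) t in
       transform (x + B t w - Argsh (expR (B t w) * sinh x + beta A_t w))
         (process_path t B w)) = S.
  by apply/funext => w; rewrite /S /shift_path eT eA.
have mS : measurable_fun setT (S : T -> borel (Cspace t)).
  by apply: measurable_shift_path => //; exact: measurable_random_time.
split=> // E mE.
have H := random_transform_law x t0 BM BMbeta indep (F := fun phi => (\1_E phi)%:E).
have {H} : (\int[P]_w (\1_E (S w))%:E = \int[P]_w (\1_E (process_path t B w))%:E)%E.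
  apply: H => [|phi]; last by rewrite lee_fin.
  by apply/measurable_EFinP; exact: measurable_indic.
have preE (Z : T -> Cspace t) : measurable_fun setT (Z : T -> borel (Cspace t)) ->
    (\int[P]_w (\1_E (Z w))%:E = P (Z @^-1` E))%E.
  move=> mZ; have mZE : measurable (Z @^-1` E).
    by rewrite -[X in measurable X]setTI; exact: mZ.
  by rewrite -[Z @^-1` E]setIT -integral_indic.
by rewrite !preE.
Qed.
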